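(* Let $N^4$ be the simply connected nilpotent Lie group with Lie algebra $\mathfrak{n}_4$, and let $g$ be a left-invariant metric on $N^4$. Then there exists a unique solution $(g(t))_{t\in(-\varepsilon,T)}$ to the Bach flow $$\frac{\partial}{\partial t}g(t)=\operatorname{B}(g(t))+\frac{\Delta s}{12}\,g(t),\qquad g(0)=g,$$ defined on a maximal interval of existence $(-\varepsilon,T)$, which is $N^4$-invariant (i.e. each $g(t)$ is a left-invariant metric). This solution satisfies: (1) $T=\infty$, and the metrics $g(t)$ converge in the pointed Cheeger-Gromov sense to the Euclidean metric on $\mathbb{R}^4$ as $t\to\infty$. (2) If $s_t=s(g(t))$ denotes the scalar curvature of $g(t)$, then the rescaled metrics $\tilde g(t)=|s_t|\,g(t)$ converge in the pointed Cheeger-Gromov sense to an expanding Bach soliton $g_\infty$ on $N^4$ as $t\to\infty$.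
   Context: $\mathfrak{n}_4$ is the unique four-dimensional indecomposable (not a direct product of two lower-dimensional Lie algebras) nilpotent real Lie algebra: it has a basis $e_1,\dots,e_4$ whose only non-trivial brackets, up to skew-symmetry, are $[e_1,e_2]=e_3$, $[e_1,e_3]=e_4$. The Bach tensor of a Riemannian 4-manifold $(M^4,g)$ is, in local coordinates, $$\operatorname{B}(g)_{ij}=\nabla^k\nabla^l W_{kijl}+\tfrac12 R^{kl}W_{kijl},$$ where $W$ is the Weyl tensor, $R^{kl}$ is the Ricci tensor with indices raised, and the index convention for the curvature tensor is such that $R_{ij}=g^{kl}R_{kijl}$. (On compact manifolds $\operatorname{B}$ is $-\tfrac14$ times the gradient of $g\mapsto\int_M|W|^2_g\,dv(g)$, with $|W|^2=W_{ijkl}W^{ijkl}$.) In the Bach flow, $s=s(g(t))$ is the scalar curvature and $\Delta$ is the Laplace-Beltrami operator of $g(t)$; for homogeneous metrics $\Delta s\equiv0$. A Bach soliton is a Riemannian 4-manifold $(M^4,g)$ with $\operatorname{B}(g)+\frac{\Delta s}{12}g=\lambda g+\mathcal{L}_Xg$ for some constant $\lambda\in\mathbb{R}$ and some complete vector field $X$; it is expanding if $\lambda>0$. Equivalently, it is a metric whose Bach flow evolves by scaling and pullback by diffeomorphisms, with increasing scaling factor in the expanding case. Pointed Cheeger-Gromov convergence is with the identity element as base point (the choice is immaterial by homogeneity). *)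

(* Defs.v *)
From mathcomp Require Import all_boot all_order all_algebra.
From mathcomp Require Import all_classical all_reals all_analysis.
From mathcomp Require Import ring lra.

Set Implicit Arguments.
Unset Strict Implicit.
Unset Printing Implicit Defensive.

Import Order.TTheory GRing.Theory Num.Theory.
Import numFieldNormedType.Exports.

Local Open Scope classical_set_scope.
Local Open Scope ring_scope.

(* Every manifold below is diffeomorphic to R^4, so all tensor fields are
   given by their components in one global chart with values in 'rV[R]_4. *)

Section Calculus.
Context {R : realType}.
Local Notation V := 'rV[R]_4.

Definition partial (i : 'I_4) (f : V -> R) : V -> R := fun x => 'D_('e_i) f x.

Definition iter_partial (s : seq 'I_4) (f : V -> R) : V -> R :=
  foldr partial f s.

(* C^oo on an open set U: all iterated partial derivatives exist and are
   continuous at the points of U. *)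
Definition smooth_on (U : set V) (f : V -> R) : Prop :=
  forall (s : seq 'I_4) (x : V), U x ->
    {for x, continuous (iter_partial s f)} /\
    forall i : 'I_4, derivable (iter_partial s f) x 'e_i.

Definition smooth_map_on (U : set V) (F : V -> V) : Prop :=
  forall i : 'I_4, smooth_on U (fun x => F x 0 i).

Definition diffeo_onto_image (U : set V) (phi : V -> V) : Prop :=
  [/\ smooth_map_on U phi, open (phi @` U) &
      exists psi : V -> V, smooth_map_on (phi @` U) psi /\
        forall x, U x -> psi (phi x) = x].

Definition jacobian (phi : V -> V) (x : V) : 'M[R]_4 :=
  \matrix_(a, i) partial i (fun y => phi y 0 a) x.

Definition pullback (phi : V -> V) (g : V -> 'M[R]_4) : V -> 'M[R]_4 :=
  fun x => (jacobian phi x)^T *m g (phi x) *m jacobian phi x.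

End Calculus.

Section Riemannian.
Context {R : realType}.
Local Notation V := 'rV[R]_4.
Implicit Types (g : V -> 'M[R]_4) (i j k l : 'I_4) (x : V).

Definition riemannian_metric g : Prop :=
  [/\ forall i j, smooth_on setT (fun x => g x i j),
      forall x, (g x)^T = g x &
      forall x (v : V), v != 0 -> 0 < (v *m g x *m v^T) 0 0].

(* christoffel g k i j is Gamma^k_{ij}. *)
Definition christoffel g k i j : V -> R := fun x =>
  2^-1 * \sum_l invmx (g x) k l *
    (partial i (fun y => g y j l) x + partial j (fun y => g y i l) x
     - partial l (fun y => g y i j) x).

(* R_{ijkl} = g(R(d_i, d_j) d_k, d_l), where
   R(X, Y) = nabla_X nabla_Y - nabla_Y nabla_X - nabla_[X, Y];
   hence R_{ij} = g^{kl} R_{kijl}, and round spheres have positive Ricci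
   curvature. *)
Definition riemann g i j k l : V -> R := fun x =>
  \sum_a g x l a *
    (partial i (christoffel g a j k) x - partial j (christoffel g a i k) x
     + \sum_b (christoffel g b j k x * christoffel g a i b x
               - christoffel g b i k x * christoffel g a j b x)).

Definition ricci g i j : V -> R := fun x =>
  \sum_k \sum_l invmx (g x) k l * riemann g k i j l x.

Definition scal g : V -> R := fun x =>
  \sum_i \sum_j invmx (g x) i j * ricci g i j x.

(* The totally trace-free part of the Riemann tensor in dimension four. *)
Definition weyl g i j k l : V -> R := fun x =>
  riemann g i j k l x
  - 2^-1 * (ricci g i l x * g x j k + ricci g j k x * g x i l
            - ricci g i k x * g x j l - ricci g j l x * g x i k)
  + scal g x / 6 * (g x i l * g x j k - g x i k * g x j l).

(* A covariant tensor field of rank n is represented by a function on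
   multi-indices, of which only the values on lists of length n matter. *)
Definition weyl_tensor g (I : seq 'I_4) : V -> R :=
  if I is [:: i; j; k; l] then weyl g i j k l else cst 0.

(* cov_deriv g T [:: m, i_1, .., i_n] is nabla_m T_{i_1 .. i_n}. *)
Definition cov_deriv g (T : seq 'I_4 -> V -> R) (I : seq 'I_4) : V -> R :=
  if I is m :: J then fun x =>
    partial m (T J) x
    - \sum_(p < size J) \sum_a
        christoffel g a m (nth 0 J p) x * T (set_nth 0 J p a) x
  else cst 0.

Definition raised_ricci g k l : V -> R := fun x =>
  \sum_a \sum_b invmx (g x) k a * invmx (g x) l b * ricci g a b x.

Definition bach g : V -> 'M[R]_4 := fun x => \matrix_(i, j)
  (\sum_k \sum_l \sum_a \sum_b invmx (g x) k a * invmx (g x) l b *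
     cov_deriv g (cov_deriv g (weyl_tensor g)) [:: a; b; k; i; j; l] x
   + 2^-1 * \sum_k \sum_l raised_ricci g k l x * weyl g k i j l x).

Definition laplacian g (f : V -> R) : V -> R := fun x =>
  \sum_i \sum_j invmx (g x) i j *
    (partial i (partial j f) x - \sum_k christoffel g k i j x * partial k f x).

Definition bach_velocity g : V -> 'M[R]_4 := fun x =>
  bach g x + (laplacian g (scal g) x / 12) *: g x.

Definition lie_deriv (X : V -> V) g : V -> 'M[R]_4 := fun x =>
  \matrix_(i, j) \sum_k
    (X x 0 k * partial k (fun y => g y i j) x
     + g x k j * partial i (fun y => X y 0 k) x
     + g x i k * partial j (fun y => X y 0 k) x).

Definition complete_field (X : V -> V) : Prop :=
  smooth_map_on setT X /\
  forall p : V, exists c : R -> V,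
    c 0 = p /\ forall t : R, is_derive t 1 c (X (c t)).

Definition expanding_bach_soliton g : Prop :=
  riemannian_metric g /\
  exists (lambda : R) (X : V -> V),
    [/\ 0 < lambda, complete_field X &
        forall x, bach_velocity g x = lambda *: g x + lie_deriv X g x].

Definition euclidean_metric : V -> 'M[R]_4 := fun=> 1%:M.

(* Smooth pointed convergence, as t -> +oo, of (R^4, g t, 0) to
   (R^4, ginf, 0): the U t exhaust the limit manifold, the phi t are
   base-point preserving diffeomorphisms of U t onto open sets, and all
   derivatives of the pulled back metrics converge uniformly on compacts. *)
Definition cheeger_gromov_cvg (g : R -> V -> 'M[R]_4) (ginf : V -> 'M[R]_4) :
    Prop :=
  exists (U : R -> set V) (phi : R -> V -> V),
    [/\ forall t, open (U t) /\ U t 0,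
        forall K : set V, compact K -> \forall t \near +oo, K `<=` U t,
        forall t, diffeo_onto_image (U t) (phi t) /\ phi t 0 = 0 &
        forall K : set V, compact K ->
          forall (s : seq 'I_4) (i j : 'I_4) (e : R), 0 < e ->
          \forall t \near +oo, forall x, K x ->
            `|iter_partial s
                (fun y => (pullback (phi t) (g t) y - ginf y) i j) x| < e].

End Riemannian.

Section N4.
Context {R : realType}.
Local Notation V := 'rV[R]_4.

(* The basis e_1, e_2, e_3, e_4 of n_4 is 'e_0, 'e_1, 'e_2, 'e_3. *)
Definition n4_bracket (x y : V) : V :=
  (x 0 0 * y 0 1 - x 0 1 * y 0 0) *: 'e_(2 : 'I_4)
  + (x 0 0 * y 0 2 - x 0 2 * y 0 0) *: 'e_(3 : 'I_4).

(* The simply connected group N^4 is R^4 = n_4 with the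
   Baker-Campbell-Hausdorff product (n_4 is three-step nilpotent, so the
   series stops here); the chart is exp^-1, and the identity element is 0. *)
Definition n4_mul (x y : V) : V :=
  x + y + 2^-1 *: n4_bracket x y
  + 12^-1 *: (n4_bracket x (n4_bracket x y) + n4_bracket y (n4_bracket y x)).

Lemma n4_bracket_basis :
  [/\ n4_bracket 'e_0 'e_1 = 'e_2, n4_bracket 'e_0 'e_2 = 'e_3,
      n4_bracket 'e_0 'e_3 = 0 &
      [/\ n4_bracket 'e_1 'e_2 = 0, n4_bracket 'e_1 'e_3 = 0 &
          n4_bracket 'e_2 'e_3 = 0]].
Proof.
split; last split; rewrite /n4_bracket !mxE /=
  !(mulr0, mul0r, subr0, oppr0, mulr1, scale0r, scale1r, addr0, add0r) //.
Qed.

Lemma ord4_ind (P : 'I_4 -> Prop) : P 0 -> P 1 -> P 2 -> P 3 -> forall i, P i.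
Proof.
move=> P0 P1 P2 P3 [[|[|[|[|//]]]] lti]; [move: P0|move: P1|move: P2|move: P3];
  by congr P; apply/val_inj.
Qed.

Lemma n4_bracketE (x y : V) :
  (n4_bracket x y 0 0 = 0) * (n4_bracket x y 0 1 = 0)
  * (n4_bracket x y 0 2 = x 0 0 * y 0 1 - x 0 1 * y 0 0)
  * (n4_bracket x y 0 3 = x 0 0 * y 0 2 - x 0 2 * y 0 0).
Proof.
by rewrite /n4_bracket; (split; [split; [split|]|]); rewrite !mxE /=
  !(mulr0, mulr1, addr0, add0r).
Qed.

Lemma n4_mulE (x y : V) :
  (n4_mul x y 0 0 = x 0 0 + y 0 0) * (n4_mul x y 0 1 = x 0 1 + y 0 1)
  * (n4_mul x y 0 2 =
       x 0 2 + y 0 2 + 2^-1 * (x 0 0 * y 0 1 - x 0 1 * y 0 0))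
  * (n4_mul x y 0 3 =
       x 0 3 + y 0 3 + 2^-1 * (x 0 0 * y 0 2 - x 0 2 * y 0 0)
       + 12^-1 * (x 0 0 - y 0 0) * (x 0 0 * y 0 1 - x 0 1 * y 0 0)).
Proof.
have E i : n4_mul x y 0 i = x 0 i + y 0 i + 2^-1 * n4_bracket x y 0 i
  + 12^-1 * (n4_bracket x (n4_bracket x y) 0 i
             + n4_bracket y (n4_bracket y x) 0 i) by rewrite /n4_mul !mxE.
by split; [split; [split|]|]; rewrite E !n4_bracketE; ring.
Qed.

Lemma n4_mulA : associative (@n4_mul).
Proof.
move=> x y z; apply/rowP; by apply: ord4_ind;
  rewrite !n4_mulE; field.
Qed.

Lemma n4_mul0x : left_id 0 n4_mul.
Proof.
move=> x; apply/rowP; by apply: ord4_ind;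
  rewrite !n4_mulE !mxE; field.
Qed.

Lemma n4_mulx0 : right_id 0 n4_mul.
Proof.
move=> x; apply/rowP; by apply: ord4_ind;
  rewrite !n4_mulE !mxE; field.
Qed.

Lemma n4_mulNx : left_inverse 0 -%R n4_mul.
Proof.
move=> x; apply/rowP; by apply: ord4_ind;
  rewrite !n4_mulE !mxE; field.
Qed.

Lemma n4_mulxN : right_inverse 0 -%R n4_mul.
Proof.
move=> x; apply/rowP; by apply: ord4_ind;
  rewrite !n4_mulE !mxE; field.
Qed.

Lemma derive_quadratic (f : V -> V) (a v A B : V) :
  (forall h : R, f (h *: v + a) = f a + h *: A + (h ^+ 2) *: B) ->
  'D_v f a = A.
Proof.
move=> fE; rewrite /derive; apply: cvg_lim => //.
have : (fun h : R => A + h *: B) @ 0^' --> A.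
  rewrite -[X in _ --> X]addr0 -[X in _ + X](scale0r B).
  apply: cvgD; first exact: cvg_cst.
  apply: cvgZr_tmp.
  exact: cvg_within.
apply: cvg_trans; apply: near_eq_cvg.
rewrite /nbhs /= /dnbhs; near=> h.
have h0 : h != 0 by near: h; exact: nbhs_dnbhs_neq.
rewrite /= fE -(addrA (f a)) [f a + _]addrC addrK scalerDr !scalerA mulVf // scale1r.
by rewrite expr2 mulrA mulVf // mul1r.
Unshelve. all: by end_near.
Qed.

Definition n4_left_field (v : V) : V -> V := fun x => 'D_v (n4_mul x) 0.

Lemma n4_left_fieldE (v x : V) : n4_left_field v x =
  v + 2^-1 *: n4_bracket x v + 12^-1 *: n4_bracket x (n4_bracket x v).
Proof.
apply: (@derive_quadratic _ _ _ _ (12^-1 *: n4_bracket v (n4_bracket v x))).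
move=> h; rewrite n4_mulx0 addr0; apply/rowP; by apply: ord4_ind;
  rewrite !(n4_mulE, n4_bracketE, mxE); field.
Qed.

Lemma n4_left_field_coord (v x : V) :
  (n4_left_field v x 0 0 = v 0 0) * (n4_left_field v x 0 1 = v 0 1)
  * (n4_left_field v x 0 2 =
       v 0 2 + 2^-1 * (x 0 0 * v 0 1 - x 0 1 * v 0 0))
  * (n4_left_field v x 0 3 =
       v 0 3 + 2^-1 * (x 0 0 * v 0 2 - x 0 2 * v 0 0)
       + 12^-1 * x 0 0 * (x 0 0 * v 0 1 - x 0 1 * v 0 0)).
Proof.
by split; [split; [split|]|]; rewrite n4_left_fieldE !(n4_bracketE, mxE);
  rewrite ?n4_bracketE; ring.
Qed.

(* The Lie algebra of (R^4, n4_mul) is n_4. *)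
Lemma n4_left_field_bracket (v w x : V) :
  'D_(n4_left_field v x) (n4_left_field w) x
  - 'D_(n4_left_field w x) (n4_left_field v) x
  = n4_left_field (n4_bracket v w) x.
Proof.
have D u z : 'D_u (n4_left_field z) x = 2^-1 *: n4_bracket u z
    + 12^-1 *: (n4_bracket x (n4_bracket u z) + n4_bracket u (n4_bracket x z)).
  apply: (@derive_quadratic _ _ _ _ (12^-1 *: n4_bracket u (n4_bracket u z))).
  move=> h; rewrite !n4_left_fieldE; apply/rowP; by apply: ord4_ind;
  rewrite !(n4_bracketE, mxE); field.
apply: (etrans (congr2 (fun a b : V => a - b)
  (D (n4_left_field v x) w) (D (n4_left_field w x) v))).
rewrite (n4_left_fieldE (n4_bracket v w)) /=.
have := n4_left_field_coord v x; have := n4_left_field_coord w x.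
move: (n4_left_field v x) (n4_left_field w x) => a b bE aE.
apply/rowP; by apply: ord4_ind;
  rewrite !(n4_bracketE, mxE) ?n4_bracketE ?aE ?bE; field.
Qed.

Definition left_invariant_metric (g : V -> 'M[R]_4) : Prop :=
  riemannian_metric g /\ forall a x : V, pullback (n4_mul a) g x = g x.

Definition bach_flow_invariant_solution (g0 : V -> 'M[R]_4) (eps T : \bar R)
    (g : R -> V -> 'M[R]_4) : Prop :=
  [/\ (0 < eps)%E, (0 < T)%E, forall x, g 0 x = g0 x &
      forall t : R, (- eps < t%:E < T)%E ->
        left_invariant_metric (g t) /\
        forall x : V, is_derive t 1 (fun u => g u x) (bach_velocity (g t) x)].

(* Any solution with the same initial metric is a restriction of g. *)
Definition bach_flow_maximal_solution (g0 : V -> 'M[R]_4) (eps T : \bar R)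
    (g : R -> V -> 'M[R]_4) : Prop :=
  bach_flow_invariant_solution g0 eps T g /\
  forall (eps' T' : \bar R) (h : R -> V -> 'M[R]_4),
    bach_flow_invariant_solution g0 eps' T' h ->
    [/\ (eps' <= eps)%E, (T' <= T)%E &
        forall t : R, (- eps' < t%:E < T')%E -> forall x : V, h t x = g t x].

End N4.

(* Main.v *)
(* A left-invariant metric on N^4 has an orthonormal frame of left-invariant
   fields with brackets [f_0, f_1] = a f_2 + b f_3, [f_0, f_2] = c f_3, obtained
   from the LDL factorization of its Gram matrix.  In that frame the Bach tensor
   is polynomial in a, b, c, and the flow reduces to a system for A = a^2,
   B = b^2, C = c^2, with logarithmic derivatives quadratic in (A, B, C).  Put
   rho = A + B + C = -2 s.  Then rho' <= - rho^3 / 4, so rho -> 0, but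
   rho' >= - 3 rho^3, so the integral of rho^2 diverges.  Since
   (ln (A / C))' = - 2 (A - C) rho and (ln (B / A))' <= - (2 / 3) rho^2, the ratio
   A / C tends to 1 and B / A to 0.  In exponential coordinates of the adapted
   frame the metric is a fixed expression, polynomial in the point and in
   (a, b, c), so (a, b, c) -> 0 gives convergence to the flat metric, and
   after rescaling by |s| one has (a, b, c) -> (1, 0, 1), the standard metric of
   N^4.  Its Bach tensor is (35 / 24) Id plus a derivation of n_4, and the
   derivation integrates to a linear vector field. *)

From Stdlib Require Import ZArith.
Require Import Defs.
From mathcomp Require Import all_boot all_order all_algebra.
From mathcomp Require Import all_classical all_reals all_analysis.
From mathcomp Require Import ring lra ssrZ.

Set Implicit Arguments.
Unset Strict Implicit.
Unset Printing Implicit Defensive.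

Import Order.TTheory GRing.Theory Num.Theory.
Import numFieldNormedType.Exports.

Local Open Scope classical_set_scope.
Local Open Scope ring_scope.

(** * Polynomial functions on R^4 *)

(** The LDL form suits [n_4] because the spans of its last one, two or three basis vectors are
    ideals: a lower unitriangular change of coframe preserves this flag, so the dual frame has
    brackets of the stated shape. The factors are rational in the Gram matrix, so any given
    invariant solution yields the equations for them, and this is what uniqueness needs. Two
    covariant derivatives of the Weyl tensor are too large to expand in coordinates. For a tensor
    with constant components in a frame with constant structure constants, covariant differentiation
    is pure algebra, and the Bach tensor becomes a computation with integer polynomials. The ODE is
    only locally Lipschitz. It is truncated in two ways: clamping all unknowns compares two given
    solutions on a compact interval, while truncating logarithms from above, with barriers, gives
    existence for all future time. In the past only a short interval is constructed; the maximal
    interval is the union of those of all invariant solutions. *)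

Section PolyFun.
Context {R : realType}.
Local Notation V := 'rV[R]_4.
Implicit Types (f g : V -> R) (i j : 'I_4) (x : V).

(** Left-invariant metrics, their coframes and their Christoffel symbols are polynomial in
    exponential coordinates. The class is closed under [partial], so smoothness and the symmetry of
    second derivatives become structural inductions. *)
Inductive poly_fun : (V -> R) -> Prop :=
| pf_cst c : poly_fun (fun=> c)
| pf_coord i : poly_fun (fun x => x 0 i)
| pf_add f g : poly_fun f -> poly_fun g -> poly_fun (fun x => f x + g x)
| pf_mul f g : poly_fun f -> poly_fun g -> poly_fun (fun x => f x * g x).

Lemma is_derive_coord i j x :
  is_derive x ('e_i : V) (fun y : V => y 0 j) (i == j)%:R.
Proof.
have h : derivable (fun y : V => y) x ('e_i : V) by exact: derivable_id.
have /derivable_mxP hd := h.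
have e := derive_mx h.
have := derive_id x ('e_i : V).
rewrite e => /rowP/(_ j); rewrite !mxE eqxx/= => ed.
by rewrite eq_sym -ed; apply: derivableP; apply: hd.
Qed.

Lemma continuous_coord j : continuous (fun y : V => y 0 j).
Proof. by move=> x; exact: coord_continuous. Qed.

Lemma partial_cst i c : partial i (fun _ : V => c : R) = fun=> 0.
Proof. by apply/funext => x; rewrite /partial derive_cst. Qed.

Lemma partial_coord i j : partial i (fun x : V => x 0 j) = fun=> (i == j)%:R.
Proof.
by apply/funext => x; rewrite /partial; apply: derive_val; exact: is_derive_coord.
Qed.

Lemma pf_derivable f : poly_fun f -> forall x v, derivable f x v.
Proof.
elim=> {f} [c|i|f g _ hf _ hg|f g _ hf _ hg] x v.
- exact: derivable_cst.
- by have /derivable_mxP := @derivable_id R V x v.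
- exact: (derivableD (hf x v) (hg x v)).
- exact: (derivableM (hf x v) (hg x v)).
Qed.

Arguments pf_derivable {f} _ x v.

Lemma pf_continuous f : poly_fun f -> continuous f.
Proof.
elim=> {f} [c|i|f g _ hf _ hg|f g _ hf _ hg] x.
- exact: cst_continuous.
- exact: continuous_coord.
- exact: continuousD (hf x) (hg x).
- exact: continuousM (hf x) (hg x).
Qed.

Lemma partialD i f g : poly_fun f -> poly_fun g ->
  partial i (fun x => f x + g x) = fun x => partial i f x + partial i g x.
Proof.
by move=> hf hg; apply/funext => x; apply: deriveD; apply: pf_derivable.
Qed.

Lemma partialM i f g : poly_fun f -> poly_fun g ->
  partial i (fun x => f x * g x) = fun x => partial i f x * g x + f x * partial i g x.
Proof.
move=> hf hg; apply/funext => x; rewrite /partial.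
have := deriveM (pf_derivable hf x ('e_i : V)) (pf_derivable hg x ('e_i : V)).
by rewrite /= => ->; rewrite addrC /GRing.scale /= [X in X + _]mulrC.
Qed.

Lemma pf_partial i f : poly_fun f -> poly_fun (partial i f).
Proof.
elim=> {f} [c|j|f g pf hf pg hg|f g pf hf pg hg].
- rewrite partial_cst; exact: pf_cst.
- rewrite partial_coord; exact: pf_cst.
- rewrite partialD //; exact: pf_add.
- by rewrite partialM //; apply: pf_add; apply: pf_mul.
Qed.

Lemma partialC i j f : poly_fun f ->
  partial i (partial j f) = partial j (partial i f).
Proof.
elim=> {f} [c|k|f g pf hf pg hg|f g pf hf pg hg].
- by rewrite !partial_cst.
- by rewrite !partial_coord !partial_cst.
- rewrite (partialD j pf pg) (partialD i pf pg).
  rewrite (partialD i (pf_partial j pf) (pf_partial j pg)).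
  by rewrite (partialD j (pf_partial i pf) (pf_partial i pg)) hf hg.
- have [pif pig pjf pjg] := And4 (pf_partial i pf) (pf_partial i pg)
    (pf_partial j pf) (pf_partial j pg).
  rewrite (partialM j pf pg) (partialM i pf pg).
  rewrite (partialD i (pf_mul pjf pg) (pf_mul pf pjg)).
  rewrite (partialD j (pf_mul pif pg) (pf_mul pf pig)).
  rewrite (partialM i pjf pg) (partialM i pf pjg).
  rewrite (partialM j pif pg) (partialM j pf pig) hf hg.
  by apply/funext => x; exact: addrACA.
Qed.

Lemma pf_iter_partial s f : poly_fun f -> poly_fun (iter_partial s f).
Proof. by move=> pf; elim: s => //= i s; exact: pf_partial. Qed.

Lemma pf_smooth U f : poly_fun f -> smooth_on U f.
Proof.
move=> pf s x _; have p := pf_iter_partial s pf; split.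
  exact: pf_continuous.
by move=> i; exact: pf_derivable.
Qed.

Lemma pf_opp f : poly_fun f -> poly_fun (fun x => - f x).
Proof.
move=> pf; rewrite (_ : (fun x => _) = fun x => -1 * f x).
  by apply: pf_mul => //; exact: pf_cst.
by apply/funext => x; rewrite mulN1r.
Qed.

Lemma pf_sum n (f : 'I_n -> V -> R) :
  (forall k, poly_fun (f k)) -> poly_fun (fun x => \sum_(k < n) f k x).
Proof.
elim: n f => [|n IH] f pf.
  by under eq_fun do rewrite big_ord0; exact: pf_cst.
under eq_fun do rewrite big_ord_recl.
by apply: pf_add => //; apply: IH.
Qed.

Lemma partialZ i c f : poly_fun f ->
  partial i (fun x => c * f x) = fun x => c * partial i f x.
Proof.
move=> pf; rewrite partialM ?partial_cst //; last exact: pf_cst.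
by apply/funext => x; rewrite mul0r add0r.
Qed.

Lemma partialN i f : poly_fun f ->
  partial i (fun x => - f x) = fun x => - partial i f x.
Proof.
by move=> pf; apply/funext => x; apply: deriveN; exact: pf_derivable.
Qed.

Lemma partialB i f g : poly_fun f -> poly_fun g ->
  partial i (fun x => f x - g x) = fun x => partial i f x - partial i g x.
Proof.
by move=> pf pg; rewrite partialD ?partialN //; exact: pf_opp.
Qed.

Lemma partial_sum i n (f : 'I_n -> V -> R) : (forall k, poly_fun (f k)) ->
  partial i (fun x => \sum_(k < n) f k x) = fun x => \sum_(k < n) partial i (f k) x.
Proof.
elim: n f => [|n IH] f pf.
  under eq_fun do rewrite big_ord0; rewrite partial_cst.
  by apply/funext => x; rewrite big_ord0.
under eq_fun do rewrite big_ord_recl.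
rewrite partialD ?IH //; last by apply: pf_sum.
by apply/funext => x; rewrite big_ord_recl.
Qed.

End PolyFun.

(** * The Bach tensor of an orthonormal frame with constant structure constants *)

Local Open Scope nat_scope.

(* Abstracting the ring operations lets the same formulas be evaluated both in a
   field and on polynomials with computable coefficients. *)
Record ops (T : Type) := Ops {
  op0 : T; op1 : T; op_half : T; op_sixth : T;
  op_add : T -> T -> T; op_mul : T -> T -> T; op_opp : T -> T }.

Section FrameAlgebra.
Context {T : Type} (o : ops T).
Local Notation "x [+] y" := (op_add o x y) (at level 50, left associativity).
Local Notation "x [*] y" := (op_mul o x y) (at level 40, left associativity).
Local Notation "x [-] y" := (op_add o x (op_opp o y)) (at level 50, left associativity).

Definition sum4 (f : nat -> T) : T := f 0 [+] (f 1 [+] (f 2 [+] f 3)).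

Definition osum (s : seq nat) (f : nat -> T) : T :=
  foldr (fun p acc => f p [+] acc) (op0 o) s.

(* With e_0, ..., e_3 an orthonormal frame and [e_i, e_j] = C i j k e_k, Koszul's
   formula gives nabla_(e_i) e_j = fr_conn C i j k e_k. *)
Definition fr_conn (C : nat -> nat -> nat -> T) i j k : T :=
  op_half o [*] (C i j k [-] C j k i [+] C k i j).

(** The component of [R(e_i, e_j) e_k] along [e_l]; the last term is there because the frame fields
    do not commute. *)
Definition fr_riem (C G : nat -> nat -> nat -> T) i j k l : T :=
  sum4 (fun m => G j k m [*] G i m l [-] G i k m [*] G j m l [-] C i j m [*] G m k l).

Definition fr_ric (Rm : nat -> nat -> nat -> nat -> T) i j : T :=
  sum4 (fun k => Rm k i j k).

Definition fr_scal (Rc : nat -> nat -> T) : T := sum4 (fun i => Rc i i).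

Definition fr_delta (i j : nat) : T := if i == j then op1 o else op0 o.

Definition fr_weyl (Rm : nat -> nat -> nat -> nat -> T) (Rc : nat -> nat -> T)
    (S : T) i j k l : T :=
  Rm i j k l
  [-] op_half o [*] (Rc i l [*] fr_delta j k [+] Rc j k [*] fr_delta i l
       [-] Rc i k [*] fr_delta j l [-] Rc j l [*] fr_delta i k)
  [+] S [*] op_sixth o [*]
       (fr_delta i l [*] fr_delta j k [-] fr_delta i k [*] fr_delta j l).

Definition fr_tensor4 (W : nat -> nat -> nat -> nat -> T) (I : seq nat) : T :=
  if I is [:: i; j; k; l] then W i j k l else op0 o.

(** The components are constant, so of [cov_deriv] only the connection terms are left. The
    derivative slot comes first, as there. *)
Definition fr_cov (G : nat -> nat -> nat -> T) (S : seq nat -> T) (I : seq nat) : T :=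
  if I is m :: J then
    op_opp o (osum (iota 0 (size J))
      (fun p => sum4 (fun d => G m (nth 0 J p) d [*] S (set_nth 0 J p d))))
  else op0 o.

Definition fr_bach (DDW : seq nat -> T) (Rc : nat -> nat -> T)
    (W : nat -> nat -> nat -> nat -> T) i j : T :=
  sum4 (fun k => sum4 (fun l => DDW [:: k; l; k; i; j; l]))
  [+] op_half o [*] sum4 (fun k => sum4 (fun l => Rc k l [*] W k i j l)).

Definition n4_const (a b c : T) (i j k : nat) : T :=
  match i, j, k with
  | 0, 1, 2 => a | 1, 0, 2 => op_opp o a
  | 0, 1, 3 => b | 1, 0, 3 => op_opp o b
  | 0, 2, 3 => c | 2, 0, 3 => op_opp o c
  | _, _, _ => op0 o
  end.

(* memo tabulates the values at 0, ..., 3, without which the nested sums below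
   would be recomputed exponentially often by vm_compute. *)
Definition memo {U : Type} (f : nat -> U) : nat -> U :=
  let f0 := f 0 in let f1 := f 1 in let f2 := f 2 in let f3 := f 3 in
  fun i => match i with 0 => f0 | 1 => f1 | 2 => f2 | 3 => f3 | n => f n end.

Lemma memoE {U : Type} (f : nat -> U) : memo f = f.
Proof. by apply/funext => -[|[|[|[|n]]]]. Qed.

Fixpoint memo_seq (n : nat) (f : seq nat -> T) : seq nat -> T :=
  if n is m.+1 then
    let t := memo (fun a => memo_seq m (fun J => f (a :: J))) in
    fun I => if I is a :: J then t a J else f I
  else f.

Lemma memo_seqE n f : memo_seq n f = f.
Proof.
elim: n f => //= n IH f; apply/funext => -[|a J] //.
by rewrite memoE IH.
Qed.

Definition memo2 (f : nat -> nat -> T) := memo (fun i => memo (f i)).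
Definition memo3 (f : nat -> nat -> nat -> T) := memo (fun i => memo2 (f i)).
Definition memo4 (f : nat -> nat -> nat -> nat -> T) := memo (fun i => memo3 (f i)).

Lemma memo2E f : memo2 f = f.
Proof. by apply/funext => i; rewrite /memo2 !memoE. Qed.
Lemma memo3E f : memo3 f = f.
Proof. by apply/funext => i; rewrite /memo3 !memoE memo2E. Qed.
Lemma memo4E f : memo4 f = f.
Proof. by apply/funext => i; rewrite /memo4 !memoE memo3E. Qed.

Definition fr_bach_n4 (a b c : T) : nat -> nat -> T :=
  let C := n4_const a b c in
  let G := fr_conn C in let Rm := fr_riem C G in let Rc := fr_ric Rm in
  let W := fr_weyl Rm Rc (fr_scal Rc) in
  fr_bach (fr_cov G (fr_cov G (fr_tensor4 W))) Rc W.

(** The 5 is the rank of the first covariant derivative of the Weyl tensor, whose entries the second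
    one reads many times. *)
Definition fr_bach_n4_memo (a b c : T) : nat -> nat -> T :=
  let C := n4_const a b c in
  let G := memo3 (fr_conn C) in let Rm := memo4 (fr_riem C G) in
  let Rc := memo2 (fr_ric Rm) in
  let W := memo4 (fr_weyl Rm Rc (fr_scal Rc)) in
  memo2 (fr_bach (fr_cov G (memo_seq 5 (fr_cov G (fr_tensor4 W)))) Rc W).

Lemma fr_bach_n4_memoE a b c : fr_bach_n4_memo a b c = fr_bach_n4 a b c.
Proof.
by rewrite /fr_bach_n4_memo /fr_bach_n4 !memo2E !memo4E !memo3E memo_seqE.
Qed.

Definition fr_scal_n4 (a b c : T) : T :=
  let C := n4_const a b c in fr_scal (fr_ric (fr_riem C (fr_conn C))).

End FrameAlgebra.

(** The frame formulas use only the operations of [ops], so they commute with such maps. Applied to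
    [peval], this transfers a computation on coefficient lists to the field. *)
Record is_ops_morphism {T U : Type} (o : ops T) (p : ops U) (phi : T -> U) : Prop :=
  IsOpsMorphism {
    om0 : phi (op0 o) = op0 p; om1 : phi (op1 o) = op1 p;
    omh : phi (op_half o) = op_half p; oms : phi (op_sixth o) = op_sixth p;
    omD : forall x y, phi (op_add o x y) = op_add p (phi x) (phi y);
    omM : forall x y, phi (op_mul o x y) = op_mul p (phi x) (phi y);
    omN : forall x, phi (op_opp o x) = op_opp p (phi x) }.

Section Morphism.
Context {T U : Type} (o : ops T) (p : ops U) (phi : T -> U).
Hypothesis phiM : is_ops_morphism o p phi.

Let phiE := (om0 phiM, om1 phiM, omh phiM, oms phiM, omD phiM, omM phiM, omN phiM).

Lemma sum4_morph f : phi (sum4 o f) = sum4 p (fun i => phi (f i)).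
Proof. by rewrite /sum4 !phiE. Qed.

Lemma osum_morph s f : phi (osum o s f) = osum p s (fun i => phi (f i)).
Proof. by elim: s => [|i s IH] /=; rewrite !phiE ?IH. Qed.

Lemma fr_delta_morph i j : phi (fr_delta o i j) = fr_delta p i j.
Proof. by rewrite /fr_delta; case: ifP; rewrite !phiE. Qed.

Lemma fr_cov_morph G S S' : (forall I, phi (S I) = S' I) ->
  forall I, phi (fr_cov o G S I) =
    fr_cov p (fun i j k => phi (G i j k)) S' I.
Proof.
move=> hS [|m J] /=; rewrite phiE // osum_morph; congr op_opp; congr osum.
by apply/funext => q; rewrite sum4_morph; congr sum4; apply/funext => d;
  rewrite phiE hS.
Qed.

Lemma n4_const_morph a b c i j k :
  phi (n4_const o a b c i j k) = n4_const p (phi a) (phi b) (phi c) i j k.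
Proof.
by case: i => [|[|[|i]]] /=; rewrite ?phiE //; case: j => [|[|[|j]]] /=;
  rewrite ?phiE //; case: k => [|[|[|[|k]]]] /=; rewrite ?phiE.
Qed.

Lemma fr_riem_n4_morph a b c i j k l :
  phi (fr_riem o (n4_const o a b c) (fr_conn o (n4_const o a b c)) i j k l) =
  fr_riem p (n4_const p (phi a) (phi b) (phi c))
    (fr_conn p (n4_const p (phi a) (phi b) (phi c))) i j k l.
Proof.
rewrite /fr_riem sum4_morph; congr sum4; apply/funext => m.
by rewrite /fr_conn !phiE !n4_const_morph.
Qed.

Lemma fr_scal_n4_morph a b c :
  phi (fr_scal_n4 o a b c) = fr_scal_n4 p (phi a) (phi b) (phi c).
Proof.
rewrite /fr_scal_n4 /fr_scal sum4_morph; congr sum4; apply/funext => i.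
rewrite /fr_ric sum4_morph; congr sum4; apply/funext => j.
exact: fr_riem_n4_morph.
Qed.

Lemma fr_bach_n4_morph a b c i j :
  phi (fr_bach_n4 o a b c i j) = fr_bach_n4 p (phi a) (phi b) (phi c) i j.
Proof.
rewrite /fr_bach_n4 /=.
set C := n4_const o a b c; set C' := n4_const p _ _ _.
have hC i' j' k' : phi (C i' j' k') = C' i' j' k' by exact: n4_const_morph.
have hG : (fun i' j' k' => phi (fr_conn o C i' j' k')) = fr_conn p C'.
  by do 3!apply/funext => ?; rewrite /fr_conn !phiE !hC.
have hRm i' j' k' l' : phi (fr_riem o C (fr_conn o C) i' j' k' l') =
    fr_riem p C' (fr_conn p C') i' j' k' l' by exact: fr_riem_n4_morph.
move: (fr_riem o _ _) (fr_riem p _ _) hRm => Rm Rm' hRm.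
have hRc i' j' : phi (fr_ric o Rm i' j') = fr_ric p Rm' i' j'.
  by rewrite /fr_ric sum4_morph; congr sum4; apply/funext => ?.
move: (fr_ric o Rm) (fr_ric p Rm') hRc => Rc Rc' hRc.
have hS : phi (fr_scal o Rc) = fr_scal p Rc'.
  by rewrite /fr_scal sum4_morph; congr sum4; apply/funext => ?.
move: (fr_scal o Rc) (fr_scal p Rc') hS => S S' hS.
have hW i' j' k' l' : phi (fr_weyl o Rm Rc S i' j' k' l') =
    fr_weyl p Rm' Rc' S' i' j' k' l'.
  by rewrite /fr_weyl !phiE !fr_delta_morph hRm !hRc hS.
move: (fr_weyl o Rm Rc S) (fr_weyl p Rm' Rc' S') hW => W W' hW.
rewrite /fr_bach.
have -> x y : phi (op_add o x (op_mul o (op_half o) y)) =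
    op_add p (phi x) (op_mul p (op_half p) (phi y)) by rewrite !phiE.
congr (op_add _ _ (op_mul _ _ _)).
  rewrite sum4_morph; congr sum4; apply/funext => k.
  rewrite sum4_morph; congr sum4; apply/funext => l.
  rewrite -hG; apply: fr_cov_morph; apply: fr_cov_morph => -[|i1[|i2[|i3[|i4[|]]]]] /=;
    by rewrite ?phiE.
rewrite sum4_morph; congr sum4; apply/funext => k.
rewrite sum4_morph; congr sum4; apply/funext => l.
by rewrite !phiE hRc hW.
Qed.

End Morphism.

(** * Computable polynomials with integer coefficients *)

Definition monom : Type := Z * (nat * nat * nat * nat).

(** Equal exponents are merged and cancelled terms dropped, which keeps the lists short. *)
Fixpoint padd1 (m : monom) (p : seq monom) : seq monom :=
  if p is m' :: p' then
    if m.2 == m'.2 then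
      let c := Z.add m.1 m'.1 in if Z.eqb c Z0 then p' else (c, m.2) :: p'
    else m' :: padd1 m p'
  else [:: m].

Definition mulm (m m' : monom) : monom :=
  (Z.mul m.1 m'.1, (m.2.1.1.1 + m'.2.1.1.1, m.2.1.1.2 + m'.2.1.1.2,
                    m.2.1.2 + m'.2.1.2, m.2.2 + m'.2.2)).

Definition padd (p q : seq monom) : seq monom := foldr padd1 q p.

Definition pmul (p q : seq monom) : seq monom :=
  foldr (fun m acc => foldr (fun m' => padd1 (mulm m m')) acc q) [::] p.

Definition popp (p : seq monom) : seq monom := [seq (Z.opp m.1, m.2) | m <- p].

Definition pmonom (z : Z) (i j k l : nat) : seq monom := [:: (z, (i, j, k, l))].

(* The fourth variable stands for 1/12. *)
Definition pops : ops (seq monom) :=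
  Ops [::] (pmonom 1 0 0 0 0) (pmonom 6 0 0 0 1) (pmonom 2 0 0 0 1) padd pmul popp.

Local Open Scope ring_scope.

Section Eval.
Context {F : numFieldType} (a b c : F).

Definition field_ops : ops F :=
  Ops 0 1 (2^-1) (6^-1) +%R *%R -%R.

Fixpoint pos_eval (p : positive) : F :=
  match p with
  | xH => 1 | xO q => 2 * pos_eval q | xI q => 1 + 2 * pos_eval q
  end.

Definition Z_eval (z : Z) : F :=
  match z with
  | Z0 => 0 | Zpos p => pos_eval p | Zneg p => - pos_eval p
  end.

Lemma Z_evalE z : Z_eval z = (int_of_Z z)%:~R.
Proof.
have h p : pos_eval p = (Pos.to_nat p)%:R.
  elim: p => //= p ->.
    by rewrite Pos2Nat.inj_xI -natrM -(natrD _ 1).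
  by rewrite Pos2Nat.inj_xO -natrM.
case: z => //= p; rewrite h //.
rewrite NegzE mulrNz; congr -%R.
by rewrite prednK //; apply/ssrnat.ltP; exact: Pos2Nat.is_pos.
Qed.

Definition meval (m : monom) : F :=
  Z_eval m.1 * a ^+ m.2.1.1.1 * b ^+ m.2.1.1.2 * c ^+ m.2.1.2 * 12^-1 ^+ m.2.2.

Fixpoint peval (p : seq monom) : F := if p is m :: q then meval m + peval q else 0.

Lemma padd1_eval m p : peval (padd1 m p) = meval m + peval p.
Proof.
elim: p => //= m' p IH; case: eqP => [e|_] /=; last by rewrite IH addrCA.
have e2 : meval m + meval m' = meval (Z.add m.1 m'.1, m.2).
  rewrite /meval /= !Z_evalE (_ : Z.add m.1 m'.1 = m.1 + m'.1)%R //.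
  by rewrite rmorphD /= intrD -!e !mulrDl.
case: ifP => [/Z.eqb_eq z|_] /=; last by rewrite addrA e2.
by rewrite addrA e2 z /meval /= !mul0r add0r.
Qed.

Lemma padd_eval p q : peval (padd p q) = peval p + peval q.
Proof. by elim: p => [|m p IH] /=; rewrite ?add0r // padd1_eval IH addrA. Qed.

Lemma mulm_eval m m' : meval (mulm m m') = meval m * meval m'.
Proof.
rewrite /meval /= !Z_evalE (_ : Z.mul m.1 m'.1 = m.1 * m'.1)%R //.
rewrite rmorphM /= intrM !exprD.
ring.
Qed.

Lemma pmul_eval p q : peval (pmul p q) = peval p * peval q.
Proof.
rewrite /pmul; elim: p => [|m p IH] /=; rewrite ?mul0r // mulrDl -IH.
move: (foldr _ _ p) => acc; clear IH.
elim: q => [|m' q IHq] /=; first by rewrite mulr0 add0r.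
by rewrite padd1_eval IHq mulm_eval mulrDr addrA.
Qed.

Lemma popp_eval p : peval (popp p) = - peval p.
Proof.
elim: p => [|m p IH] /=; rewrite ?oppr0 // IH opprD; congr (_ + _).
rewrite /meval /= !Z_evalE (_ : Z.opp m.1 = - m.1)%R //.
by rewrite rmorphN /= mulrNz !mulNr.
Qed.

Lemma peval_morphism : is_ops_morphism pops field_ops peval.
Proof.
split=> //=; rewrite /meval /= ?expr0 ?expr1 ?mulr1 ?addr0 //.
- by field.
- by field.
- exact: padd_eval.
- exact: pmul_eval.
- exact: popp_eval.
Qed.

Lemma pmonom_eval : (peval (pmonom 1 1 0 0 0) = a) * (peval (pmonom 1 0 1 0 0) = b) *
  (peval (pmonom 1 0 0 1 0) = c).
Proof. by rewrite /= /meval /= !expr0 !expr1 !mulr1 !mul1r !addr0. Qed.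

Definition bach_polys :=
  fr_bach_n4_memo pops (pmonom 1 1 0 0 0) (pmonom 1 0 1 0 0) (pmonom 1 0 0 1 0).

Lemma fr_bach_n4E i j : fr_bach_n4 field_ops a b c i j = peval (bach_polys i j).
Proof.
by rewrite /bach_polys fr_bach_n4_memoE (fr_bach_n4_morph peval_morphism) !pmonom_eval.
Qed.

Definition bach_frame (i j : nat) : F :=
  let A := a ^+ 2 in let B := b ^+ 2 in let C := c ^+ 2 in let r := A + B + C in
  match i, j with
  | 0%N, 0%N => A * B - A * C / 8 + A ^+ 2 / 2 + B * C + B ^+ 2 / 2 + C ^+ 2 / 2
  | 1%N, 1%N => A * B - A * C / 24 + A ^+ 2 / 2 + B * C / 3 + B ^+ 2 / 2 - C ^+ 2 / 6
  | 2%N, 2%N => - (A * B) + A * C / 24 - 5 / 6 * A ^+ 2 + B * C / 3 - B ^+ 2 / 6 + C ^+ 2 / 2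
  | 3%N, 3%N => - (A * B) + A * C / 8 - A ^+ 2 / 6 - 5 / 3 * (B * C) - 5 / 6 * B ^+ 2
              - 5 / 6 * C ^+ 2
  | 1%N, 2%N | 2%N, 1%N => 2 / 3 * (b * c) * r
  | 2%N, 3%N | 3%N, 2%N => - (2 / 3 * (a * b) * r)
  | _, _ => 0
  end.

Lemma fr_bach_n4_frame i j : (i < 4)%N -> (j < 4)%N ->
  fr_bach_n4 field_ops a b c i j = bach_frame i j.
Proof.
rewrite fr_bach_n4E.
have -> : bach_polys = memo2 bach_polys by rewrite memo2E.
(* Each of the sixteen entries is evaluated to a closed coefficient list; [field] only compares it
   with the table. *)
case: i => [|[|[|[|i]]]] // _; case: j => [|[|[|[|j]]]] // _;
  match goal with |- context[memo2 bach_polys ?i ?j] =>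
   let v := eval vm_compute in (memo2 bach_polys i j) in
   have -> : memo2 bach_polys i j = v by vm_cast_no_check (erefl v)
  end; rewrite /= /meval /=; by field.
Qed.

Definition scal_polys :=
  fr_scal_n4 pops (pmonom 1 1 0 0 0) (pmonom 1 0 1 0 0) (pmonom 1 0 0 1 0).

Lemma fr_scal_n4_frame :
  fr_scal_n4 field_ops a b c = - ((a ^+ 2 + b ^+ 2 + c ^+ 2) / 2).
Proof.
transitivity (peval scal_polys).
  by rewrite /scal_polys (fr_scal_n4_morph peval_morphism) !pmonom_eval.
let v := eval vm_compute in scal_polys in
   have -> : scal_polys = v by vm_cast_no_check (erefl v).
rewrite /= /meval /=; by field.
Qed.

End Eval.

(** * Curvature in a moving frame *)

Arguments fr_conn : simpl never.
Arguments fr_riem : simpl never.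
Arguments fr_ric : simpl never.
Arguments fr_scal : simpl never.
Arguments fr_delta : simpl never.
Arguments fr_weyl : simpl never.
Arguments fr_cov : simpl never.
Arguments fr_bach : simpl never.
Arguments sum4 : simpl never.
Arguments osum : simpl never.

Lemma sum4E {F : numFieldType} (f : nat -> F) :
  sum4 (field_ops (F := F)) f = \sum_(k < 4) f k.
Proof. by rewrite /sum4 !big_ord_recr big_ord0 /= add0r !addrA. Qed.

Lemma osumE {F : numFieldType} n (f : nat -> F) :
  osum (field_ops (F := F)) (iota 0 n) f = \sum_(p < n) f p.
Proof.
rewrite -(big_mkord xpredT) /index_iota subn0.
by elim: (iota 0 n) => [|p s IH]; rewrite ?big_nil ?big_cons // -IH.
Qed.

Section MovingFrame.
Context {R : realType}.
Local Notation V := 'rV[R]_4.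
Local Notation o := (field_ops (F := R)).

(* F a i are the components of the orthonormal coframe, E i a those of the dual
   frame e_a, and [e_a, e_b] = C a b c e_c. *)
Variables (F E : 'I_4 -> 'I_4 -> V -> R) (g : V -> 'M[R]_4).
Variable C : nat -> nat -> nat -> R.
Hypothesis pfF : forall a i, poly_fun (F a i).
Hypothesis pfE : forall i a, poly_fun (E i a).
Hypothesis FE : forall x a b, \sum_i F a i x * E i b x = (a == b)%:R.
Hypothesis gE : forall x i j, g x i j = \sum_a F a i x * F a j x.
Hypothesis CN : forall i j k, C j i k = - C i j k.
Hypothesis dF : forall (c i j : 'I_4) x, partial i (F c j) x - partial j (F c i) x =
  - \sum_(a < 4) \sum_(b < 4) C a b c * F a i x * F b j x.

Local Notation w := (fr_conn o C).

Lemma fr_connE i j k : w i j k = 2^-1 * (C i j k - C j k i + C k i j).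
Proof. by []. Qed.

Lemma sum_delta_l (f : 'I_4 -> R) a : \sum_b (a == b)%:R * f b = f a.
Proof.
rewrite (bigD1 a) //= eqxx mul1r big1 ?addr0 // => b /negPf.
by rewrite eq_sym => ->; rewrite mul0r.
Qed.

Lemma sum_delta_r (f : 'I_4 -> R) a : \sum_b (b == a)%:R * f b = f a.
Proof. by under eq_bigr do rewrite eq_sym; exact: sum_delta_l. Qed.

Lemma invmx_frame x k l : invmx (g x) k l = \sum_c E k c x * E l c x.
Proof.
pose Fm := \matrix_(a, i) F a i x; pose Em := \matrix_(i, a) E i a x.
have FmE : Fm *m Em = 1%:M.
  by apply/matrixP => a b; rewrite !mxE -(FE x); apply: eq_bigr => i _; rewrite !mxE.
have EFm : Em *m Fm = 1%:M by exact: mulmx1C.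
have gx : g x = Fm^T *m Fm.
  by apply/matrixP => i j; rewrite gE !mxE; apply: eq_bigr => a _; rewrite !mxE.
have gEE : g x *m (Em *m Em^T) = 1%:M.
  rewrite gx -mulmxA (mulmxA Fm) FmE mul1mx -trmx_mul EFm.
  by apply/matrixP => i j; rewrite !mxE eq_sym.
have gu : g x \in unitmx by case: (mulmx1_unit gEE).
have -> : invmx (g x) = Em *m Em^T.
  by rewrite -[LHS]mulmx1 -gEE (mulmxA (invmx _)) mulVmx // mul1mx.
by rewrite !mxE; apply: eq_bigr => c _; rewrite !mxE.
Qed.

(** The component along [e_c] of the covariant derivative of the coordinate field [j] in direction
    [i]. *)
Definition conn1 (c i j : 'I_4) : V -> R := fun x =>
  partial i (F c j) x + \sum_(a < 4) \sum_(b < 4) w a b c * F a i x * F b j x.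

(** A polynomial expression for the Christoffel symbols: the inverse matrix in [christoffel] never
    has to be differentiated. *)
Definition chr k i j : V -> R := fun x => \sum_c E k c x * conn1 c i j x.

Lemma pf_conn1 c i j : poly_fun (conn1 c i j).
Proof.
apply: pf_add; first exact: pf_partial.
do 2!apply: pf_sum => ?; apply: pf_mul => //; apply: pf_mul => //; exact: pf_cst.
Qed.

Lemma pf_chr k i j : poly_fun (chr k i j).
Proof. by apply: pf_sum => c; apply: pf_mul => //; exact: pf_conn1. Qed.

(** Koszul's formula contracted with the coframe. Once the summation indices are renamed so that the
    three coframe factors agree, coefficients match by skewness of [C]. *)
Lemma koszul_sum (i j l : 'I_4) x :
  2 * \sum_c F c l x * (\sum_(a < 4) \sum_(b < 4) w a b c * F a i x * F b j x) =
  \sum_(c < 4) F c l x * (\sum_(a < 4) \sum_(b < 4) C a b c * F a i x * F b j x)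
  - \sum_(c < 4) F c j x * (\sum_(a < 4) \sum_(b < 4) C a b c * F a i x * F b l x)
  - \sum_(c < 4) F c i x * (\sum_(a < 4) \sum_(b < 4) C a b c * F a j x * F b l x).
Proof.
have T (u v t : 'I_4 -> R) (K : 'I_4 -> 'I_4 -> 'I_4 -> R) :
    \sum_c t c * (\sum_a \sum_b K a b c * u a * v b) =
    \sum_a \sum_b \sum_c K a b c * u a * v b * t c.
  under eq_bigr do rewrite mulr_sumr.
  rewrite exchange_big; apply: eq_bigr => a _ /=.
  under eq_bigr do rewrite mulr_sumr.
  rewrite exchange_big; apply: eq_bigr => b _ /=.
  by apply: eq_bigr => c _; rewrite mulrC.
rewrite !(T (F^~ i ^~ x) (F^~ j ^~ x)) (T (F^~ i ^~ x) (F^~ l ^~ x))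
  (T (F^~ j ^~ x) (F^~ l ^~ x)) /=.
rewrite (_ : \sum_(a < 4) \sum_(b < 4) \sum_(c < 4) C a b c * F a i x * F b l x * F c j x =
  \sum_(a < 4) \sum_(b < 4) \sum_(c < 4) C a c b * F a i x * F b j x * F c l x); last first.
  apply: eq_bigr => a _; rewrite exchange_big; apply: eq_bigr => b _ /=.
  by apply: eq_bigr => c _; ring.
rewrite (_ : \sum_(a < 4) \sum_(b < 4) \sum_(c < 4) C a b c * F a j x * F b l x * F c i x =
  \sum_(a < 4) \sum_(b < 4) \sum_(c < 4) C b c a * F a i x * F b j x * F c l x); last first.
  rewrite [RHS]exchange_big /=; apply: eq_bigr => a _.
  rewrite [RHS]exchange_big /=; apply: eq_bigr => b _ /=.
  by apply: eq_bigr => c _; ring.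
rewrite mulr_sumr -!sumrB; apply: eq_bigr => a _.
rewrite mulr_sumr -!sumrB; apply: eq_bigr => b _.
rewrite mulr_sumr -!sumrB; apply: eq_bigr => c _.
by rewrite fr_connE (CN a c b); field.
Qed.

Lemma partial_g m i j x : partial m (fun y => g y i j) x =
  \sum_c (partial m (F c i) x * F c j x + F c i x * partial m (F c j) x).
Proof.
rewrite (_ : (fun y => g y i j) = fun y => \sum_c F c i y * F c j y); last first.
  by apply/funext => y; rewrite gE.
rewrite partial_sum => [|c]; last exact: pf_mul.
by apply: eq_bigr => c _; rewrite partialM.
Qed.

(** The left side is twice the Christoffel symbol of the first kind. [dF] turns the products with
    [C] from [koszul_sum] into antisymmetrized derivatives of the coframe; the rest is the product
    rule. *)
Lemma lower_chr i j l x :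
  partial i (fun y => g y j l) x + partial j (fun y => g y i l) x
     - partial l (fun y => g y i j) x = 2 * \sum_c F c l x * conn1 c i j x.
Proof.
rewrite !partial_g /conn1.
under [in RHS]eq_bigr do rewrite mulrDr.
rewrite [in RHS]big_split /= [in RHS]mulrDr koszul_sum.
have D (c i' j' : 'I_4) : \sum_(a < 4) \sum_(b < 4) C a b c * F a i' x * F b j' x =
   partial j' (F c i') x - partial i' (F c j') x.
  by have := dF c i' j' x => /(congr1 -%R); rewrite opprB opprK.
under [X in _ = _ + (X - _ - _)]eq_bigr do rewrite D.
under [X in _ = _ + (_ - X - _)]eq_bigr do rewrite D.
under [X in _ = _ + (_ - _ - X)]eq_bigr do rewrite D.
rewrite mulr_sumr -!sumrB -!big_split -!sumrB; apply: eq_bigr => c _ /=; ring.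
Qed.

Lemma E_contract x (f : 'I_4 -> R) k :
  \sum_l (\sum_c E k c x * E l c x) * (\sum_c F c l x * f c) = \sum_c E k c x * f c.
Proof.
under eq_bigr do rewrite mulr_suml.
rewrite exchange_big; apply: eq_bigr => c _ /=.
under eq_bigr do rewrite -mulrA mulr_sumr.
rewrite -mulr_sumr exchange_big /=; congr (_ * _).
under eq_bigr => b _.
  under eq_bigr do rewrite mulrA (mulrC (E _ _ _)).
  rewrite -mulr_suml FE; over.
exact: sum_delta_r.
Qed.

Lemma christoffel_frame k i j : christoffel g k i j = chr k i j.
Proof.
apply/funext => x; rewrite /christoffel.
under eq_bigr do rewrite lower_chr invmx_frame mulrCA.
by rewrite -mulr_sumr mulrA mulVf ?mul1r ?pnatr_eq0 // E_contract.
Qed.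

(** [conn1] solved for the derivative: the coframe intertwines the coordinate connection [chr] with
    the frame connection [w]. *)
Lemma partial_F c j k x : partial j (F c k) x =
  \sum_a F c a x * chr a j k x - \sum_(a < 4) \sum_(b < 4) w a b c * F a j x * F b k x.
Proof.
rewrite /chr; under eq_bigr do rewrite mulr_sumr.
rewrite exchange_big /=.
under eq_bigr => b _.
  under eq_bigr do rewrite mulrA.
  rewrite -mulr_suml FE; over.
by rewrite sum_delta_l /conn1 addrK.
Qed.

(** Gauge covariance of curvature. With [f] the coframe, the first two hypotheses give its
    derivatives and the third says that its mixed second derivatives agree; after expansion the
    mixed terms cancel, leaving the curvature of the coordinate connection on one side and that of
    the frame connection on the other. *)
Lemma curvature_alg (f Gi Gj dGij dGji Oi Oj dOij dOji dFi dFj : 'M[R]_4) :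
  dFi = f *m Gi - Oi *m f -> dFj = f *m Gj - Oj *m f ->
  dFi *m Gj + f *m dGij - (dOij *m f + Oj *m dFi) =
  dFj *m Gi + f *m dGji - (dOji *m f + Oi *m dFj) ->
  f *m (dGij - dGji + (Gi *m Gj - Gj *m Gi)) =
  (dOij - dOji + (Oi *m Oj - Oj *m Oi)) *m f.
Proof.
move=> -> ->.
rewrite !(mulmxDl, mulmxDr, mulmxBl, mulmxBr, mulmxN, mulNmx) !mulmxA.
move: (f *m Gi *m Gj) (f *m Gj *m Gi) (Oi *m f *m Gj) (Oj *m f *m Gi)
  (f *m dGij) (f *m dGji) (dOij *m f) (dOji *m f) (Oj *m Oi *m f) (Oi *m Oj *m f).
move=> a b c d e h k l m n H; apply/matrixP => u v; move/matrixP: H => /(_ u v).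
by rewrite !mxE => H; lra.
Qed.

Definition frame_comp (c : 'I_4) i j k x := \sum_a F c a x *
   (partial i (chr a j k) x - partial j (chr a i k) x
     + \sum_b (chr b j k x * chr a i b x - chr b i k x * chr a j b x)).

Lemma frame_comp_riem (c i j k : 'I_4) x :
  frame_comp c i j k x =
  \sum_(p < 4) \sum_(q < 4) \sum_(r < 4)
    F p i x * F q j x * F r k x * fr_riem o C w p q r c.
Proof.
pose f := \matrix_(a, b) F a b x.
pose G m := \matrix_(a, b) chr a m b x.
pose dG m n := \matrix_(a, b) partial m (chr a n b) x.
pose O m := \matrix_(a < 4, b < 4) \sum_(p < 4) w p b a * F p m x.
pose dO m n := \matrix_(a < 4, b < 4) \sum_(p < 4) w p b a * partial m (F p n) x.
pose dFm m := \matrix_(a, b) partial m (F a b) x.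
have hF m : dFm m = f *m G m - O m *m f.
  apply/matrixP => a b; rewrite !mxE partial_F; congr (_ - _).
    by apply: eq_bigr => d _; rewrite !mxE.
  rewrite exchange_big /=; apply: eq_bigr => d _; rewrite !mxE mulr_suml.
  by apply: eq_bigr => p _; ring.
have hdF m n a b : partial m (partial n (F a b)) x =
    (dFm m *m G n + f *m dG m n - (dO m n *m f + O n *m dFm m)) a b.
  have -> : partial n (F a b) = fun y => \sum_d F a d y * chr d n b y
      - \sum_(p < 4) \sum_(q < 4) w p q a * F p n y * F q b y.
    by apply/funext => y; rewrite partial_F.
  have pf1 d : poly_fun (fun y => F a d y * chr d n b y).
    by apply: pf_mul => //; exact: pf_chr.
  have pf3 (p q : 'I_4) : poly_fun (fun y => w p q a * F p n y).
    by apply: pf_mul => //; exact: pf_cst.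
  have pf2 (p q : 'I_4) : poly_fun (fun y => w p q a * F p n y * F q b y).
    exact: pf_mul.
  rewrite partialB; [|exact: pf_sum|by do 2!apply: pf_sum => ?].
  rewrite partial_sum // partial_sum; last by move=> p; apply: pf_sum.
  rewrite [LHS]/= !mxE; congr (_ - _).
    rewrite -big_split; apply: eq_bigr => d _ /=; rewrite !mxE partialM //.
    exact: pf_chr.
  rewrite -big_split [LHS](eq_bigr (fun p : 'I_4 => \sum_(q < 4)
     (w p q a * partial m (F p n) x * F q b x + w p q a * F p n x * partial m (F q b) x)));
    last first.
    move=> p _; rewrite partial_sum //; apply: eq_bigr => q _.
    by rewrite (partialM m (pf3 p q) (pfF q b)) partialZ.
  rewrite exchange_big; apply: eq_bigr => d _ /=.
  rewrite !mxE !mulr_suml -big_split; apply: eq_bigr => q _ /=; ring.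
have hsym : dFm i *m G j + f *m dG i j - (dO i j *m f + O j *m dFm i) =
    dFm j *m G i + f *m dG j i - (dO j i *m f + O i *m dFm j).
  apply/matrixP => a b; apply: etrans (esym (hdF i j a b)) _.
  by apply: etrans (hdF j i a b); rewrite (partialC i j (pfF a b)).
have := curvature_alg (hF i) (hF j) hsym => /matrixP/(_ c k).
rewrite mxE => H.
rewrite /frame_comp (eq_bigr (fun a => f c a * (dG i j - dG j i + (G i *m G j - G j *m G i)) a k));
  last first.
  move=> a _; rewrite !mxE sumrB; congr (_ * (_ + (_ - _)));
    by apply: eq_bigr => b _; rewrite !mxE mulrC.
rewrite {}H mxE.
under [RHS]eq_bigr do rewrite exchange_big.
rewrite [RHS]exchange_big; apply: eq_bigr => r _ /=; rewrite !mxE.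
(* In the connection form only the coframe varies, so [dF] converts the difference of derivatives
   into the bracket term of [fr_riem]. *)
rewrite -sumrB (eq_bigr (fun p : 'I_4 => - \sum_(a < 4) \sum_(b < 4)
   (C a b p * w p r c) * (F a i x * F b j x))); last first.
  move=> p _; rewrite -mulrBr dF mulrN mulr_sumr; congr (- _).
  apply: eq_bigr => a _; rewrite mulr_sumr; apply: eq_bigr => b _; ring.
rewrite sumrN exchange_big /= mulrDl.
have hOO m n (u v : 'I_4) : \sum_l O m u l * O n l v =
   \sum_(p < 4) \sum_(q < 4) (\sum_(l < 4) w p l u * w q v l) * (F p m x * F q n x).
  under eq_bigr do rewrite !mxE mulr_suml.
  rewrite exchange_big; apply: eq_bigr => p _ /=.
  under eq_bigr do rewrite mulr_sumr.
  rewrite exchange_big; apply: eq_bigr => q _ /=.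
  rewrite mulr_suml; apply: eq_bigr => l _; ring.
rewrite !hOO [X in _ + (_ - X) * _]exchange_big -sumrB mulr_suml -sumrN -mulr_suml.
rewrite -mulrDl -big_split mulr_suml; apply: eq_bigr => p _ /=.
rewrite exchange_big -sumrB -sumrN -big_split mulr_suml; apply: eq_bigr => q _ /=.
rewrite -mulr_suml /fr_riem sum4E /=.
have -> : \sum_(m < 4) (w q r m * w p m c - w p r m * w q m c - C p q m * w m r c) =
    \sum_(m < 4) w p m c * w q r m - \sum_(m < 4) w q m c * w p r m
    - \sum_(m < 4) C p q m * w m r c.
  by rewrite -!sumrB; apply: eq_bigr => m _; ring.
ring.
Qed.

(* frame T I is the coordinate component of index I of the tensor field with
   constant components T in the frame. *)
Fixpoint frame (T : seq nat -> R) (I : seq 'I_4) (x : V) : R :=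
  if I is i :: J then \sum_(a < 4) F a i x * frame (fun K => T (nat_of_ord a :: K)) J x
  else T [::].

Lemma pf_frame T I : poly_fun (frame T I).
Proof.
elim: I T => [|i J IH] T /=; first exact: pf_cst.
by apply: pf_sum => a; apply: pf_mul.
Qed.

Lemma frame_lin T S (r s : R) I x :
  frame (fun K => r * T K + s * S K) I x = r * frame T I x + s * frame S I x.
Proof.
elim: I T S => [|i J IH] T S //=.
rewrite !mulr_sumr -big_split; apply: eq_bigr => a _ /=; rewrite IH; ring.
Qed.

Lemma frameD T S I x : frame (fun K => T K + S K) I x = frame T I x + frame S I x.
Proof.
by have := frame_lin T S 1 1 I x; under eq_fun do rewrite !mul1r; rewrite !mul1r.
Qed.

Lemma frameZ T (r : R) I x : frame (fun K => r * T K) I x = r * frame T I x.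
Proof.
have := frame_lin T T r 0 I x; under eq_fun do rewrite mul0r addr0.
by rewrite mul0r addr0.
Qed.

Lemma frameN T I x : frame (fun K => - T K) I x = - frame T I x.
Proof. by have := frameZ T (-1) I x; under eq_fun do rewrite mulN1r; rewrite mulN1r. Qed.

Lemma frame_sum n (T : 'I_n -> seq nat -> R) I x :
  frame (fun K => \sum_(p < n) T p K) I x = \sum_(p < n) frame (T p) I x.
Proof.
elim: n T => [|n IH] T.
  rewrite big_ord0; under eq_fun do rewrite big_ord0.
  by have := frameZ (fun=> 0) 0 I x; under eq_fun do rewrite mul0r; rewrite mul0r.
by under eq_fun do rewrite big_ord_recl; rewrite frameD IH big_ord_recl.
Qed.

Lemma frame_ext T S I x : (forall K, size K = size I -> T K = S K) ->
  frame T I x = frame S I x.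
Proof.
elim: I T S => [|i J IH] T S h /=; first exact: h.
by apply: eq_bigr => a _; congr (_ * _); apply: IH => K sK; apply: h; rewrite /= sK.
Qed.

Lemma fr_covE T (b : 'I_4) K : fr_cov o w T (nat_of_ord b :: K) =
  - \sum_(p < size K) \sum_(d < 4) w b (nth 0%N K p) d * T (set_nth 0%N K p d).
Proof.
rewrite /fr_cov osumE /=; congr (- _); apply: eq_bigr => p _.
by rewrite sum4E.
Qed.

(** Induction on the slots. By [partial_F] the derivative of the first coframe factor is a
    Christoffel term, cancelled by the correction for that slot, and a connection term, the new
    summand of [fr_cov]. *)
Lemma partial_frame T m I x :
  partial m (frame T I) x
  - \sum_(p < size I) \sum_a chr a m (nth 0 I p) x * frame T (set_nth 0 I p a) x
  = \sum_(b < 4) F b m x * frame (fun K => fr_cov o w T (nat_of_ord b :: K)) I x.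
Proof.
elim: I T => [|i J IH] T.
  rewrite /= partial_cst big_ord0 subr0 big1 // => b _.
  by rewrite fr_covE big_ord0 oppr0 mulr0.
rewrite [size _]/= big_ord_recl [frame T (_ :: _)]/=.
rewrite partial_sum; last by move=> a; apply: pf_mul => //; exact: pf_frame.
under eq_bigr => a _.
  rewrite partialM; [|by []|exact: pf_frame].
  rewrite partial_F; over.
under [X in _ - (X + _)]eq_bigr do rewrite /= mulr_sumr.
rewrite [X in _ - (X + _)]exchange_big /=.
under [X in _ - (_ + X)]eq_bigr => p _.
  under eq_bigr do rewrite mulr_sumr.
  rewrite exchange_big /=; over.
rewrite [X in _ - (_ + X)]exchange_big /= opprD addrA -!sumrB.
under [RHS]eq_bigr do rewrite mulr_sumr.
rewrite [RHS]exchange_big /=.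
have IH' a : partial m (frame (fun K => T (nat_of_ord a :: K)) J) x =
   \sum_(b < 4) F b m x * frame (fun K =>
      fr_cov o w (fun K => T (nat_of_ord a :: K)) (nat_of_ord b :: K)) J x
   + \sum_(p < size J) \sum_a0 chr a0 m (nth 0 J p) x *
       frame (fun K => T (nat_of_ord a :: K)) (set_nth 0 J p a0) x.
  by rewrite -IH subrK.
rewrite (eq_bigr (fun a : 'I_4 =>
   (- \sum_(b < 4) \sum_(d < 4) w b d a * F b m x * F d i x) *
      frame (fun K => T (nat_of_ord a :: K)) J x
   + F a i x * \sum_(b < 4) F b m x * frame (fun K =>
      fr_cov o w (fun K => T (nat_of_ord a :: K)) (nat_of_ord b :: K)) J x));
  last first.
  move=> a _; rewrite IH' [in LHS]mulrDr.
  have -> : \sum_(c < 4) chr c m i x * (F a c x * frame (fun K => T (nat_of_ord a :: K)) J x)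
     = (\sum_(c < 4) F a c x * chr c m i x) * frame (fun K => T (nat_of_ord a :: K)) J x.
    by rewrite mulr_suml; apply: eq_bigr => c _; ring.
  have -> : \sum_(p < size J) \sum_(d < 4) chr d m (nth 0 J p) x *
       (F a i x * frame (fun K => T (nat_of_ord a :: K)) (set_nth 0 J p d) x) =
     F a i x * \sum_(p < size J) \sum_(d < 4) chr d m (nth 0 J p) x *
       frame (fun K => T (nat_of_ord a :: K)) (set_nth 0 J p d) x.
    rewrite mulr_sumr; apply: eq_bigr => p _; rewrite mulr_sumr; apply: eq_bigr => d _.
    ring.
  ring.
rewrite big_split /=.
have -> : \sum_(a < 4) (- \sum_(b < 4) \sum_(d < 4) w b d a * F b m x * F d i x) *
      frame (fun K => T (nat_of_ord a :: K)) J x =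
   \sum_(d < 4) F d i x * \sum_(b < 4) F b m x *
     (- \sum_(a < 4) w b d a * frame (fun K => T (nat_of_ord a :: K)) J x).
  under eq_bigr do rewrite mulNr mulr_suml.
  rewrite sumrN exchange_big /=.
  under eq_bigr do (under eq_bigr do rewrite mulr_suml; rewrite exchange_big /=).
  rewrite exchange_big /= -sumrN; apply: eq_bigr => d _.
  rewrite mulr_sumr -sumrN; apply: eq_bigr => b _.
  rewrite !mulrN !mulr_sumr; congr (- _).
  by apply: eq_bigr => a _; ring.
rewrite -big_split; apply: eq_bigr => d _ /=.
rewrite -mulrDr -big_split /= mulr_sumr; apply: eq_bigr => b _.
rewrite -mulrDr mulrCA; congr (_ * (_ * _)).
rewrite -sumrN (eq_bigr (fun a : 'I_4 => frame (fun K => - w b d a * T (nat_of_ord a :: K)) J x));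
  last by move=> a _; rewrite frameZ mulNr.
rewrite -frame_sum -frameD; apply: frame_ext => K _.
rewrite !fr_covE [size (_ :: _)]/= [in RHS]big_ord_recl /= opprD; congr (_ + _).
by rewrite -sumrN; apply: eq_bigr => a _; rewrite mulNr.
Qed.

Lemma cov_deriv_frame (S : seq 'I_4 -> V -> R) T n :
  (forall I, size I = n -> S I = frame T I) ->
  forall I, size I = n.+1 -> cov_deriv g S I = frame (fr_cov o w T) I.
Proof.
move=> ST [//|m J] [sJ]; apply/funext => x; rewrite /= -partial_frame ST //.
congr (_ - _); apply: eq_bigr => p _; apply: eq_bigr => a _.
rewrite christoffel_frame ST // size_set_nth.
by rewrite (maxn_idPr (ltn_ord p)).
Qed.

(** Brings an inner slot to the front, where it can be contracted. *)
Lemma frame_pull T I l J x : frame T (I ++ l :: J) x =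
  \sum_(d < 4) F d l x * frame (fun K => T (take (size I) K ++
    nat_of_ord d :: drop (size I) K)) (I ++ J) x.
Proof.
elim: I T => [|i I IH] T.
  by rewrite /=; apply: eq_bigr => d _; under [in RHS]eq_fun do rewrite take0 drop0.
rewrite /= (eq_bigr _ (fun a _ => congr1 (fun t => F a i x * t) (IH _))).
under eq_bigr do rewrite mulr_sumr.
rewrite exchange_big /=; apply: eq_bigr => d _.
by rewrite mulr_sumr; apply: eq_bigr => a _; rewrite mulrCA.
Qed.

Lemma E_pair x (X Y : 'I_4 -> 'I_4 -> R) :
  \sum_k \sum_l (\sum_p \sum_q E k p x * E l q x * X p q)
     * (\sum_r F r k x * \sum_s F s l x * Y r s) = \sum_p \sum_q X p q * Y p q.
Proof.
have step (h : 'I_4 -> R) (h' : 'I_4 -> R) :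
    \sum_k (\sum_p E k p x * h p) * (\sum_r F r k x * h' r) = \sum_p h p * h' p.
  under eq_bigr do rewrite mulr_suml.
  rewrite exchange_big /=; apply: eq_bigr => p _.
  under eq_bigr do rewrite mulr_sumr.
  rewrite exchange_big /= -[in RHS](sum_delta_r h') mulr_sumr; apply: eq_bigr => r _.
  rewrite -(FE x) mulr_suml mulr_sumr; apply: eq_bigr => k _; ring.
rewrite exchange_big /=.
under eq_bigr => l _.
  rewrite (eq_bigr (fun k => (\sum_p E k p x * (\sum_q E l q x * X p q)) *
    (\sum_r F r k x * \sum_s F s l x * Y r s))); last first.
    move=> k _; congr (_ * _); apply: eq_bigr => p _.
    by rewrite mulr_sumr; apply: eq_bigr => q _; rewrite mulrA.
  rewrite step; over.
rewrite exchange_big /=; apply: eq_bigr => p _.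
exact: (step (fun q => X p q) (fun s => Y p s)).
Qed.

(** With [X] the identity this is a metric trace, with [X] the Ricci tensor a contraction with the
    raised Ricci tensor. *)
Lemma frame_trace_gen T (X : nat -> nat -> R) I J x :
  \sum_k \sum_l (\sum_(p < 4) \sum_(q < 4) E k p x * E l q x * X p q)
     * frame T (k :: (I ++ l :: J)) x =
  frame (fun K => \sum_(p < 4) \sum_(q < 4) X p q *
      T (nat_of_ord p :: take (size I) K ++ nat_of_ord q :: drop (size I) K)) (I ++ J) x.
Proof.
under eq_bigr do under eq_bigr do
  rewrite /= (eq_bigr _ (fun a _ => congr1 (fun t => F a _ x * t) (frame_pull _ _ _ _ _))).
rewrite (E_pair _ (fun p q => X p q)) frame_sum; apply: eq_bigr => p _.
by rewrite frame_sum; apply: eq_bigr => q _; rewrite frameZ.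
Qed.

Lemma frame_trace T I J x :
  \sum_k \sum_l invmx (g x) k l * frame T (k :: (I ++ l :: J)) x =
  frame (fun K => \sum_(p < 4)
      T (nat_of_ord p :: take (size I) K ++ nat_of_ord p :: drop (size I) K)) (I ++ J) x.
Proof.
pose X (p q : nat) : R := (p == q)%:R.
have sX (p : 'I_4) (f : 'I_4 -> R) : \sum_(q < 4) X p q * f q = f p.
  exact: (sum_delta_l f p).
have invE k l : invmx (g x) k l = \sum_(p < 4) \sum_(q < 4) E k p x * E l q x * X p q.
  rewrite invmx_frame; apply: eq_bigr => p _.
  by rewrite -(sX p (fun q => E k p x * E l q x)); apply: eq_bigr => q _; rewrite mulrC.
under eq_bigr do under eq_bigr do rewrite invE.
rewrite (frame_trace_gen T X); apply: frame_ext => K _; apply: eq_bigr => p _.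
exact: sX.
Qed.

Lemma invmx_sym x k l : invmx (g x) k l = invmx (g x) l k.
Proof. by rewrite !invmx_frame; apply: eq_bigr => c _; rewrite mulrC. Qed.

Local Notation Rm := (fr_riem o C w).
Local Notation Rc := (fr_ric o Rm).
Local Notation Sc := (fr_scal o Rc).
Local Notation W := (fr_weyl o Rm Rc Sc).

Definition tens2 (u : nat -> nat -> R) (K : seq nat) : R :=
  if K is [:: i; j] then u i j else 0.

Lemma riemann_frame i j k l x :
  riemann g i j k l x = frame (fr_tensor4 o Rm) [:: i; j; k; l] x.
Proof.
transitivity (\sum_(c < 4) F c l x * frame_comp c i j k x).
  rewrite /riemann /frame_comp.
  under eq_bigr do rewrite gE mulr_suml.
  rewrite exchange_big /=; apply: eq_bigr => c _; rewrite mulr_sumr.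
  apply: eq_bigr => a _; rewrite !christoffel_frame mulrA; congr (_ * (_ + _)).
  by apply: eq_bigr => b _; rewrite !christoffel_frame.
under eq_bigr do rewrite frame_comp_riem mulr_sumr.
rewrite exchange_big /=; apply: eq_bigr => p _.
under eq_bigr do rewrite mulr_sumr.
rewrite exchange_big mulr_sumr /=; apply: eq_bigr => q _.
under eq_bigr do rewrite mulr_sumr.
rewrite exchange_big !mulr_sumr /=; apply: eq_bigr => r _.
rewrite !mulr_sumr; apply: eq_bigr => c _; ring.
Qed.

Lemma ricci_frame i j x : ricci g i j x = frame (tens2 Rc) [:: i; j] x.
Proof.
rewrite /ricci.
under eq_bigr do under eq_bigr do rewrite riemann_frame.
rewrite (frame_trace (fr_tensor4 o Rm) [:: i; j] [::]).
by apply: frame_ext => -[|p[|q[|]]] //= _; rewrite /fr_ric sum4E.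
Qed.

Lemma scal_frame x : scal g x = Sc.
Proof.
rewrite /scal.
under eq_bigr do under eq_bigr do rewrite ricci_frame.
by rewrite (frame_trace (tens2 Rc) [::] [::]) /= /fr_scal sum4E.
Qed.

Lemma metric_frame i j x : g x i j = frame (tens2 (fr_delta o)) [:: i; j] x.
Proof.
rewrite gE /=; apply: eq_bigr => a _; congr (_ * _).
rewrite -(sum_delta_l (fun b => F b j x) a); apply: eq_bigr => b _.
by rewrite mulrC /fr_delta /=; congr (_ * _); rewrite -[a == b]/(nat_of_ord a == b); case: eqP.
Qed.

Lemma frame_prod_il (u v : nat -> nat -> R) i j k l x :
  frame (fr_tensor4 o (fun a b c d => u a d * v b c)) [:: i; j; k; l] x =
  frame (tens2 u) [:: i; l] x * frame (tens2 v) [:: j; k] x.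
Proof.
rewrite /= mulr_suml; apply: eq_bigr => a _; rewrite -mulrA; congr (_ * _).
rewrite mulr_sumr; apply: eq_bigr => b _; rewrite mulrCA; congr (_ * _).
rewrite mulr_sumr; apply: eq_bigr => c _; rewrite mulrCA; congr (_ * _).
rewrite mulr_suml; apply: eq_bigr => d _; ring.
Qed.

Lemma frame_prod_ik (u v : nat -> nat -> R) i j k l x :
  frame (fr_tensor4 o (fun a b c d => u a c * v b d)) [:: i; j; k; l] x =
  frame (tens2 u) [:: i; k] x * frame (tens2 v) [:: j; l] x.
Proof.
rewrite /= mulr_suml; apply: eq_bigr => a _; rewrite -mulrA; congr (_ * _).
rewrite mulr_sumr; apply: eq_bigr => b _; rewrite mulrCA; congr (_ * _).
rewrite mulr_suml; apply: eq_bigr => c _; rewrite -mulrA; congr (_ * _).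
rewrite mulr_sumr; apply: eq_bigr => d _; ring.
Qed.

Lemma weyl_frame i j k l x :
  weyl g i j k l x = frame (fr_tensor4 o W) [:: i; j; k; l] x.
Proof.
rewrite /weyl riemann_frame !ricci_frame scal_frame !metric_frame.
rewrite (mulrC (frame (tens2 Rc) [:: j; k] x)) (mulrC (frame (tens2 Rc) [:: j; l] x)).
rewrite -!(frame_prod_il _ _ i j k l) -!(frame_prod_ik _ _ i j k l).
rewrite -!frameN -!frameD -!frameZ -frameN -!frameD.
apply: frame_ext => -[|p[|q[|r[|s[|]]]]] //= _.
rewrite /fr_weyl /=; ring.
Qed.

Lemma raised_ricci_frame k l x :
  raised_ricci g k l x = \sum_(p < 4) \sum_(q < 4) E k p x * E l q x * Rc p q.
Proof.
rewrite /raised_ricci.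
under eq_bigr do under eq_bigr do rewrite ricci_frame !invmx_frame.
rewrite (eq_bigr (fun a => \sum_b (\sum_p \sum_q E a p x * E b q x *
   (E k p x * E l q x)) * (\sum_r F r a x * \sum_s F s b x * Rc r s))); last first.
  move=> a _; apply: eq_bigr => b _; congr (_ * _).
  rewrite mulr_suml; apply: eq_bigr => p _; rewrite mulr_sumr; apply: eq_bigr => q _.
  ring.
by rewrite E_pair.
Qed.

Lemma bach_frame_comp i j x :
  bach g x i j = frame (tens2 (fr_bach o
    (fr_cov o w (fr_cov o w (fr_tensor4 o W))) Rc W)) [:: i; j] x.
Proof.
rewrite mxE.
set D2 := fr_cov o w (fr_cov o w (fr_tensor4 o W)).
have hW I : size I = 4 -> weyl_tensor g I = frame (fr_tensor4 o W) I.
  move: I => [|i1[|i2[|i3[|i4[|]]]]] // _; apply/funext => y; exact: weyl_frame.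
have hD I : size I = 6 -> cov_deriv g (cov_deriv g (weyl_tensor g)) I = frame D2 I.
  by apply: cov_deriv_frame; apply: cov_deriv_frame.
rewrite (_ : \sum_k \sum_l \sum_a \sum_b _ =
  frame (fun K => \sum_(l < 4) \sum_(k < 4) D2 ((nat_of_ord k :: nat_of_ord l ::
    nat_of_ord k :: rcons K l))) [:: i; j] x); last first.
  transitivity (\sum_l \sum_b invmx (g x) l b * \sum_k \sum_a invmx (g x) a k *
      frame D2 [:: a; b; k; i; j; l] x).
    rewrite exchange_big; apply: eq_bigr => l _.
    transitivity (\sum_b \sum_k \sum_a invmx (g x) l b * (invmx (g x) a k *
      frame D2 [:: a; b; k; i; j; l] x)); last first.
      apply: eq_bigr => b _; rewrite mulr_sumr; apply: eq_bigr => k _.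
      by rewrite mulr_sumr.
    rewrite [RHS]exchange_big; apply: eq_bigr => k _.
    rewrite [RHS]exchange_big; apply: eq_bigr => a _; apply: eq_bigr => b _.
    rewrite hD // (invmx_sym x a k); ring.
  (* The two traces are taken in turn: the outer derivative slot with [k] gives [D1], and there the
     inner derivative slot is traced with [l]. *)
  pose D1 K := \sum_(p < 4) D2 (nat_of_ord p :: take 1 K ++ nat_of_ord p :: drop 1 K).
  transitivity (\sum_b \sum_l invmx (g x) b l * frame D1 (b :: [:: i; j] ++ [:: l]) x).
    rewrite exchange_big; apply: eq_bigr => b _; apply: eq_bigr => l _.
    rewrite (invmx_sym x l b); congr (_ * _).
    by rewrite exchange_big; exact: (frame_trace D2 [:: b] [:: i; j; l]).
  rewrite (frame_trace D1 [:: i; j] [::]) /D1.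
  apply: frame_ext => -[|p[|q[|]]] //= _; apply: eq_bigr => l _; apply: eq_bigr => k _.
under [X in _ + _ * X]eq_bigr do under eq_bigr do
  rewrite raised_ricci_frame weyl_frame.
rewrite (frame_trace_gen (fr_tensor4 o W) Rc [:: i; j] [::]) -frameZ -frameD.
apply: frame_ext => -[|p[|q[|]]] // _; rewrite /fr_bach /= !sum4E; congr (_ + _ * _).
  by rewrite exchange_big; apply: eq_bigr => k _; rewrite sum4E.
by apply: eq_bigr => k _; rewrite sum4E.
Qed.

End MovingFrame.

(** * Left-invariant metrics on N^4 *)

Lemma big4 {F : nmodType} (f : 'I_4 -> F) : \sum_i f i = f 0 + f 1 + f 2 + f 3.
Proof.
rewrite !big_ord_recr big_ord0 /= add0r.
by congr (f _ + f _ + f _ + f _); apply/val_inj.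
Qed.

Section LeftInvariant.
Context {R : realType}.
Local Notation V := 'rV[R]_4.
Local Notation jacobian := Defs.jacobian.
Local Notation o := (field_ops (F := R)).

(** Paired with polynomiality, the value of a derivative is found by unification while the rules are
    applied along the term. *)
Definition has_partial (i : 'I_4) (f : V -> R) (x : V) (d : R) : Prop :=
  poly_fun f /\ partial i f x = d.

Lemma hp_cst i c x : has_partial i (fun=> c) x 0.
Proof. by split; [exact: pf_cst|rewrite partial_cst]. Qed.

Lemma hp_coord i j x : has_partial i (fun y : V => y 0 j) x (i == j)%:R.
Proof. by split; [exact: pf_coord|rewrite partial_coord]. Qed.

Lemma hp_add i f g x a b : has_partial i f x a -> has_partial i g x b ->
  has_partial i (fun y => f y + g y) x (a + b).
Proof. by move=> [pf <-] [pg <-]; split; [exact: pf_add|rewrite partialD]. Qed.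

Lemma hp_opp i f x a : has_partial i f x a -> has_partial i (fun y => - f y) x (- a).
Proof. by move=> [pf <-]; split; [exact: pf_opp|rewrite partialN]. Qed.

Lemma hp_mul i f g x a b : has_partial i f x a -> has_partial i g x b ->
  has_partial i (fun y => f y * g y) x (a * g x + f x * b).
Proof. by move=> [pf <-] [pg <-]; split; [exact: pf_mul|rewrite partialM]. Qed.

Lemma hp_eq i f x a b : has_partial i f x a -> a = b -> partial i f x = b.
Proof. by move=> [_ <-]. Qed.

Ltac hp_tac := do ?[exact: hp_coord|exact: hp_cst|apply: hp_add|apply: hp_opp|apply: hp_mul].

Definition n4_ad (a b c : R) (x : V) : 'M[R]_4 :=
  \matrix_(k < 4, j < 4) \sum_(i < 4) n4_const o a b c i j k * x 0 i.

(* (1 - exp(- ad_x)) / ad_x, the left Maurer-Cartan form in exponential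
   coordinates, for the brackets [e_0,e_1] = a e_2 + b e_3, [e_0,e_2] = c e_3. *)
Definition theta (a b c : R) (x : V) : 'M[R]_4 :=
  1%:M - 2^-1 *: n4_ad a b c x + 6^-1 *: (n4_ad a b c x *m n4_ad a b c x).

Definition theta_entry (a b c x0 x1 x2 : R) (k j : nat) : R :=
  match k, j with
  | 0%N, 0%N | 1%N, 1%N | 2%N, 2%N | 3%N, 3%N => 1
  | 2%N, 0%N => 2^-1 * a * x1
  | 2%N, 1%N => - (2^-1 * a * x0)
  | 3%N, 0%N => 2^-1 * (b * x1 + c * x2) - 6^-1 * a * c * x0 * x1
  | 3%N, 1%N => - (2^-1 * b * x0) + 6^-1 * a * c * x0 * x0
  | 3%N, 2%N => - (2^-1 * c * x0)
  | _, _ => 0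
  end.

Lemma n4_adE a b c x (k j : 'I_4) : n4_ad a b c x k j =
  match nat_of_ord k, nat_of_ord j with
  | 2%N, 0%N => - (a * x 0 1) | 2%N, 1%N => a * x 0 0
  | 3%N, 0%N => - (b * x 0 1 + c * x 0 2) | 3%N, 1%N => b * x 0 0
  | 3%N, 2%N => c * x 0 0
  | _, _ => 0
  end.
Proof.
rewrite mxE big4; move: k; apply: ord4_ind; move: j; apply: ord4_ind => /=; ring.
Qed.

Lemma thetaE a b c x k j :
  theta a b c x k j = theta_entry a b c (x 0 0) (x 0 1) (x 0 2) k j.
Proof.
have -> : theta a b c x k j = (k == j)%:R - 2^-1 * n4_ad a b c x k j
    + 6^-1 * \sum_l n4_ad a b c x k l * n4_ad a b c x l j.
  by rewrite /theta; move: (n4_ad a b c x) => M; rewrite !mxE.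
rewrite big4 !n4_adE.
by move: k; apply: ord4_ind; move: j; apply: ord4_ind => /=; field.
Qed.

Lemma jacobian_n4_mul (a x : V) k i : jacobian (n4_mul a) x k i =
  match nat_of_ord k with
  | 0%N => (i == 0)%:R | 1%N => (i == 1)%:R
  | 2%N => (i == 2)%:R + 2^-1 * (a 0 0 * (i == 1)%:R - a 0 1 * (i == 0)%:R)
  | _ => (i == 3)%:R + 2^-1 * (a 0 0 * (i == 2)%:R - a 0 2 * (i == 0)%:R)
     + 12^-1 * (- (i == 0)%:R * (a 0 0 * x 0 1 - a 0 1 * x 0 0)
       + (a 0 0 - x 0 0) * (a 0 0 * (i == 1)%:R - a 0 1 * (i == 0)%:R))
  end.
Proof.
rewrite mxE; move: k; apply: ord4_ind => /=.
- rewrite (_ : (fun y : V => n4_mul a y 0 0) = fun y => a 0 0 + y 0 0); last first.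
    by apply/funext => y; rewrite n4_mulE.
  by apply: hp_eq; [hp_tac|rewrite add0r].
- rewrite (_ : (fun y : V => n4_mul a y 0 1) = fun y => a 0 1 + y 0 1); last first.
    by apply/funext => y; rewrite n4_mulE.
  by apply: hp_eq; [hp_tac|rewrite add0r].
- rewrite (_ : (fun y : V => n4_mul a y 0 2) = fun y => a 0 2 + y 0 2 +
      2^-1 * (a 0 0 * y 0 1 + - (a 0 1 * y 0 0))); last first.
    by apply/funext => y; rewrite n4_mulE.
  by apply: hp_eq; [hp_tac|cbv beta; ring].
- rewrite (_ : (fun y : V => n4_mul a y 0 3) = fun y => a 0 3 + y 0 3 +
      2^-1 * (a 0 0 * y 0 2 + - (a 0 2 * y 0 0)) +
      12^-1 * (a 0 0 + - y 0 0) * (a 0 0 * y 0 1 + - (a 0 1 * y 0 0))); last first.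
    by apply/funext => y; rewrite n4_mulE.
  by apply: hp_eq; [hp_tac|cbv beta; ring].
Qed.

Local Notation theta1 := (theta 1 0 1).

(** The Maurer-Cartan form at [x] is the differential of the left translation that carries [x] to
    the identity. *)
Lemma theta_jacobian (x : V) : jacobian (n4_mul (- x)) x = theta1 x.
Proof.
apply/matrixP => k i; rewrite jacobian_n4_mul thetaE !mxE.
by move: k; apply: ord4_ind; move: i; apply: ord4_ind => /=; field.
Qed.

Lemma theta_mul (a x : V) : theta1 (n4_mul a x) *m jacobian (n4_mul a) x = theta1 x.
Proof.
apply/matrixP => k i; rewrite mxE big4 !thetaE !jacobian_n4_mul !n4_mulE.
by move: k; apply: ord4_ind; move: i; apply: ord4_ind => /=; field.
Qed.

Lemma pf_theta a b c k j : poly_fun (fun x => theta a b c x k j).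
Proof.
under eq_fun do rewrite thetaE.
move: k; apply: ord4_ind; move: j; apply: ord4_ind => /=;
 do ?[exact: pf_coord|exact: pf_cst|apply: pf_add|apply: pf_opp|apply: pf_mul].
Qed.

Lemma partial_theta k j m x : partial m (fun y => theta1 y k j) x =
  match nat_of_ord k, nat_of_ord j with
  | 2%N, 0%N => 2^-1 * (m == 1)%:R
  | 2%N, 1%N => - (2^-1 * (m == 0)%:R)
  | 3%N, 0%N => 2^-1 * (m == 2)%:R
       - 6^-1 * ((m == 0)%:R * x 0 1 + x 0 0 * (m == 1)%:R)
  | 3%N, 1%N => 6^-1 * ((m == 0)%:R * x 0 0 + x 0 0 * (m == 0)%:R)
  | 3%N, 2%N => - (2^-1 * (m == 0)%:R)
  | _, _ => 0
  end.
Proof.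
under eq_fun do rewrite thetaE.
by move: k; apply: ord4_ind; move: j; apply: ord4_ind => /=;
  apply: hp_eq; by [hp_tac|cbv beta; ring].
Qed.

(** The Maurer-Cartan equation, in the form of the hypothesis [dF] on moving frames. *)
Lemma theta_structure (d i j : 'I_4) x :
  partial i (fun y => theta1 y d j) x - partial j (fun y => theta1 y d i) x =
  - \sum_(p < 4) \sum_(q < 4) n4_const o 1 0 1 p q d * theta1 x p i * theta1 x q j.
Proof.
rewrite !partial_theta !big4 !thetaE.
by move: d; apply: ord4_ind; move: i; apply: ord4_ind; move: j; apply: ord4_ind => /=; field.
Qed.

(* The inverse of theta1. *)
Definition eta (x : V) : 'M[R]_4 := \matrix_(k, j)
  match nat_of_ord k, nat_of_ord j with
  | 0%N, 0%N | 1%N, 1%N | 2%N, 2%N | 3%N, 3%N => 1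
  | 2%N, 0%N => - (2^-1 * x 0 1)
  | 2%N, 1%N => 2^-1 * x 0 0
  | 3%N, 0%N => - (2^-1 * x 0 2) - 12^-1 * x 0 0 * x 0 1
  | 3%N, 1%N => 12^-1 * x 0 0 * x 0 0
  | 3%N, 2%N => 2^-1 * x 0 0
  | _, _ => 0
  end.

Lemma theta_eta x : theta1 x *m eta x = 1%:M.
Proof.
apply/matrixP => k i; rewrite mxE big4 !thetaE !mxE.
by move: k; apply: ord4_ind; move: i; apply: ord4_ind => /=; field.
Qed.

Lemma pf_eta k j : poly_fun (fun x => eta x k j).
Proof.
under eq_fun do rewrite mxE.
move: k; apply: ord4_ind; move: j; apply: ord4_ind => /=;
 do ?[exact: pf_coord|exact: pf_cst|apply: pf_add|apply: pf_opp|apply: pf_mul].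
Qed.

(* The left-invariant metric with Gram matrix G at the identity. *)
Definition linv (G : 'M[R]_4) (x : V) : 'M[R]_4 := (theta1 x)^T *m G *m theta1 x.

Lemma theta_0 a b c : theta a b c 0 = 1%:M.
Proof.
rewrite /theta (_ : n4_ad a b c 0 = 0) ?mulmx0 ?scaler0 ?subr0 ?addr0 //.
by apply/matrixP => i j; rewrite !mxE big1 // => k _; rewrite mxE mulr0.
Qed.

Lemma linv_0 G : linv G 0 = G.
Proof. by rewrite /linv theta_0 trmx1 mul1mx mulmx1. Qed.

Lemma left_invariant_linv g : left_invariant_metric g -> g = linv (g 0).
Proof.
move=> [_ h]; apply/funext => x; rewrite -(h (- x) x) /pullback theta_jacobian.
by rewrite n4_mulNx.
Qed.

Lemma linv_left_invariant G : G^T = G ->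
  (forall v : V, v != 0 -> 0 < (v *m G *m v^T) 0 0) -> left_invariant_metric (linv G).
Proof.
move=> GT Gpos; split; last first.
  move=> a x; rewrite /pullback /linv -(theta_mul a x) trmx_mul.
  by rewrite !mulmxA.
split.
- move=> i j; apply: pf_smooth.
  rewrite (_ : (fun x => _) = fun x => \sum_l (\sum_k theta1 x k i * G k l) * theta1 x l j).
    apply: pf_sum => l; apply: pf_mul; last exact: pf_theta.
    by apply: pf_sum => k; apply: pf_mul; [exact: pf_theta|exact: pf_cst].
  apply/funext => x; rewrite mxE; apply: eq_bigr => l _; rewrite mxE; congr (_ * _).
  by apply: eq_bigr => k _; rewrite mxE.
- by move=> x; rewrite /linv !trmx_mul trmxK GT mulmxA.
- move=> x v v0; set u := v *m (theta1 x)^T.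
  have -> : v *m linv G x *m v^T = u *m G *m u^T.
    by rewrite /u /linv trmx_mul trmxK !mulmxA.
  apply: Gpos; apply: contra v0 => /eqP e.
  have := congr1 (fun u => u *m (eta x)^T) e.
  by rewrite mul0mx -mulmxA -trmx_mul (mulmx1C (theta_eta x)) trmx1 mulmx1 => ->.
Qed.

(* The linear map U carries the bracket of n_4 to the bracket with structure
   constants a, b, c. *)
Definition n4_frame_morph (U : 'M[R]_4) (a b c : R) : Prop :=
  forall r p q : 'I_4, \sum_(d < 4) U r d * n4_const o 1 0 1 p q d =
    \sum_(k < 4) \sum_(l < 4) n4_const o a b c k l r * U k p * U l q.

Lemma n4_constN a b c i j k : n4_const o a b c j i k = - n4_const o a b c i j k.
Proof.
by case: i => [|[|[|i]]]; case: j => [|[|[|j]]]; case: k => [|[|[|[|k]]]] /=;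
  rewrite ?opprK ?oppr0.
Qed.

(** [U] times the Maurer-Cartan form is an orthonormal coframe for the Gram matrix [U^T U], and the
    morphism property rewrites its structure equation with the constants [a], [b], [c]. *)
Lemma linv_moving_frame U a b c : U \in unitmx -> n4_frame_morph U a b c ->
  let F r i x := \sum_d U r d * theta1 x d i in
  let E i r x := \sum_d eta x i d * invmx U d r in
  let g := linv (U^T *m U) in
  [/\ forall r i, poly_fun (F r i), forall i r, poly_fun (E i r),
      forall x r s, \sum_i F r i x * E i s x = (r == s)%:R,
      forall x i j, g x i j = \sum_r F r i x * F r j x &
      forall (r i j : 'I_4) x, partial i (F r j) x - partial j (F r i) x =
        - \sum_(k < 4) \sum_(l < 4) n4_const o a b c k l r * F k i x * F l j x].
Proof.
move=> uU hU F E g.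
have FM x r i : F r i x = (U *m theta1 x) r i by rewrite mxE.
split.
- by move=> r i; apply: pf_sum => d; apply: pf_mul; [exact: pf_cst|exact: pf_theta].
- by move=> i r; apply: pf_sum => d; apply: pf_mul; [exact: pf_eta|exact: pf_cst].
- move=> x r s; transitivity (((U *m theta1 x) *m (eta x *m invmx U)) r s).
    by rewrite [RHS]mxE; apply: eq_bigr => i _; rewrite FM [X in _ = _ * X]mxE.
  by rewrite mulmxA -(mulmxA U) theta_eta mulmx1 mulmxV // mxE.
- move=> x i j; transitivity (((U *m theta1 x)^T *m (U *m theta1 x)) i j).
    by rewrite /g /linv trmx_mul !mulmxA.
  by rewrite mxE; apply: eq_bigr => r _; rewrite mxE !FM.
- move=> r i j x.
  rewrite /F !partial_sum; try by move=> d; apply: pf_mul; [exact: pf_cst|exact: pf_theta].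
  rewrite -sumrB (eq_bigr (fun d : 'I_4 => - \sum_(p < 4) \sum_(q < 4)
    (U r d * n4_const o 1 0 1 p q d) * (theta1 x p i * theta1 x q j))); last first.
    move=> d _; rewrite !partialZ; try exact: pf_theta.
    rewrite -mulrBr theta_structure mulrN mulr_sumr; congr (- _).
    by apply: eq_bigr => p _; rewrite mulr_sumr; apply: eq_bigr => q _; rewrite !mulrA.
  rewrite sumrN; congr (- _); rewrite exchange_big /=.
  under eq_bigr => p _.
    rewrite exchange_big /=; under eq_bigr do rewrite -mulr_suml hU; over.
  transitivity (\sum_(p < 4) \sum_(q < 4) \sum_(k < 4) \sum_(l < 4)
     n4_const o a b c k l r * (U k p * theta1 x p i) * (U l q * theta1 x q j)).
    apply: eq_bigr => p _; apply: eq_bigr => q _; rewrite mulr_suml.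
    apply: eq_bigr => k _; rewrite mulr_suml; apply: eq_bigr => l _; ring.
  under [LHS]eq_bigr do rewrite exchange_big /=.
  rewrite [LHS]exchange_big; apply: eq_bigr => k _ /=.
  under [LHS]eq_bigr do rewrite exchange_big /=.
  rewrite [LHS]exchange_big; apply: eq_bigr => l _ /=.
  rewrite exchange_big mulr_sumr /=; apply: eq_bigr => q _.
  by rewrite -mulr_suml -mulr_sumr.
Qed.

Definition bach_mx (a b c : R) : 'M[R]_4 := \matrix_(i < 4, j < 4) bach_frame a b c i j.

Lemma linv_bach U a b c x : U \in unitmx -> n4_frame_morph U a b c ->
  bach (linv (U^T *m U)) x = linv (U^T *m bach_mx a b c *m U) x.
Proof.
move=> uU hU; have /= [pF pE FE gE dF] := linv_moving_frame uU hU.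
have CN i j k := n4_constN a b c i j k.
apply/matrixP => i j; rewrite (bach_frame_comp pF pE FE gE CN dF) /=.
transitivity (((U *m theta1 x)^T *m bach_mx a b c *m (U *m theta1 x)) i j); last first.
  by rewrite /linv trmx_mul !mulmxA.
rewrite mxE; under [RHS]eq_bigr do rewrite mxE mulr_suml.
rewrite [RHS]exchange_big; apply: eq_bigr => p _ /=.
rewrite mulr_sumr; apply: eq_bigr => q _.
rewrite -[fr_bach _ _ _ _ _ _]/(fr_bach_n4 o a b c p q) fr_bach_n4_frame //.
rewrite !mxE; ring.
Qed.

Lemma linv_scal U a b c x : U \in unitmx -> n4_frame_morph U a b c ->
  scal (linv (U^T *m U)) x = - ((a ^+ 2 + b ^+ 2 + c ^+ 2) / 2).
Proof.
move=> uU hU; have /= [pF pE FE gE dF] := linv_moving_frame uU hU.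
have CN i j k := n4_constN a b c i j k.
by rewrite (scal_frame pF pE FE gE CN dF) -fr_scal_n4_frame.
Qed.

Lemma linv_bach_velocity U a b c x : U \in unitmx -> n4_frame_morph U a b c ->
  bach_velocity (linv (U^T *m U)) x = linv (U^T *m bach_mx a b c *m U) x.
Proof.
move=> uU hU; rewrite /bach_velocity (linv_bach _ uU hU).
have -> : scal (linv (U^T *m U)) = fun=> - ((a ^+ 2 + b ^+ 2 + c ^+ 2) / 2).
  by apply/funext => y; exact: linv_scal uU hU.
rewrite /laplacian big1 ?mul0r ?scale0r ?addr0 // => i _; rewrite big1 // => j _.
rewrite !partial_cst big1 ?subr0 ?mulr0 // => k _.
by rewrite partial_cst mulr0.
Qed.

(** Naturality: [U] intertwines the adjoint actions, and [theta] is a polynomial in the adjoint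
    action. *)
Lemma theta_frame_morph U a b c x : n4_frame_morph U a b c ->
  U *m theta1 x = theta a b c (x *m U^T) *m U.
Proof.
move=> hU.
have adE : U *m n4_ad 1 0 1 x = n4_ad a b c (x *m U^T) *m U.
  apply/matrixP => r q; rewrite !mxE.
  under eq_bigr => d _.
    rewrite mxE mulr_sumr; under eq_bigr do rewrite mulrA; over.
  rewrite exchange_big /=; under eq_bigr do rewrite -mulr_suml hU.
  under [RHS]eq_bigr do rewrite mxE mulr_suml.
  rewrite [RHS]exchange_big /=; under [LHS]eq_bigr do rewrite mulr_suml.
  rewrite [LHS]exchange_big; apply: eq_bigr => k _ /=.
  under [LHS]eq_bigr do rewrite mulr_suml.
  rewrite [LHS]exchange_big; apply: eq_bigr => l _ /=; rewrite !mxE mulr_sumr mulr_suml.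
  by apply: eq_bigr => p _; rewrite !mxE; ring.
rewrite /theta !mulmxDr !mulmxDl mulmx1 mul1mx mulmxN mulNmx -!scalemxAr -!scalemxAl.
by rewrite adE mulmxA adE -!mulmxA adE.
Qed.

End LeftInvariant.

(** * Ordinary differential equations *)

Section DerivativeRules.
Context {R : realType}.
Implicit Types (f g : R -> R) (t a b : R).

Lemma dr_cst t c : is_derive t (1 : R) (fun=> c : R) 0.
Proof. exact: is_derive_cst. Qed.

Lemma dr_id t : is_derive t (1 : R) (fun s => s) 1.
Proof. exact: is_derive_id. Qed.

Lemma dr_add f g t a b : is_derive t 1 f a -> is_derive t 1 g b ->
  is_derive t (1 : R) (fun s => f s + g s) (a + b).
Proof. by move=> ? ?; exact: is_deriveD. Qed.

Lemma dr_opp f t a : is_derive t 1 f a -> is_derive t (1 : R) (fun s => - f s) (- a).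
Proof. by move=> ?; exact: is_deriveN. Qed.

Lemma dr_mul f g t a b : is_derive t 1 f a -> is_derive t 1 g b ->
  is_derive t (1 : R) (fun s => f s * g s) (a * g t + f t * b).
Proof.
move=> fa gb; have := is_deriveM fa gb; rewrite /GRing.scale /= => h.
by apply: is_derive_eq h _; rewrite addrC mulrC.
Qed.

Lemma dr_exp f t a : is_derive t 1 f a ->
  is_derive t (1 : R) (fun s => expR (f s)) (expR (f t) * a).
Proof. by move=> fa; exact: is_derive1_comp. Qed.

Lemma dr_inv f t a : f t != 0 -> is_derive t 1 f a ->
  is_derive t (1 : R) (fun s => (f s)^-1) (- a / f t ^+ 2).
Proof.
move=> f0 fa; have := is_deriveV f0 fa => h; apply: is_derive_eq h _.
by rewrite /GRing.scale /= mulNr mulrC mulNr.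
Qed.

Lemma dr_comp f g t a b : is_derive (g t) 1 f a -> is_derive t 1 g b ->
  is_derive t (1 : R) (fun s => f (g s)) (a * b).
Proof. by move=> fa gb; exact: is_derive1_comp. Qed.

Lemma dr_sum n (f : 'I_n -> R -> R) (a : 'I_n -> R) t :
  (forall i, is_derive t 1 (f i) (a i)) ->
  is_derive t (1 : R) (fun s => \sum_i f i s) (\sum_i a i).
Proof.
move=> h; rewrite (_ : (fun s => _) = \sum_i f i); first exact: is_derive_sum.
by apply/funext => s; rewrite fct_sumE.
Qed.

Lemma dr_eq f t a b : is_derive t 1 f a -> a = b -> is_derive t (1 : R) f b.
Proof. by move=> ? <-. Qed.

Lemma dr_continuous f t a : is_derive t 1 f a -> {for t, continuous f}.
Proof.
by move=> [df _]; apply: differentiable_continuous; apply/derivable1_diffP.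
Qed.

Lemma dr_ndecr f (df : R -> R) a b : a <= b ->
  (forall s, a <= s <= b -> is_derive s 1 f (df s)) ->
  (forall s, a <= s <= b -> 0 <= df s) -> f a <= f b.
Proof.
move=> ab h h0; have [||c cab e] := MVT_segment (f := f) (df := df) ab.
- by move=> x; rewrite in_itv /= => /andP[/ltW ? /ltW ?]; apply: h; apply/andP.
- apply: continuous_in_subspaceT => x; rewrite inE /= in_itv /= => xab.
  exact: dr_continuous (h x xab).
- by rewrite -subr_ge0 e mulr_ge0 ?subr_ge0 // h0 //; move: cab; rewrite in_itv.
Qed.

Lemma dr_nincr f (df : R -> R) a b : a <= b ->
  (forall s, a <= s <= b -> is_derive s 1 f (df s)) ->
  (forall s, a <= s <= b -> df s <= 0) -> f b <= f a.
Proof.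
move=> ab h h0; rewrite -lerN2.
apply: (@dr_ndecr (fun s => - f s) (fun s => - df s) a b) => // s sab.
  by apply: dr_opp; exact: h.
by rewrite oppr_ge0 h0.
Qed.

Lemma dr_const f a b : a <= b ->
  (forall s, a <= s <= b -> is_derive s 1 f 0) -> f a = f b.
Proof.
move=> ab h; apply/eqP; rewrite eq_le.
by rewrite (@dr_ndecr f (fun=> 0) a b) // (@dr_nincr f (fun=> 0) a b).
Qed.

End DerivativeRules.

(** * Antiderivatives on the whole line *)

Section Antiderivative.
Context {R : realType}.
Variable f : R -> R.
Hypothesis fc : continuous f.
Local Notation mu := (@lebesgue_measure R).

(** The derivative is taken only to the right of the left end [- N]. Normalized at 0, the integral
    no longer depends on [N], which may therefore grow with [t]. *)
Let P (N t : R) : R := \int[mu]_(s in `[- N, t]) f s.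

Lemma P_derive (N t : R) : - N < t -> is_derive t (1 : R) (P N) (f t).
Proof.
move=> Nt.
have fct : {for t, continuous f} by exact: fc.
have [] := @continuous_FTC1_closed R f (- N) t (t + 1) _ _ Nt fct.
- by rewrite ltrDl.
- apply: continuous_compact_integrable; first exact: segment_compact.
  by apply: continuous_subspaceT.
- by move=> d e; rewrite -e derive1E; exact: derivableP.
Qed.

Let Q (N t : R) := P N t - P N 0.

Lemma Q_derive (N t : R) : - N < t -> is_derive t (1 : R) (Q N) (f t).
Proof.
move=> h; rewrite -[f t]addr0.
exact: (dr_add (P_derive h) (dr_cst t (- P N 0))).
Qed.

Lemma Q_eq (N M t : R) : 0 < N -> 0 < M -> - N < t -> - M < t -> Q N t = Q M t.
Proof.
move=> N0 M0 Nt Mt; apply/eqP; rewrite -subr_eq0; apply/eqP.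
have h s : - N < s -> - M < s -> is_derive s (1 : R) (fun s => Q N s + - Q M s) 0.
  move=> ? ?; rewrite -(subrr (f s)).
  by apply: (dr_add (Q_derive _) (dr_opp (Q_derive _))).
have Q0 : Q N 0 + - Q M 0 = 0 by rewrite /Q !subrr.
case: (leP 0 t) => t0.
  rewrite -[RHS]Q0; apply/esym/(@dr_const _ (fun s => Q N s + - Q M s)) => //.
  by move=> s /andP[s0 _]; apply: h; apply: lt_le_trans s0; rewrite oppr_lt0.
rewrite -[RHS]Q0; apply: (@dr_const _ (fun s => Q N s + - Q M s)); first exact: ltW.
by move=> s /andP[s0 _]; apply: h; exact: lt_le_trans s0.
Qed.

Lemma antiderivative : exists F : R -> R,
  F 0 = 0 /\ forall t, is_derive t (1 : R) F (f t).
Proof.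
exists (fun t => Q (`|t| + 1) t); split; first by rewrite /Q subrr.
(* Near [t] the moving parameter [|s| + 1] is replaced by a fixed one. *)
move=> t; apply: (@near_eq_is_derive _ _ _ (Q (`|t| + 2))); last first.
  by apply: Q_derive; have := ler_norm (- t); rewrite normrN; lra.
near=> s.
have st : `|s - t| < 1.
  by rewrite distrC; near: s; apply: nbhsx_ballx; exact: ltr01.
have := ler_norm (- s); have := ler_norm (- t); have := ler_distD t s 0.
have := normr_ge0 s; have := normr_ge0 t.
rewrite !subr0 !normrN => *; apply: Q_eq; lra.
Unshelve. all: by end_near. Qed.

End Antiderivative.

(** * Globally Lipschitz systems: uniqueness and Picard iteration *)

Section CauchyLipschitz.
Context {R : realType} (n : nat).
Variables (F : 'I_n -> ('I_n -> R) -> R) (L : R).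
Hypothesis L0 : 0 < L.
Hypothesis FL : forall i u v, `|F i u - F i v| <= L * \sum_j `|u j - v j|.

Lemma sol_unique (u v : 'I_n -> R -> R) (t : R) :
  (forall i, u i 0 = v i 0) ->
  (forall i s, Num.min 0 t <= s <= Num.max 0 t ->
     is_derive s (1 : R) (u i) (F i (u^~ s))) ->
  (forall i s, Num.min 0 t <= s <= Num.max 0 t ->
     is_derive s (1 : R) (v i) (F i (v^~ s))) ->
  forall i, u i t = v i t.
Proof.
move=> uv0 hu hv.
(* The squared distance E satisfies |E'| <= K E. *)
pose E s := \sum_i (u i s + - v i s) * (u i s + - v i s).
pose d i s := F i (u^~ s) - F i (v^~ s).
pose dE s := \sum_i (d i s * (u i s + - v i s) + (u i s + - v i s) * d i s).
have hE s : Num.min 0 t <= s <= Num.max 0 t -> is_derive s (1 : R) E (dE s).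
  move=> st; apply: dr_sum => i.
  have hi := dr_add (hu i s st) (dr_opp (hv i s st)).
  exact: (dr_mul hi hi).
have E0 s : 0 <= E s by apply: sumr_ge0 => i _; rewrite -expr2 sqr_ge0.
(* Twice a product of two differences is at most the sum of their squares; summing over all pairs
   gives [2 * n] times [E]. *)
pose K : R := L * (2 * n%:R).
have hd s : `|dE s| <= K * E s.
  apply: le_trans (ler_norm_sum _ _ _) _.
  pose w i := `|u i s - v i s|.
  have hw i : `|d i s * (u i s + - v i s) + (u i s + - v i s) * d i s| <=
      L * \sum_j (w i * w i + w j * w j).
    rewrite (mulrC (d i s)) -mulr2n normrMn normrM -/(w i).
    apply: (@le_trans _ _ ((w i * (L * \sum_j w j)) *+ 2)).
      by rewrite lerMn2r /=; apply: ler_wpM2l; [exact: normr_ge0|exact: FL].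
    rewrite mulrCA -mulrnAr ler_pM2l // mulr_sumr -sumrMnl; apply: ler_sum => j _.
    have := sqr_ge0 (w i - w j); rewrite mulr2n; nra.
  apply: le_trans (ler_sum _ (fun i _ => hw i)) _.
  rewrite -mulr_sumr /K -mulrA ler_pM2l //.
  under eq_bigr do rewrite big_split /=.
  rewrite big_split /= exchange_big /=.
  have -> : \sum_(j < n) \sum_(i < n) w i * w i = n%:R * E s.
    rewrite (eq_bigr (fun=> E s)); first by rewrite big_const_ord iter_addr_0 mulr_natl.
    move=> j _; apply: eq_bigr => i _.
    by rewrite /w -normrM ger0_norm // -expr2 sqr_ge0.
  lra.
have Ex c s : is_derive s (1 : R) (fun s => expR (c * s)) (expR (c * s) * c).
  apply: dr_eq (dr_exp (dr_mul (dr_cst s c) (dr_id s))) _.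
  by rewrite mul0r add0r mulr1.
have Ez : E 0 = 0 by rewrite /E big1 // => i _; rewrite uv0 subrr mul0r.
have Et : E t = 0.
  apply/eqP; rewrite eq_le E0 andbT.
  case: (leP 0 t) => t0.
    have st s : 0 <= s <= t -> Num.min 0 t <= s <= Num.max 0 t.
      by rewrite (min_idPl t0) (max_idPr t0).
    have := @dr_nincr _ (fun s => E s * expR (- K * s))
      (fun s => dE s * expR (- K * s) + E s * (expR (- K * s) * - K)) 0 t t0.
    rewrite Ez mul0r pmulr_lle0 ?expR_gt0 //; apply.
      by move=> s /st /hE h; exact: (dr_mul h (Ex _ s)).
    move=> s _; have := hd s; rewrite ler_norml => /andP[_ h].
    have := expR_gt0 (- K * s); nra.
  have st s : t <= s <= 0 -> Num.min 0 t <= s <= Num.max 0 t.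
    by rewrite (min_idPr (ltW t0)) (max_idPl (ltW t0)).
  have := @dr_ndecr _ (fun s => E s * expR (K * s))
      (fun s => dE s * expR (K * s) + E s * (expR (K * s) * K)) t 0 (ltW t0).
  rewrite Ez mul0r pmulr_lle0 ?expR_gt0 //; apply.
    by move=> s /st /hE h; exact: (dr_mul h (Ex _ s)).
  move=> s _; have := hd s; rewrite ler_norml => /andP[h _].
  have := expR_gt0 (K * s); nra.
move=> i; apply/eqP; rewrite -subr_eq0 -sqrf_eq0 expr2; apply/eqP.
move: Et; rewrite /E => /eqP; rewrite psumr_eq0; last first.
  by move=> j _; rewrite -expr2 sqr_ge0.
by move=> /allP/(_ i); rewrite mem_index_enum => /(_ isT)/eqP.
Qed.

Lemma field_continuous (y : 'I_n -> R -> R) i :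
  (forall j, continuous (y j)) -> continuous (fun s => F i (y^~ s)).
Proof.
move=> yc s; apply/cvgrPdist_lt => e e0.
pose d := e / (L * n.+1%:R).
have d0 : 0 < d by rewrite divr_gt0 // mulr_gt0.
have H j : \forall x \near nbhs s, `|y j s - y j x| < d.
  have /cvgrPdist_lt h : y j x @[x --> s] --> y j s by exact: yc.
  exact: h.
have H' := @filter_forall R 'I_n (fun j x => `|y j s - y j x| < d) (nbhs s) _ H.
near=> x.
apply: le_lt_trans (FL _ _ _) _.
have Hx : forall j, `|y j s - y j x| < d by near: x; exact: H'.
have S : \sum_j `|y j s - y j x| <= n%:R * d.
  apply: (@le_trans _ _ (\sum_(j < n) d)).
    by apply: ler_sum => j _; exact: ltW.
  by rewrite big_const_ord iter_addr_0 mulr_natl.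
apply: (@le_lt_trans _ _ (L * (n%:R * d))); first by rewrite ler_pM2l.
rewrite (_ : e = L * (n.+1%:R * d)); last first.
  have LN : L * n.+1%:R != 0 by rewrite gt_eqF // mulr_gt0.
  by rewrite mulrA [RHS]mulrC /d divfK.
by rewrite ltr_pM2l // ltr_pM2r // ltr_nat.
Unshelve. all: by end_near. Qed.

Lemma le_exp_of_derive (f df : R -> R) (c K t : R) : 0 <= c -> 0 <= t ->
  f 0 = 0 -> (forall s, is_derive s (1 : R) f (df s)) ->
  (forall s, 0 <= s -> df s <= c * K * expR (K * s)) -> f t <= c * expR (K * t).
Proof.
move=> c0 t0 f0 hf hdf.
have hd s : is_derive s (1 : R) (fun s => f s + - (c * expR (K * s)))
    (df s + - (0 * expR (K * s) + c * (expR (K * s) * (0 * s + K * 1)))).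
  exact: (dr_add (hf s) (dr_opp (dr_mul (dr_cst s c)
    (dr_exp (dr_mul (dr_cst s K) (dr_id s)))))).
have hn s : 0 <= s <= t ->
    df s + - (0 * expR (K * s) + c * (expR (K * s) * (0 * s + K * 1))) <= 0.
  by move=> /andP[s0 _]; have := hdf s s0; lra.
have : f t + - (c * expR (K * t)) <= f 0 + - (c * expR (K * 0)).
  exact: (dr_nincr t0 (fun s _ => hd s) hn).
rewrite f0 mulr0 expR0; lra.
Qed.

(** One Picard step: integrating the weight [exp (K |s|)] gains a factor 1/K. *)
Lemma norm_le_exp_of_derive (f df : R -> R) (c K t : R) : 0 <= c ->
  f 0 = 0 -> (forall s, is_derive s (1 : R) f (df s)) ->
  (forall s, `|df s| <= c * K * expR (K * `|s|)) -> `|f t| <= c * expR (K * `|t|).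
Proof.
move=> c0 f0 hf hdf.
have main (f1 df1 : R -> R) u : 0 <= u -> f1 0 = 0 ->
    (forall s, is_derive s (1 : R) f1 (df1 s)) ->
    (forall s, `|df1 s| <= c * K * expR (K * `|s|)) -> `|f1 u| <= c * expR (K * u).
  move=> u0 f10 hf1 hdf1; rewrite ler_norml; apply/andP; split; last first.
    apply: (le_exp_of_derive c0 u0 f10 hf1) => s s0.
    by apply: le_trans (ler_norm _) _; rewrite -{2}(ger0_norm s0).
  rewrite lerNl; apply: (@le_exp_of_derive (fun s => - f1 s) (fun s => - df1 s) c K u c0 u0 _
    (fun s => dr_opp (hf1 s))).
  - by rewrite f10 oppr0.
  - move=> s s0; apply: le_trans (ler_norm _) _.
    by rewrite normrN -{2}(ger0_norm s0).
case: (leP 0 t) => t0.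
  by rewrite (ger0_norm t0); exact: main hdf.
have t0' : 0 <= - t by rewrite oppr_ge0 ltW.
have f0' : f (- 0) = 0 by rewrite oppr0.
have := @main (fun s => f (- s)) (fun s => df (- s) * - 1) (- t) t0' f0'
  (fun s => dr_comp (hf (- s)) (dr_opp (dr_id s))).
rewrite opprK (ltr0_norm t0); apply => s.
by rewrite mulrN1 normrN -(normrN s).
Qed.

(** The iteration contracts by 1/2 in the sup norm weighted with [exp (- K |t|)], so the solution is
    obtained on the whole line at once. *)
Lemma picard (y0 : 'I_n -> R) : exists y : 'I_n -> R -> R,
  (forall i, y i 0 = y0 i) /\ forall i t, is_derive t (1 : R) (y i) (F i (y^~ t)).
Proof.
(* [choice] asks for a value at every function; a discontinuous one gets a dummy. *)
have antid (f : R -> R) : exists g : R -> R, continuous f ->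
    g 0 = 0 /\ forall t, is_derive t (1 : R) g (f t).
  have [fc|nfc] := pselect (continuous f); last by exists f.
  by have [g hg] := antiderivative fc; exists g.
have [P hP] := choice antid.
pose T (y : 'I_n -> R -> R) i t := y0 i + P (fun s => F i (y^~ s)) t.
pose Y k := iter k T (fun i _ => y0 i).
have TD y : (forall j, continuous (y j)) ->
    (forall i, T y i 0 = y0 i) /\
    forall i t, is_derive t (1 : R) (T y i) (F i (y^~ t)).
  move=> yc; split=> [i|i t].
    by rewrite /T (proj1 (hP _ (field_continuous yc))) addr0.
  have h := proj2 (hP _ (field_continuous (i := i) yc)) t.
  by apply: dr_eq (dr_add (dr_cst t (y0 i)) h) _; rewrite add0r.
have Yc k j : continuous (Y k j).
  elim: k j => [|k IH] j t; first exact: cst_continuous.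
  exact: dr_continuous (proj2 (TD _ IH) j t).
have Y0 k i : Y k i 0 = y0 i.
  by case: k => [//|k]; exact: (proj1 (TD _ (Yc k))).
have YD k i t : is_derive t (1 : R) (Y k.+1 i) (F i (fun j => Y k j t)).
  exact: (proj2 (TD _ (Yc k))).
(* The 2 makes the contraction factor 1/2, and [n.+1] keeps [K] positive when n = 0. *)
pose K : R := 2 * L * n.+1%:R.
have K0 : 0 < K by rewrite !mulr_gt0.
pose e (t : R) := expR (K * `|t|).
have e1 t : 1 <= e t by rewrite /e -expR0 ler_expR mulr_ge0 // ltW.
have e0 t : 0 < e t by exact: expR_gt0.
pose M := \sum_i `|F i y0|.
pose D := M / K.
have M0 : 0 <= M by exact: sumr_ge0.
have D0 : 0 <= D by rewrite divr_ge0 // ltW.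
have DK : D * K = M by rewrite divfK // gt_eqF.
have step (u v : 'I_n -> R) (b : R) i : (forall j, `|u j - v j| <= b) ->
    `|F i u - F i v| <= 2^-1 * b * K.
  move=> h; apply: le_trans (FL _ _ _) _.
  have b0 : 0 <= b by apply: le_trans (h i); exact: normr_ge0.
  rewrite (_ : 2^-1 * b * K = L * (n.+1%:R * b)); last by rewrite /K; field.
  rewrite ler_pM2l //; apply: (@le_trans _ _ (\sum_(j < n) b)); first exact: ler_sum.
  by rewrite big_const_ord iter_addr_0 -[b *+ n]mulr_natl ler_wpM2r // ler_nat.
have dY k i t : `|Y k.+1 i t - Y k i t| <= D / 2 ^+ k * e t.
  elim: k i t => [|k IH] i t.
    rewrite expr0 divr1.
    have z0 : Y 1 i 0 + - Y 0 i 0 = 0 by rewrite !Y0 subrr.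
    have hD s : is_derive s (1 : R) (fun s => Y 1 i s + - Y 0 i s) (F i y0 + - 0).
      exact: (dr_add (YD 0 i s) (dr_opp (dr_cst s (y0 i)))).
    apply: (@norm_le_exp_of_derive (fun s => Y 1 i s + - Y 0 i s)
      (fun=> F i y0 + - 0) D K t D0 z0 hD) => s.
    rewrite oppr0 addr0 DK; apply: (@le_trans _ _ M).
      by rewrite /M (bigD1 i) //= lerDl sumr_ge0.
    by rewrite ler_peMr // e1.
  have z0 : Y k.+2 i 0 + - Y k.+1 i 0 = 0 by rewrite !Y0 subrr.
  have c0 : 0 <= D / 2 ^+ k.+1 by rewrite divr_ge0 // exprn_ge0.
  apply: (@norm_le_exp_of_derive (fun s => Y k.+2 i s + - Y k.+1 i s)
    (fun s => F i (fun j => Y k.+1 j s) + - F i (fun j => Y k j s)) _ K t c0 z0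
    (fun s => dr_add (YD k.+1 i s) (dr_opp (YD k i s)))) => s.
  apply: le_trans (step _ _ _ i (fun j => IH j s)) _.
  rewrite le_eqVlt; apply/orP; left; apply/eqP; rewrite /e exprS invfM; ring.
(* The tail of the geometric series of the bounds [dY]. *)
pose r k t := 2 * (D / 2 ^+ k * e t).
have rS k t : r k t = r k.+1 t + D / 2 ^+ k * e t.
  by rewrite /r exprS invfM; field.
have r0 k t : 0 <= r k t by rewrite !mulr_ge0 ?invr_ge0 ?exprn_ge0 // ltW.
have [y hy] : exists y : 'I_n -> R -> R, forall k i t, `|y i t - Y k i t| <= r k t.
  (* The intervals of radius [r k t] around [Y k i t] are nested; the supremum of their left ends
     lies in all of them, which gives the limit together with its error bound. *)
  exists (fun i t => sup (range (fun k => Y k i t - r k t))) => k i t.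
  pose a k := Y k i t - r k t; pose b k := Y k i t + r k t.
  have aS m : a m <= a m.+1.
    by have := dY m i t; rewrite ler_norml /a (rS m) => /andP[h _]; lra.
  have bS m : b m.+1 <= b m.
    by have := dY m i t; rewrite ler_norml /b (rS m) => /andP[_ h]; lra.
  have am m p : (m <= p)%N -> a m <= a p.
    by move=> /subnK <-; elim: (p - m)%N => // q IH; apply: le_trans IH _; exact: aS.
  have bm m p : (m <= p)%N -> b p <= b m.
    by move=> /subnK <-; elim: (p - m)%N => // q IH; apply: le_trans _ IH; exact: bS.
  have ab m p : a m <= b p.
    apply: le_trans (am _ _ (leq_maxl m p)) _; apply: le_trans (bm _ _ (leq_maxr m p)).
    by rewrite /a /b; have := r0 (maxn m p) t; lra.
  have hs : has_sup (range a).
    by split; [exists (a 0), 0|exists (b 0) => _ [m _ <-]].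
  have lo : a k <= sup (range a) by apply: sup_ubound; [exact: hs.2|exists k].
  have up : sup (range a) <= b k by apply: ge_sup; [exact: hs.1|move=> _ [m _ <-]].
  by rewrite ler_norml; move: lo up; rewrite /a /b => *; apply/andP; split; lra.
have rsmall (t eps : R) : 0 < eps -> exists k, r k t < eps.
  move=> eps0.
  pose c := 2 * (D * e t); have c0 : 0 <= c by do ?apply: mulr_ge0 => //; exact: ltW.
  have ce : 0 <= c / eps by apply: divr_ge0 => //; exact: ltW.
  exists (Num.bound (c / eps)); set k := Num.bound _.
  have h1 : c / eps < k%:R by exact: archi_boundP.
  have h2 : (k%:R : R) <= 2 ^+ k by rewrite -natrX ler_nat; apply/ltnW/ltn_expl.
  rewrite /r (_ : 2 * (D / 2 ^+ k * e t) = c / 2 ^+ k); last by rewrite /c; ring.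
  rewrite ltr_pdivrMr ?exprn_gt0 // mulrC -ltr_pdivrMr //.
  exact: lt_le_trans h1 h2.
have yc j : continuous (y j).
  move=> t; apply/cvgrPdist_lt => eps eps0.
  have [k hk] := rsmall (`|t| + 1) (eps / 3) (divr_gt0 eps0 (ltr0n _ 3)).
  have rk s : `|s| <= `|t| + 1 -> r k s < eps / 3.
    move=> st; apply: le_lt_trans hk.
    apply: ler_wpM2l => //; apply: ler_wpM2l; first by rewrite divr_ge0 // exprn_ge0.
    rewrite /e ler_expR (ger0_norm (addr_ge0 (normr_ge0 t) ler01)).
    by rewrite ler_pM2l.
  have eps3 : 0 < eps / 3 by rewrite divr_gt0.
  have /cvgrPdist_lt/(_ _ eps3) Yt : Y k j x @[x --> t] --> Y k j t by exact: Yc.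
  have /cvgrPdist_lt/(_ 1 ltr01) tt : x @[x --> t] --> t by exact: cvg_id.
  near=> s.
  have h1 := hy k j t; have h2 := hy k j s.
  have h3 : `|Y k j t - Y k j s| < eps / 3 by near: s.
  have st : `|t - s| < 1 by near: s.
  have st' : `|s| <= `|t| + 1.
    have := ler_normD (s - t) t; rewrite subrK distrC; lra.
  have h4 := rk s st'.
  have h5 := rk t (ler_wpDr ler01 (lexx _)).
  rewrite (_ : y j t - y j s = (y j t - Y k j t) + (Y k j t - Y k j s) - (y j s - Y k j s));
    last by ring.
  apply: le_lt_trans (ler_normB _ _) _.
  by have := ler_normD (y j t - Y k j t) (Y k j t - Y k j s); lra.
have [z0 zD] := TD _ yc.
have zy i t : T y i t = y i t.
  apply/eqP; rewrite -subr_eq0 -normr_le0; apply/ler_addgt0Pl => eps eps0.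
  rewrite addr0.
  have [k hk] := rsmall t (eps / 2) (divr_gt0 eps0 (ltr0n _ 2)).
  have h1 := hy k.+1 i t.
  have h2 : `|T y i t - Y k.+1 i t| <= D / 2 ^+ k * e t.
    have c0 : 0 <= D / 2 ^+ k by rewrite divr_ge0 // exprn_ge0.
    have i0 : T y i 0 + - Y k.+1 i 0 = 0 by rewrite z0 Y0 subrr.
    apply: (@norm_le_exp_of_derive (fun s => T y i s + - Y k.+1 i s)
      (fun s => F i (y^~ s) + - F i (fun j => Y k j s)) _ K t c0 i0
      (fun s => dr_add (zD i s) (dr_opp (YD k i s)))) => s.
    apply: le_trans (step _ _ _ i (fun j => hy k j s)) _.
    rewrite le_eqVlt; apply/orP; left; apply/eqP; rewrite /r /e; field.
    by rewrite expf_neq0.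
  rewrite (_ : T y i t - y i t = (T y i t - Y k.+1 i t) - (y i t - Y k.+1 i t));
    last by ring.
  apply: le_trans (ler_normB _ _) _.
  by have := rS k t; have := r0 k.+1 t; lra.
exists y; split=> [i|i t]; first by rewrite -zy.
rewrite -(_ : T y i = y i); last by apply/funext => s; exact: zy.
exact: zD.
Unshelve. all: by end_near. Qed.

End CauchyLipschitz.

(** * Bounded Lipschitz functions *)

Section BoundedLipschitz.
Context {R : realType} {n : nat}.
Implicit Types (f g : ('I_n -> R) -> R) (u v : 'I_n -> R).

(** Lipschitz functions are closed under products only together with boundedness. *)
Definition bounded_lipschitz f : Prop := exists M L, [/\ 0 <= M, 0 <= L,
  forall u, `|f u| <= M & forall u v, `|f u - f v| <= L * \sum_j `|u j - v j|].

Lemma bl_cst c : bounded_lipschitz (fun=> c).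
Proof.
exists `|c|, 0; split => // u v.
by rewrite subrr normr0 mul0r.
Qed.

Lemma bl_add f g : bounded_lipschitz f -> bounded_lipschitz g ->
  bounded_lipschitz (fun u => f u + g u).
Proof.
move=> [M [L [M0 L0 fM fL]]] [M' [L' [M'0 L'0 gM gL]]].
exists (M + M'), (L + L'); split; [exact: addr_ge0|exact: addr_ge0| |].
  by move=> u; apply: le_trans (ler_normD _ _) _; exact: lerD.
move=> u v; rewrite opprD addrACA mulrDl; apply: le_trans (ler_normD _ _) _.
exact: lerD.
Qed.

Lemma bl_mul f g : bounded_lipschitz f -> bounded_lipschitz g ->
  bounded_lipschitz (fun u => f u * g u).
Proof.
move=> [M [L [M0 L0 fM fL]]] [M' [L' [M'0 L'0 gM gL]]].
exists (M * M'), (M * L' + M' * L); split.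
- exact: mulr_ge0.
- by rewrite addr_ge0 // mulr_ge0.
- by move=> u; rewrite normrM ler_pM.
- move=> u v.
  rewrite (_ : f u * g u - f v * g v = f u * (g u - g v) + g v * (f u - f v)); last by ring.
  apply: le_trans (ler_normD _ _) _; rewrite !normrM mulrDl -!mulrA.
  by apply: lerD; apply: ler_pM.
Qed.

Lemma bl_opp f : bounded_lipschitz f -> bounded_lipschitz (fun u => - f u).
Proof.
move=> [M [L [M0 L0 fM fL]]]; exists M, L; split => // [u|u v]; first by rewrite normrN.
by rewrite -opprD normrN.
Qed.

Lemma coord_le_sum u v i : `|u i - v i| <= \sum_j `|u j - v j|.
Proof. by rewrite (bigD1 i) //= lerDl sumr_ge0. Qed.

Lemma max_lipschitz (a x y : R) : `|Num.max a x - Num.max a y| <= `|x - y|.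
Proof.
have := ler_norm (x - y); have := ler_norm (y - x); rewrite (distrC y) => h1 h2.
rewrite ler_norml /Num.max; apply/andP; split;
  case: (ltP a x) => ?; case: (ltP a y) => ?; lra.
Qed.

Lemma min_lipschitz (a x y : R) : `|Num.min x a - Num.min y a| <= `|x - y|.
Proof.
have := ler_norm (x - y); have := ler_norm (y - x); rewrite (distrC y) => h1 h2.
rewrite ler_norml /Num.min; apply/andP; split;
  case: (ltP x a) => ?; case: (ltP y a) => ?; lra.
Qed.

Lemma bl_clamp k i : 0 <= k ->
  bounded_lipschitz (fun u => Num.max (- k) (Num.min (u i) k)).
Proof.
move=> k0; exists k, 1; split => // [u|u v].
  rewrite ler_norml; apply/andP; split; first by rewrite le_max lexx.
  by rewrite ge_max ge_min lexx orbT; lra.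
rewrite mul1r; apply: le_trans (coord_le_sum u v i).
exact: le_trans (max_lipschitz _ _ _) (min_lipschitz _ _ _).
Qed.

(** Truncation from above is enough, since below [k] the slope of the exponential is at most
    [expR k]. *)
Lemma bl_exp_min k i : bounded_lipschitz (fun u => expR (Num.min (u i) k)).
Proof.
exists (expR k), (expR k); split; try exact: expR_ge0.
  by move=> u; rewrite ger0_norm ?expR_ge0 // ler_expR ge_min lexx orbT.
have main (x y : R) : y <= x -> expR (Num.min x k) - expR (Num.min y k) <= expR k * (x - y).
  move=> yx; set a := Num.min x k; set b := Num.min y k.
  have ba : b <= a.
    by rewrite /a /b /Num.min; case: (ltP x k) => ?; case: (ltP y k) => ?; lra.
  have ak : a <= k by rewrite /a ge_min lexx orbT.
  have ab : a - b <= x - y.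
    by rewrite /a /b /Num.min; case: (ltP x k) => ?; case: (ltP y k) => ?; lra.
  have h : 1 + (b - a) <= expR (b - a) by exact: expR_ge1Dx.
  have e : expR b = expR a * expR (b - a) by rewrite -expRD addrC subrK.
  have ea := expR_gt0 a; have eak : expR a <= expR k by rewrite ler_expR.
  apply: (@le_trans _ _ (expR a * (a - b))); first by rewrite e; nra.
  by apply: ler_pM => //; rewrite ?subr_ge0 ?expR_ge0.
move=> u v; apply: (@le_trans _ _ (expR k * `|u i - v i|)); last first.
  by rewrite ler_pM2l ?expR_gt0 // coord_le_sum.
have mono (x y : R) : y <= x -> expR (Num.min y k) <= expR (Num.min x k).
  by move=> yx; rewrite ler_expR /Num.min; case: (ltP x k) => ?; case: (ltP y k) => ?; lra.
case: (leP (v i) (u i)) => h.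
  by rewrite !ger0_norm ?subr_ge0 // ?mono // main.
rewrite distrC (distrC (u i)) !ger0_norm ?subr_ge0 ?mono ?main // ltW //.
Qed.

Lemma bl_uniform (F : 'I_n -> ('I_n -> R) -> R) :
  (forall i, bounded_lipschitz (F i)) -> exists2 L, 0 < L &
  forall i u v, `|F i u - F i v| <= L * \sum_j `|u j - v j|.
Proof.
move=> h.
have h' i : exists l, 0 <= l /\ forall u v, `|F i u - F i v| <= l * \sum_j `|u j - v j|.
  by have [M [l [_ l0 _ hl]]] := h i; exists l.
have [L hL] := choice h'.
exists (1 + \sum_i L i).
  by rewrite ltr_pwDl // sumr_ge0 // => i _; case: (hL i).
move=> i u v; apply: le_trans ((hL i).2 u v) _; apply: ler_wpM2r; first exact: sumr_ge0.
rewrite (bigD1 i) //= addrCA lerDl addr_ge0 // sumr_ge0 // => j _.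
by case: (hL j).
Qed.

End BoundedLipschitz.

(** * Barriers and decay estimates *)

Section Comparison.
Context {R : realType}.

(** If [x t > k], let [u] be the last earlier time with [x u <= k]. On [[u, t]] the function is
    above [k] after [u], so it cannot increase there, by the mean value theorem. *)
Lemma barrier (x dx : R -> R) (k t : R) : 0 <= t -> x 0 <= k ->
  (forall s : R, 0 <= s -> is_derive s (1 : R) x (dx s)) ->
  (forall s : R, 0 <= s -> k <= x s -> dx s <= 0) -> x t <= k.
Proof.
move=> t0 x0 hx hk; rewrite leNgt; apply/negP => xt.
pose S := [set s | 0 <= s <= t /\ x s <= k].
have S0 : S 0 by rewrite /S /= lexx t0.
have hS : has_sup S by split; [exists 0|exists t => s [/andP[]]].
set u := sup S.
have u0 : 0 <= u by apply: sup_ubound => //; exact: hS.2.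
have ut : u <= t by apply: ge_sup; [exact: hS.1|move=> s [/andP[]]].
have xu : x u <= k.
  rewrite leNgt; apply/negP => xu.
  have /cvgrPdist_lt/(_ (x u - k)) : x s @[s --> u] --> x u.
    exact: dr_continuous (hx u u0).
  rewrite subr_gt0 => /(_ xu) [d /= d0 hd].
  have [s Ss us] := sup_adherent d0 hS.
  have su : s <= u by apply: sup_ubound => //; exact: hS.2.
  have := hd s; rewrite /ball_ /= -/u in us *; rewrite ger0_norm ?subr_ge0 // => /(_ _).
  have us' : u - s < d by move: us; rewrite /u; lra.
  move=> /(_ us') h; have := ler_norm (x u - x s); case: Ss => _; lra.
have xs s : u < s -> s <= t -> k <= x s.
  move=> us st; rewrite leNgt; apply/negP => xs.
  have : s <= u; last by lra.
  apply: sup_ubound; first exact: hS.2.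
  by split; [rewrite st andbT; lra|exact: ltW].
have utlt : u < t.
  by rewrite lt_neqAle ut andbT; apply/eqP => e; move: xt; rewrite -e ltNge xu.
have [||c] := MVT (f := x) (df := dx) utlt.
- by move=> s; rewrite in_itv /= => /andP[us _]; apply: hx; lra.
- apply: continuous_in_subspaceT => s; rewrite inE /= in_itv /= => /andP[us _].
  by apply: dr_continuous (hx s _); lra.
rewrite in_itv /= => /andP[uc ct] e.
have dc : dx c <= 0 by apply: hk; [lra|apply: xs => //; exact: ltW].
have : dx c * (t - u) <= 0 by rewrite mulr_le0_ge0 // subr_ge0.
lra.
Qed.

(** The derivative of [p^-2] is [- 2 p' / p^3], hence at most 6. *)
Lemma square_lower_bound (p dp : R -> R) (t : R) : 0 <= t ->
  (forall s : R, 0 <= s -> 0 < p s) ->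
  (forall s : R, 0 <= s -> is_derive s (1 : R) p (dp s)) ->
  (forall s : R, 0 <= s -> - (3 * p s ^+ 3) <= dp s) ->
  (p 0 ^- 2 + 6 * t)^-1 <= p t ^+ 2.
Proof.
move=> t0 p0 hp hdp.
have pp s : 0 <= s -> 0 < p s * p s by move=> s0; rewrite mulr_gt0 ?p0.
have h : (p t * p t)^-1 + - (6 * t) <= (p 0 * p 0)^-1 + - (6 * 0).
  apply: (@dr_nincr _ (fun s => (p s * p s)^-1 + - (6 * s)) (fun s =>
    - (dp s * p s + p s * dp s) / (p s * p s) ^+ 2 + - (0 * s + 6 * 1)) 0 t t0).
    move=> s /andP[s0 _].
    exact: (dr_add (@dr_inv _ (fun s => p s * p s) s _ (lt0r_neq0 (pp s s0))
      (dr_mul (hp s s0) (hp s s0)))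
      (dr_opp (dr_mul (dr_cst s 6) (dr_id s)))).
  move=> s /andP[s0 _].
  suff : - (dp s * p s + p s * dp s) / (p s * p s) ^+ 2 <= 6 by lra.
  rewrite ler_pdivrMr ?exprn_gt0 ?pp //.
  have := hdp s s0; have := p0 s s0; move: (p s) (dp s) => a b a0 ab.
  nra.
have q1 : 0 < p 0 ^- 2 + 6 * t.
  by apply: ltr_wpDr; [exact: mulr_ge0|rewrite invr_gt0 exprn_gt0 // p0].
have q2 : 0 < (p t ^+ 2)^-1 by rewrite invr_gt0 exprn_gt0 // p0.
rewrite -[leRHS]invrK lef_pV2 ?posrE //.
by move: h; rewrite -!expr2; lra.
Qed.

(** An integrating factor: [r] times the power [k / 6] of [q0 + 6 s] does not increase, because the
    logarithm of that power has derivative [k / (q0 + 6 s)], at most [k * rho2 s]. *)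
Lemma decay (r dr rho2 : R -> R) (k q0 : R) : 0 < k -> 0 < q0 ->
  (forall s : R, 0 <= s -> 0 <= r s) ->
  (forall s : R, 0 <= s -> is_derive s (1 : R) r (dr s)) ->
  (forall s : R, 0 <= s -> (q0 + 6 * s)^-1 <= rho2 s) ->
  (forall s : R, 0 <= s -> dr s <= - (k * rho2 s * r s)) ->
  r t @[t --> +oo] --> 0.
Proof.
move=> k0 q00 r0 hr hrho hdr.
pose m := k / 6; have m0 : 0 < m by rewrite divr_gt0.
have qs s : 0 <= s -> 0 < q0 + 6 * s by move=> s0; lra.
(* The 1 keeps [C] positive when [r 0 = 0] and makes the bound below strict. *)
pose C := r 0 * expR (m * ln q0) + 1.
have C0 : 0 < C by rewrite ltr_wpDl // mulr_ge0 ?expR_ge0 ?r0.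
have bound t : 0 <= t -> r t < C * expR (- (m * ln (q0 + 6 * t))).
  move=> t0.
  have h : r t * expR (m * ln (q0 + 6 * t)) <= r 0 * expR (m * ln (q0 + 6 * 0)).
    apply: (@dr_nincr _ (fun s => r s * expR (m * ln (q0 + 6 * s)))
      (fun s => dr s * expR (m * ln (q0 + 6 * s)) + r s * (expR (m * ln (q0 + 6 * s)) *
        (0 * ln (q0 + 6 * s) + m * ((q0 + 6 * s)^-1 * (0 + (0 * s + 6 * 1)))))) 0 t t0).
      move=> s /andP[s0 _].
      have hl := @dr_comp _ (@ln R) (fun s => q0 + 6 * s) s _ _ (is_derive1_ln (qs s s0))
        (dr_add (dr_cst s q0) (dr_mul (dr_cst s 6) (dr_id s))).
      exact: (dr_mul (hr s s0) (dr_exp (dr_mul (dr_cst s m) hl))).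
    move=> s /andP[s0 _].
    have := hdr s s0; have := hrho s s0; have := r0 s s0.
    have := expR_gt0 (m * ln (q0 + 6 * s)).
    move: (expR _) ((q0 + 6 * s)^-1) (r s) (dr s) (rho2 s) => e q a b c e0 a0 qc hb.
    have km : k = 6 * m by rewrite /m; field.
    suff : b + 6 * m * a * q <= 0.
      move=> h; rewrite (_ : _ + _ = e * (b + 6 * m * a * q)); last by ring.
      by rewrite mulr_ge0_le0 // ltW.
    have : 6 * m * a * q <= 6 * m * a * c.
      by apply: ler_wpM2l => //; rewrite !mulr_ge0 // ltW.
    by move: hb; rewrite km; lra.
  rewrite expRN -ltr_pdivrMr ?invr_gt0 ?expR_gt0 // invrK.
  by apply: le_lt_trans h _; rewrite mulr0 addr0 /C ltrDl.
apply/cvgrPdist_lt => e e0.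
near=> t.
have t0 : 0 <= t by near: t; apply: nbhs_pinfty_ge; exact: num_real.
rewrite sub0r normrN ger0_norm ?r0 //.
apply: lt_le_trans (bound t t0) _.
have H : expR (- (ln (e / C) / m)) <= t.
  by near: t; apply: nbhs_pinfty_ge; exact: num_real.
have eC : 0 < e / C by rewrite divr_gt0.
rewrite mulrC -ler_pdivlMr // -(lnK (x := e / C)) ?posrE // ler_expR.
rewrite lerNl -ler_pdivrMl // mulrC mulNr.
rewrite -ler_expR lnK ?posrE ?qs //.
apply: le_trans H _; lra.
Unshelve. all: by end_near. Qed.

End Comparison.

(** * The Bach flow in the LDL parameters *)

Section GramParameters.
Context {R : realType}.
Local Notation V := 'rV[R]_4.
Implicit Types (n : nat -> R) (l : nat -> nat -> R).

(* A left-invariant metric is written L^T diag(n) L with L lower unitriangular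
   with subdiagonal entries l. *)
Definition unitri l (k j : nat) : R :=
  if j == k then 1 else if (j < k)%N then l k j else 0.

Definition gram n l : 'M[R]_4 :=
  \matrix_(i < 4, j < 4) \sum_(k < 4) n k * unitri l k i * unitri l k j.

(* qA, qB and qC are the squares of the structure constants a, b, c of the adapted
   orthonormal frame. *)
Definition qA n : R := n 2 / (n 0%N * n 1%N).
Definition qC n : R := n 3 / (n 0%N * n 2).
Definition qbeta l : R := l 3 2 - l 2 1%N.
Definition qB n l : R := qbeta l ^+ 2 * (n 3 / (n 0%N * n 1%N)).

(** The diagonal of [bach_frame] in the squares A, B, C; along the flow these are the logarithmic
    derivatives of the diagonal factors. *)
Definition bdiag (A B C : R) (k : nat) : R :=
  match k with
  | 0%N => A * B - A * C / 8 + A ^+ 2 / 2 + B * C + B ^+ 2 / 2 + C ^+ 2 / 2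
  | 1%N => A * B - A * C / 24 + A ^+ 2 / 2 + B * C / 3 + B ^+ 2 / 2 - C ^+ 2 / 6
  | 2 => - (A * B) + A * C / 24 - 5 / 6 * A ^+ 2 + B * C / 3 - B ^+ 2 / 6 + C ^+ 2 / 2
  | _ => - (A * B) + A * C / 8 - A ^+ 2 / 6 - 5 / 3 * (B * C) - 5 / 6 * B ^+ 2
              - 5 / 6 * C ^+ 2
  end.

(** [shear2] and [shear3] are the entries (2, 1) and (3, 2), the only nonzero ones, of the matrix
    [S] with [L' = S L] along the flow. They are odd in [qbeta], as the off-diagonal Bach components
    are odd in [b]. *)
Definition shear2 (A B C beta : R) : R := 2 / 3 * (A + B + C) * beta * C.
Definition shear3 (A B C beta : R) : R := - (2 / 3 * (A + B + C) * beta * A).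

(** With [D] the diagonal factor this is [D' + S^T D + D S]; conjugation by [L] gives the derivative
    of the Gram matrix. *)
Definition vel_core n l (p q : nat) : R :=
  let A := qA n in let B := qB n l in let C := qC n in
  match p, q with
  | 0%N, 0%N | 1%N, 1%N | 2, 2 | 3, 3 => n p * bdiag A B C p
  | 1%N, 2 | 2, 1%N => n 2 * shear2 A B C (qbeta l)
  | 2, 3 | 3, 2 => n 3 * shear3 A B C (qbeta l)
  | _, _ => 0
  end.

Definition gram_vel n l : 'M[R]_4 := \matrix_(i < 4, j < 4)
  \sum_(p < 4) \sum_(q < 4) unitri l p i * vel_core n l p q * unitri l q j.

Definition gram_root n l : 'M[R]_4 :=
  \matrix_(k < 4, j < 4) (Num.sqrt (n k) * unitri l k j).

Section Positive.
Variables (n : nat -> R) (l : nat -> nat -> R).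
Hypothesis n0 : forall k, (k < 4)%N -> 0 < n k.

Let s k := Num.sqrt (n k).

Let sP k : (k < 4)%N -> 0 < s k.
Proof. by move=> k4; rewrite sqrtr_gt0 n0. Qed.

Let ss k : (k < 4)%N -> n k = s k * s k.
Proof. by move=> k4; rewrite -expr2 sqr_sqrtr // ltW // n0. Qed.

Definition fr_a := s 2 / (s 0%N * s 1%N).
Definition fr_b := qbeta l * (s 3 / (s 0%N * s 1%N)).
Definition fr_c := s 3 / (s 0%N * s 2).

Lemma fr_sqr : (fr_a ^+ 2 = qA n) * (fr_b ^+ 2 = qB n l) * (fr_c ^+ 2 = qC n).
Proof.
rewrite /fr_a /fr_b /fr_c /qA /qB /qC !ss //.
have [? ? ? ?] := And4 (lt0r_neq0 (sP (k := 0) isT)) (lt0r_neq0 (sP (k := 1) isT))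
  (lt0r_neq0 (sP (k := 2) isT)) (lt0r_neq0 (sP (k := 3) isT)).
by split; [split|]; field; do ?[apply/andP; split].
Qed.

Lemma gram_root_unit : gram_root n l \in unitmx.
Proof.
rewrite unitmxE det_trig; last first.
  apply/is_trig_mxP => i j ij; rewrite mxE /unitri.
  by rewrite gtn_eqF // ltnNge ltnW //= mulr0.
rewrite unitfE; apply/prodf_neq0 => i _.
by rewrite mxE /unitri eqxx mulr1 lt0r_neq0 // sP.
Qed.

Lemma gram_rootE : (gram_root n l)^T *m gram_root n l = gram n l.
Proof.
apply/matrixP => i j; rewrite !mxE; apply: eq_bigr => k _; rewrite !mxE.
by rewrite mulrACA -/(s k) -ss // mulrA.
Qed.

Lemma gram_root_morph : n4_frame_morph (gram_root n l) fr_a fr_b fr_c.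
Proof.
have := And4 (lt0r_neq0 (sP (k := 0) isT)) (lt0r_neq0 (sP (k := 1) isT))
  (lt0r_neq0 (sP (k := 2) isT)) (lt0r_neq0 (sP (k := 3) isT)).
move=> + r p q; rewrite !big4 !mxE /fr_a /fr_b /fr_c /qbeta -!/(s _).
move: (s) => u [u0 u1 u2 u3].
by move: r; apply: ord4_ind; move: p; apply: ord4_ind; move: q; apply: ord4_ind;
  rewrite /= /unitri /=; field; rewrite ?u0 ?u1 ?u2 ?u3.
Qed.

Lemma gram_root_vel :
  (gram_root n l)^T *m bach_mx fr_a fr_b fr_c *m gram_root n l = gram_vel n l.
Proof.
have [? ? ? ?] := And4 (lt0r_neq0 (sP (k := 0) isT)) (lt0r_neq0 (sP (k := 1) isT))
  (lt0r_neq0 (sP (k := 2) isT)) (lt0r_neq0 (sP (k := 3) isT)).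
(* Here the square roots disappear: every entry becomes rational in the diagonal factors and
   [qbeta]. *)
have core p q : (p < 4)%N -> (q < 4)%N ->
    s p * bach_frame fr_a fr_b fr_c p q * s q = vel_core n l p q.
  have [[ea eb] ec] := fr_sqr.
  case: p => [|[|[|[|p]]]] // _; case: q => [|[|[|[|q]]]] // _;
    rewrite /bach_frame /vel_core /bdiag /shear2 /shear3 ?ea ?eb ?ec ?mulr0 ?mul0r //;
    rewrite ?ss //; try ring;
    rewrite /fr_a /fr_b /fr_c /qA /qC; rewrite ?ss //; move: (qB n l) => B;
    by field; do ?[apply/andP; split].
apply/matrixP => i j; rewrite mxE [RHS]mxE exchange_big.
apply: eq_bigr => q _ /=; rewrite !mxE mulr_suml; apply: eq_bigr => p _.
by rewrite !mxE -core // -/(s _) -/(s _); ring.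
Qed.

Lemma gram_bach_velocity x :
  bach_velocity (linv (gram n l)) x = linv (gram_vel n l) x.
Proof.
by rewrite -gram_rootE (linv_bach_velocity _ gram_root_unit gram_root_morph) gram_root_vel.
Qed.

Lemma gram_scal x : scal (linv (gram n l)) x = - ((qA n + qB n l + qC n) / 2).
Proof.
by rewrite -gram_rootE (linv_scal _ gram_root_unit gram_root_morph) !fr_sqr.
Qed.

Lemma gram_sym : (gram n l)^T = gram n l.
Proof.
by apply/matrixP => i j; rewrite !mxE; apply: eq_bigr => k _; ring.
Qed.

Lemma gram_posdef (v : V) : v != 0 -> 0 < (v *m gram n l *m v^T) 0 0.
Proof.
move=> v0; set u := v *m (gram_root n l)^T.
have u0 : u != 0.
  apply: contra v0 => /eqP e.
  have ut : (gram_root n l)^T \in unitmx by rewrite unitmx_tr gram_root_unit.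
  by rewrite -[v](mulmxK ut) -/u e mul0mx.
rewrite -gram_rootE (_ : _ *m _ *m v^T = u *m u^T); last first.
  by rewrite /u trmx_mul trmxK !mulmxA.
clearbody u; rewrite mxE (eq_bigr (fun i => u 0 i ^+ 2)) => [|i _]; last by rewrite mxE expr2.
rewrite lt_neqAle sumr_ge0 ?andbT; last by move=> i _; rewrite sqr_ge0.
rewrite eq_sym; apply: contra u0; rewrite psumr_eq0; last by move=> i _; rewrite sqr_ge0.
move=> /allP h; apply/eqP/rowP => i; rewrite [RHS]mxE; apply/eqP.
by have := h i (mem_index_enum i); rewrite sqrf_eq0.
Qed.

Lemma gram_left_invariant : left_invariant_metric (linv (gram n l)).
Proof. exact: linv_left_invariant gram_sym gram_posdef. Qed.

End Positive.

End GramParameters.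

Section MatrixDerivative.
Context {R : realType}.

Lemma is_derive_mx m n (M : R -> 'M[R]_(m, n)) (D : 'M[R]_(m, n)) t :
  (forall i j, is_derive t (1 : R) (fun s => M s i j) (D i j)) ->
  is_derive t (1 : R) M D.
Proof.
move=> h; have d : derivable M t 1.
  by apply/derivable_mxP => i j; case: (h i j).
apply: DeriveDef => //; rewrite derive_mx //; apply/matrixP => i j; rewrite mxE.
by case: (h i j).
Qed.

Lemma is_derive_entry m n (M : R -> 'M[R]_(m, n)) (D : 'M[R]_(m, n)) t i j :
  is_derive t (1 : R) M D -> is_derive t (1 : R) (fun s => M s i j) (D i j).
Proof.
move=> [d e]; have /derivable_mxP/(_ i j) dij := d.
by apply: DeriveDef => //; rewrite -e derive_mx // mxE.
Qed.

Lemma linv_derive (G : R -> 'M[R]_4) (D : 'M[R]_4) t x :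
  (forall i j, is_derive t (1 : R) (fun s => G s i j) (D i j)) ->
  is_derive t (1 : R) (fun s => linv (G s) x) (linv D x).
Proof.
move=> h; apply: is_derive_mx => i j.
have E (M : 'M[R]_4) : linv M x i j =
    \sum_(q < 4) \sum_(p < 4) theta 1 0 1 x p i * theta 1 0 1 x q j * M p q.
  rewrite /linv mxE; apply: eq_bigr => q _; rewrite mxE mulr_suml.
  by apply: eq_bigr => p _; rewrite mxE; ring.
rewrite E (_ : (fun s => _) = (fun s => \sum_(q < 4) \sum_(p < 4)
   theta 1 0 1 x p i * theta 1 0 1 x q j * G s p q)); last first.
  by apply/funext => s; rewrite E.
have hd p q : is_derive t (1 : R) (fun s => theta 1 0 1 x p i * theta 1 0 1 x q j * G s p q)
    (theta 1 0 1 x p i * theta 1 0 1 x q j * D p q).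
  have := dr_mul (dr_cst t (theta 1 0 1 x p i * theta 1 0 1 x q j)) (h p q).
  by rewrite mul0r add0r.
exact: (dr_sum (fun q => dr_sum (fun p => hd p q))).
Qed.

End MatrixDerivative.

(** * LDL factorization of a positive definite Gram matrix *)

Section GramDecomposition.
Context {R : realType}.
Local Notation V := 'rV[R]_4.
Variable G : 'M[R]_4.

(** The factorization is [L^T D L] with [L] lower triangular, so the last row of [G] involves only
    the last row of [L], and elimination runs upwards from there. *)
Definition ldl_n3 : R := G 3 3.
Definition ldl_l3 (j : 'I_4) : R := G 3 j / ldl_n3.
Definition ldl_n2 : R := G 2 2 - ldl_n3 * ldl_l3 2 ^+ 2.
Definition ldl_l2 (j : 'I_4) : R := (G 2 j - ldl_n3 * ldl_l3 2 * ldl_l3 j) / ldl_n2.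
Definition ldl_n1 : R := G 1 1 - ldl_n2 * ldl_l2 1 ^+ 2 - ldl_n3 * ldl_l3 1 ^+ 2.
Definition ldl_l1 : R :=
  (G 1 0 - ldl_n2 * ldl_l2 1 * ldl_l2 0 - ldl_n3 * ldl_l3 1 * ldl_l3 0) / ldl_n1.
Definition ldl_n0 : R :=
  G 0 0 - ldl_n1 * ldl_l1 ^+ 2 - ldl_n2 * ldl_l2 0 ^+ 2 - ldl_n3 * ldl_l3 0 ^+ 2.

Definition ldl_n (k : nat) : R :=
  match k with 0%N => ldl_n0 | 1%N => ldl_n1 | 2 => ldl_n2 | _ => ldl_n3 end.

Definition ldl_l (k j : nat) : R :=
  match k with
  | 1%N => ldl_l1 | 2 => ldl_l2 (inord j) | _ => ldl_l3 (inord j)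
  end.

Lemma inord4 : ((inord 0 : 'I_4) = 0) * ((inord 1 : 'I_4) = 1) * ((inord 2 : 'I_4) = 2)
  * ((inord 3 : 'I_4) = 3).
Proof. by split; [split; [split|]|]; apply/val_inj; rewrite /= inordK. Qed.

Hypothesis Gsym : G^T = G.
Hypothesis Gpos : forall v : V, v != 0 -> 0 < (v *m G *m v^T) 0 0.

Let sym i j : G i j = G j i.
Proof. by rewrite -[in LHS]Gsym mxE. Qed.

Let quad (a b c d : R) : 0 < a ^+ 2 + b ^+ 2 + c ^+ 2 + d ^+ 2 ->
  0 < G 0 0 * a ^+ 2 + G 1 1 * b ^+ 2 + G 2 2 * c ^+ 2 + G 3 3 * d ^+ 2
   + 2 * (G 1 0 * a * b + G 2 0 * a * c + G 3 0 * a * d + G 2 1 * b * c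
     + G 3 1 * b * d + G 3 2 * c * d).
Proof.
move=> h; pose v : V := \row_i match nat_of_ord i with
  | 0%N => a | 1%N => b | 2 => c | _ => d end.
have v0 : v != 0.
  apply/eqP => /rowP e; have := (e 0, e 1, e 2, e 3); rewrite !mxE /=.
  by move=> [[[ea eb] ec] ed]; move: h; rewrite ea eb ec ed !expr0n /= !addr0 ltxx.
have := Gpos v0; rewrite mxE big4 !mxE !big4 !mxE /=.
by rewrite (sym 0 1) (sym 0 2) (sym 0 3) (sym 1 2) (sym 1 3) (sym 2 3) => H; lra.
Qed.

(** Each diagonal factor is the value of the quadratic form at a column of the inverse of [L]. *)
Lemma ldl_pos : [/\ 0 < ldl_n0, 0 < ldl_n1, 0 < ldl_n2 & 0 < ldl_n3].
Proof.
have E (x y : R) : 0 < y -> x = y -> 0 < x by move=> ? ->.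
have n3 : 0 < ldl_n3.
  have := @quad 0 0 0 1; rewrite /ldl_n3 !expr0n !expr1n /= => H.
  by apply: (E _ _ (H _)); [lra|ring].
have g3 j : G 3 j = ldl_n3 * ldl_l3 j by rewrite mulrC divfK // gt_eqF.
have g33 : G 3 3 = ldl_n3 by [].
have g22 : G 2 2 = ldl_n2 + ldl_n3 * ldl_l3 2 ^+ 2 by rewrite /ldl_n2 subrK.
have n2 : 0 < ldl_n2.
  have := @quad 0 0 1 (- ldl_l3 2); rewrite !expr0n expr1n /= g33 g22 (g3 2).
  have h := sqr_ge0 (- ldl_l3 2) => H.
  by apply: (E _ _ (H _)); [lra|ring].
have g2 j : G 2 j = ldl_n2 * ldl_l2 j + ldl_n3 * ldl_l3 2 * ldl_l3 j.
  by rewrite [ldl_n2 * _]mulrC divfK ?gt_eqF // subrK.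
have g11 : G 1 1 = ldl_n1 + ldl_n2 * ldl_l2 1 ^+ 2 + ldl_n3 * ldl_l3 1 ^+ 2.
  by rewrite /ldl_n1; ring.
have n1 : 0 < ldl_n1.
  have := @quad 0 1 (- ldl_l2 1) (ldl_l3 2 * ldl_l2 1 - ldl_l3 1).
  rewrite !expr0n expr1n /= g33 g22 g11 (g3 2) (g3 1) (g2 1).
  have h := sqr_ge0 (- ldl_l2 1).
  have h' := sqr_ge0 (ldl_l3 2 * ldl_l2 1 - ldl_l3 1) => H.
  by apply: (E _ _ (H _)); [lra|ring].
have g10 : G 1 0 = ldl_n1 * ldl_l1 + ldl_n2 * ldl_l2 1 * ldl_l2 0
    + ldl_n3 * ldl_l3 1 * ldl_l3 0.
  by rewrite [ldl_n1 * _]mulrC divfK ?gt_eqF //; ring.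
have g00 : G 0 0 = ldl_n0 + ldl_n1 * ldl_l1 ^+ 2 + ldl_n2 * ldl_l2 0 ^+ 2
    + ldl_n3 * ldl_l3 0 ^+ 2 by rewrite /ldl_n0; ring.
split => //.
pose c2 := ldl_l2 1 * ldl_l1 - ldl_l2 0.
pose c3 := - ldl_l3 0 + ldl_l3 1 * ldl_l1 + ldl_l3 2 * ldl_l2 0
   - ldl_l3 2 * ldl_l2 1 * ldl_l1.
have := @quad 1 (- ldl_l1) c2 c3.
rewrite !expr1n g33 g22 g11 g00 (g3 2) (g3 1) (g3 0) (g2 1) (g2 0) g10.
have h := sqr_ge0 (- ldl_l1); have h2 := sqr_ge0 c2.
have h3 := sqr_ge0 c3 => H.
by apply: (E _ _ (H _)); [lra|rewrite /c2 /c3; ring].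
Qed.

Lemma ldl_n_gt0 k : (k < 4)%N -> 0 < ldl_n k.
Proof. by have [? ? ? ?] := ldl_pos; case: k => [|[|[|[|]]]]. Qed.

Lemma gram_ldl : gram ldl_n ldl_l = G.
Proof.
have [n0 n1 n2 n3] := ldl_pos.
have g3 j : G 3 j = ldl_n3 * ldl_l3 j by rewrite mulrC divfK // gt_eqF.
have l33 : ldl_l3 3 = 1 by rewrite /ldl_l3 divff // gt_eqF.
have g2 j : G 2 j = ldl_n2 * ldl_l2 j + ldl_n3 * ldl_l3 2 * ldl_l3 j.
  by rewrite [ldl_n2 * _]mulrC divfK ?gt_eqF // subrK.
have g22 : G 2 2 = ldl_n2 + ldl_n3 * ldl_l3 2 ^+ 2 by rewrite /ldl_n2 subrK.
have g11 : G 1 1 = ldl_n1 + ldl_n2 * ldl_l2 1 ^+ 2 + ldl_n3 * ldl_l3 1 ^+ 2.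
  by rewrite /ldl_n1; ring.
have g10 : G 1 0 = ldl_n1 * ldl_l1 + ldl_n2 * ldl_l2 1 * ldl_l2 0
    + ldl_n3 * ldl_l3 1 * ldl_l3 0.
  by rewrite [ldl_n1 * _]mulrC divfK ?gt_eqF //; ring.
have g00 : G 0 0 = ldl_n0 + ldl_n1 * ldl_l1 ^+ 2 + ldl_n2 * ldl_l2 0 ^+ 2
    + ldl_n3 * ldl_l3 0 ^+ 2 by rewrite /ldl_n0; ring.
apply/matrixP => i j; rewrite mxE big4.
move: i; apply: ord4_ind; move: j; apply: ord4_ind; rewrite /unitri /= ?inord4;
  rewrite ?(sym 0 1) ?(sym 0 2) ?(sym 0 3) ?(sym 1 2) ?(sym 1 3) ?(sym 2 3);
  rewrite ?g22 ?g11 ?g10 ?g00 ?g2 ?g3 ?l33; ring.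
Qed.

End GramDecomposition.

(** * The flow of the Gram matrix and of its LDL factors *)

Section GramFlow.
Context {R : realType}.

Definition ldl_dot (n : nat -> R) (l : nat -> nat -> R) (k j : nat) : R :=
  match k with
  | 2 => shear2 (qA n) (qB n l) (qC n) (qbeta l) * unitri l 1 j
  | 3 => shear3 (qA n) (qB n l) (qC n) (qbeta l) * unitri l 2 j
  | _ => 0
  end.

Definition ldl_flow (n : R -> nat -> R) (l : R -> nat -> nat -> R) (t : R) : Prop :=
  (forall k, (k < 4)%N -> is_derive t (1 : R) (fun s => n s k)
     (n t k * bdiag (qA (n t)) (qB (n t) (l t)) (qC (n t)) k)) /\
  (forall k j, (k < 4)%N -> (j < k)%N ->
     is_derive t (1 : R) (fun s => l s k j) (ldl_dot (n t) (l t) k j)).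

Lemma gram_flow n l t : ldl_flow n l t -> forall i j,
  is_derive t (1 : R) (fun s => gram (n s) (l s) i j) (gram_vel (n t) (l t) i j).
Proof.
move=> [hn hl] i j.
have hu (k m : 'I_4) : is_derive t (1 : R) (fun s => unitri (l s) k m)
    (if (m < k)%N then ldl_dot (n t) (l t) k m else 0).
  rewrite /unitri; have [e|e] := eqVneq (m : nat) k; first by rewrite e ltnn; exact: dr_cst.
  by case: ifP => mk; [exact: hl|exact: dr_cst].
rewrite (_ : (fun s => _) = fun s => \sum_(k < 4)
    n s k * unitri (l s) k i * unitri (l s) k j); last by apply/funext => s; rewrite mxE.
apply: dr_eq (dr_sum (fun k : 'I_4 => dr_mul (dr_mul (hn k (ltn_ord k)) (hu k i)) (hu k j))) _.
rewrite big4 mxE !big4 /vel_core.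
by move: i j; apply: ord4_ind; apply: ord4_ind; rewrite /ldl_dot /unitri /=; ring.
Qed.

Section Backward.
Variables (H : R -> 'M[R]_4) (t : R).
Local Notation n := (fun s => ldl_n (H s)).
Local Notation l := (fun s => ldl_l (H s)).
Hypothesis Hsym : (H t)^T = H t.
Hypothesis Hpos : forall v : 'rV[R]_4, v != 0 -> 0 < (v *m H t *m v^T) 0 0.
Hypothesis hH : forall i j,
  is_derive t (1 : R) (fun s => H s i j) (gram_vel (n t) (l t) i j).

(** The direction that uniqueness needs, where only the Gram matrix is given. The factors are
    differentiated in the order of the elimination, from the last row upwards, subtracting what the
    rows already treated contribute. *)
Lemma ldl_flow_of_gram : ldl_flow n l t.
Proof.
have [/lt0r_neq0 z0 /lt0r_neq0 z1 /lt0r_neq0 z2 /lt0r_neq0 z3] := ldl_pos Hsym Hpos.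
have gE := gram_ldl Hsym Hpos.
pose b := bdiag (qA (n t)) (qB (n t) (l t)) (qC (n t)).
pose m2 := shear2 (qA (n t)) (qB (n t) (l t)) (qC (n t)) (qbeta (l t)).
pose m3 := shear3 (qA (n t)) (qB (n t) (l t)) (qC (n t)) (qbeta (l t)).
have vE i j := congr1 (fun M : 'M[R]_4 => M i j) gE.
have V33 : gram_vel (n t) (l t) 3 3 = ldl_n3 (H t) * b 3.
  by rewrite mxE !big4 /unitri /=; ring.
have V3 (j : 'I_4) : (j < 3)%N -> gram_vel (n t) (l t) 3 j =
    ldl_n3 (H t) * (m3 * unitri (l t) 2 j + b 3 * unitri (l t) 3 j).
  move=> j3; rewrite mxE !big4 /vel_core -/m3 -/m2 -/(b _) /=.
  by move: j j3; apply: ord4_ind; rewrite /unitri //= => _; ring.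
have dn3 : is_derive t (1 : R) (fun s => ldl_n3 (H s)) (ldl_n3 (H t) * b 3).
  exact: dr_eq (hH 3 3) V33.
have g3 j : H t 3 j = ldl_n3 (H t) * ldl_l3 (H t) j by rewrite mulrC divfK.
have dl3 (j : 'I_4) : (j < 3)%N ->
    is_derive t (1 : R) (fun s => ldl_l3 (H s) j) (m3 * unitri (l t) 2 j).
  move=> j3.
  apply: dr_eq (dr_mul (hH 3 j) (@dr_inv _ (fun s => ldl_n3 (H s)) t _ z3 dn3)) _.
  rewrite V3 // g3 (_ : unitri (l t) 3 j = ldl_l3 (H t) j); first by field.
  by move: j j3; apply: ord4_ind; rewrite /unitri /= ?inord4.
have l32 := dl3 2 isT; have l31 := dl3 1 isT; have l30 := dl3 0 isT.
have u22 : unitri (l t) 2 2 = 1 by [].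
have u21 : unitri (l t) 2 1 = ldl_l2 (H t) 1 by rewrite /unitri /= inord4.
have u20 : unitri (l t) 2 0 = ldl_l2 (H t) 0 by rewrite /unitri /= inord4.
have u32 : unitri (l t) 3 2 = ldl_l3 (H t) 2 by rewrite /unitri /= inord4.
have u3 (j : 'I_4) : (j < 3)%N -> unitri (l t) 3 j = ldl_l3 (H t) j.
  by move=> j3; rewrite /unitri ltn_eqF // j3 /= inord_val.
have V2 (j : 'I_4) : (j < 3)%N -> gram_vel (n t) (l t) 2 j =
    ldl_n2 (H t) * (b 2 * unitri (l t) 2 j + m2 * unitri (l t) 1 j)
    + ldl_n3 (H t) * (m3 * unitri (l t) 3 j + m3 * ldl_l3 (H t) 2 * unitri (l t) 2 j
        + b 3 * ldl_l3 (H t) 2 * unitri (l t) 3 j).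
  move=> j3; rewrite mxE !big4 /vel_core -/m3 -/m2 -/(b _) /=.
  by move: j j3; apply: ord4_ind; rewrite /unitri //= ?inord4 => _; ring.
have dn2 : is_derive t (1 : R) (fun s => ldl_n2 (H s)) (ldl_n2 (H t) * b 2).
  apply: dr_eq (dr_add (hH 2 2) (dr_opp (dr_mul dn3 (dr_mul l32 l32)))) _.
  rewrite V2 // !u22 u32 (_ : unitri (l t) 1 2 = 0) //; ring.
have g2 j : H t 2 j = ldl_n2 (H t) * ldl_l2 (H t) j
    + ldl_n3 (H t) * ldl_l3 (H t) 2 * ldl_l3 (H t) j.
  by rewrite [ldl_n2 (H t) * _]mulrC divfK // subrK.
have dl2 (j : 'I_4) : (j < 2)%N ->
    is_derive t (1 : R) (fun s => ldl_l2 (H s) j) (m2 * unitri (l t) 1 j).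
  move=> j2; have j3 : (j < 3)%N by exact: ltnW.
  apply: dr_eq (dr_mul (dr_add (hH 2 j) (dr_opp (dr_mul (dr_mul dn3 l32) (dl3 j j3))))
    (@dr_inv _ (fun s => ldl_n2 (H s)) t _ z2 dn2)) _.
  rewrite V2 // g2 u22 (_ : unitri (l t) 3 j = ldl_l3 (H t) j); last first.
    by move: j j2 {j3}; apply: ord4_ind; rewrite /unitri /= ?inord4.
  rewrite (_ : unitri (l t) 2 j = ldl_l2 (H t) j); first by field.
  by move: j j2 {j3}; apply: ord4_ind; rewrite /unitri /= ?inord4.
have l21 := dl2 1 isT; have l20 := dl2 0 isT.
have u11 : unitri (l t) 1 1 = 1 by [].
have u10 : unitri (l t) 1 0 = ldl_l1 (H t) by [].
have V1u (j : 'I_4) : (j < 2)%N -> gram_vel (n t) (l t) 1 j =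
    ldl_n1 (H t) * b 1 * unitri (l t) 1 j
    + ldl_n2 (H t) * (m2 * unitri (l t) 2 j + m2 * ldl_l2 (H t) 1 * unitri (l t) 1 j
        + b 2 * ldl_l2 (H t) 1 * unitri (l t) 2 j)
    + ldl_n3 (H t) * (m3 * ldl_l2 (H t) 1 * unitri (l t) 3 j
        + m3 * ldl_l3 (H t) 1 * unitri (l t) 2 j
        + b 3 * ldl_l3 (H t) 1 * unitri (l t) 3 j).
  move=> j3; rewrite mxE !big4 /vel_core -/m3 -/m2 -/(b _) /=.
  by move: j j3; apply: ord4_ind; rewrite /unitri //= ?inord4 => _; ring.
have u2 (j : 'I_4) : (j < 2)%N -> unitri (l t) 2 j = ldl_l2 (H t) j.
  by move=> j2; rewrite /unitri ltn_eqF // j2 /= inord_val.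
have V1 (j : 'I_4) : (j < 2)%N -> gram_vel (n t) (l t) 1 j =
    ldl_n1 (H t) * b 1 * unitri (l t) 1 j
    + ldl_n2 (H t) * (m2 * ldl_l2 (H t) j + m2 * ldl_l2 (H t) 1 * unitri (l t) 1 j
        + b 2 * ldl_l2 (H t) 1 * ldl_l2 (H t) j)
    + ldl_n3 (H t) * (m3 * ldl_l2 (H t) 1 * ldl_l3 (H t) j
        + m3 * ldl_l3 (H t) 1 * ldl_l2 (H t) j
        + b 3 * ldl_l3 (H t) 1 * ldl_l3 (H t) j).
  by move=> j2; rewrite V1u // u2 // u3 // ltnW.
have dn1 : is_derive t (1 : R) (fun s => ldl_n1 (H s)) (ldl_n1 (H t) * b 1).
  apply: dr_eq (dr_add (dr_add (hH 1 1) (dr_opp (dr_mul dn2 (dr_mul l21 l21))))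
    (dr_opp (dr_mul dn3 (dr_mul l31 l31)))) _.
  by rewrite V1 // u11 u21; ring.
have g10 : H t 1 0 = ldl_n1 (H t) * ldl_l1 (H t)
    + ldl_n2 (H t) * ldl_l2 (H t) 1 * ldl_l2 (H t) 0
    + ldl_n3 (H t) * ldl_l3 (H t) 1 * ldl_l3 (H t) 0.
  by rewrite [ldl_n1 (H t) * _]mulrC divfK //; ring.
have dl1 : is_derive t (1 : R) (fun s => ldl_l1 (H s)) 0.
  apply: dr_eq (dr_mul (dr_add (dr_add (hH 1 0) (dr_opp (dr_mul (dr_mul dn2 l21) l20)))
    (dr_opp (dr_mul (dr_mul dn3 l31) l30))) (@dr_inv _ (fun s => ldl_n1 (H s)) t _ z1 dn1)) _.
  by rewrite V1 // g10 u11 u10 u21 u20; field.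
have V0 : gram_vel (n t) (l t) 0 0 =
    ldl_n0 (H t) * b 0%N + ldl_n1 (H t) * b 1%N * ldl_l1 (H t) ^+ 2
    + ldl_n2 (H t) * (2 * m2 * ldl_l1 (H t) * ldl_l2 (H t) 0 + b 2 * ldl_l2 (H t) 0 ^+ 2)
    + ldl_n3 (H t) * (2 * m3 * ldl_l2 (H t) 0 * ldl_l3 (H t) 0 + b 3 * ldl_l3 (H t) 0 ^+ 2).
  rewrite mxE !big4 /vel_core -/m3 -/m2 -/(b _) /unitri /= ?inord4; ring.
have dn0 : is_derive t (1 : R) (fun s => ldl_n0 (H s)) (ldl_n0 (H t) * b 0%N).
  apply: dr_eq (dr_add (dr_add (dr_add (hH 0 0) (dr_opp (dr_mul dn1 (dr_mul dl1 dl1))))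
    (dr_opp (dr_mul dn2 (dr_mul l20 l20)))) (dr_opp (dr_mul dn3 (dr_mul l30 l30)))) _.
  by rewrite V0 u20 u10; ring.
split.
- by case=> [|[|[|[|]]]].
- case=> [|[|[|[|k]]]] // [|[|[|j]]] //= _ _;
    rewrite /ldl_dot -?/m2 -?/m3 /ldl_l ?inord4; assumption.
Qed.

End Backward.

End GramFlow.

(** * The reduced system and uniqueness *)

Section ReducedFlow.
Context {R : realType}.

(** The logarithmic derivative of [qA]; likewise [fC] for [qC], [fbeta] for [qbeta] and [fB] for
    [qB]. *)
Definition fA (A B C : R) := bdiag A B C 2 - bdiag A B C 0 - bdiag A B C 1.
Definition fC (A B C : R) := bdiag A B C 3 - bdiag A B C 0 - bdiag A B C 2.
Definition fbeta (A B C : R) := - (2 / 3 * (A + B + C) * (A + C)).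
Definition fB (A B C : R) :=
  bdiag A B C 3 - bdiag A B C 0 - bdiag A B C 1 + 2 * fbeta A B C.

Lemma qbeta_flow (n : R -> nat -> R) l t : ldl_flow n l t ->
  is_derive t (1 : R) (fun s => qbeta (l s))
    (qbeta (l t) * fbeta (qA (n t)) (qB (n t) (l t)) (qC (n t))).
Proof.
move=> [_ hl].
apply: dr_eq (dr_add (hl 3 2 isT isT) (dr_opp (hl 2 1%N isT isT))) _.
by rewrite /ldl_dot /shear2 /shear3 /fbeta /unitri /=; ring.
Qed.

Lemma reduced_flow (n : R -> nat -> R) l t : (forall k, (k < 4)%N -> 0 < n t k) ->
  ldl_flow n l t ->
  let A := qA (n t) in let B := qB (n t) (l t) in let C := qC (n t) in
  [/\ is_derive t (1 : R) (fun s => qA (n s)) (A * fA A B C),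
      is_derive t (1 : R) (fun s => qB (n s) (l s)) (B * fB A B C) &
      is_derive t (1 : R) (fun s => qC (n s)) (C * fC A B C)].
Proof.
move=> np fl A B C; have [hn _] := fl; have hb := qbeta_flow fl.
have [p0 p1 p2 p3] := And4 (np 0%N isT) (np 1%N isT) (np 2 isT) (np 3 isT).
have d0 := hn 0%N isT; have d1 := hn 1%N isT; have d2 := hn 2 isT; have d3 := hn 3 isT.
have [z0 z1 z2] := And3 (lt0r_neq0 p0) (lt0r_neq0 p1) (lt0r_neq0 p2).
have z01 : n t 0%N * n t 1%N != 0 by rewrite mulf_neq0.
have z02 : n t 0%N * n t 2 != 0 by rewrite mulf_neq0.
have i01 := @dr_inv _ (fun s => n s 0%N * n s 1%N) t _ z01 (dr_mul d0 d1).
have i02 := @dr_inv _ (fun s => n s 0%N * n s 2) t _ z02 (dr_mul d0 d2).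
split.
- apply: dr_eq (dr_mul d2 i01) _; rewrite -/A -/B -/C /fA.
  move: (bdiag A B C) => b; rewrite /A /qA; field.
  by rewrite z0 z1.
- apply: dr_eq (dr_mul (dr_mul hb hb) (dr_mul d3 i01)) _; rewrite -/A -/B -/C /fB.
  move: (bdiag A B C) (fbeta A B C) => b f; rewrite /B /qB; field.
  by rewrite z0 z1.
- apply: dr_eq (dr_mul d3 i02) _; rewrite -/A -/B -/C /fC.
  move: (bdiag A B C) => b; rewrite /C /qC; field.
  by rewrite z0 z2.
Qed.

Lemma dr_const_between (f : R -> R) (t : R) :
  (forall s, Num.min 0 t <= s <= Num.max 0 t -> is_derive s (1 : R) f 0) -> f t = f 0.
Proof.
case: (leP 0 t) => t0 h; first by apply/esym/dr_const.
exact: dr_const (ltW t0) _.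
Qed.

Lemma continuous_bounded (f : R -> R) (a b : R) : a <= b ->
  (forall s, a <= s <= b -> {for s, continuous f}) ->
  exists K, forall s, a <= s <= b -> `|f s| <= K.
Proof.
move=> ab fc.
have [c _ hc] : exists2 c, c \in `[a, b]%R & forall s, s \in `[a, b]%R ->
    `|f s| <= `|f c|.
  apply: (EVT_max (f := fun s => `|f s|) ab).
  apply: continuous_in_subspaceT => s; rewrite inE /= in_itv /= => sab.
  by apply: continuous_comp; [exact: fc|exact: norm_continuous].
by exists `|f c| => s sab; apply: hc; rewrite in_itv.
Qed.

(* Two given solutions are bounded between 0 and t, so there they also solve the
   system truncated by clamp, which is globally Lipschitz. *)
Definition clamp (K x : R) := Num.max (- K) (Num.min x K).

Lemma clamp_id K x : `|x| <= K -> clamp K x = x.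
Proof.
rewrite ler_norml => /andP[h1 h2].
by rewrite /clamp (min_idPl h2) (max_idPr h1).
Qed.

Definition red_field (K : R) (i : 'I_4) (u : 'I_4 -> R) : R :=
  let A := clamp K (u 0) in let B := clamp K (u 1) in let C := clamp K (u 2) in
  match nat_of_ord i with
  | 0%N => A * fA A B C | 1%N => B * fB A B C | 2 => C * fC A B C
  | _ => clamp K (u 3) * fbeta A B C
  end.

Lemma bl_red_field K i : 0 <= K -> bounded_lipschitz (red_field K i).
Proof.
move=> K0; have c j := bl_clamp (n := 4) j K0.
rewrite /red_field /fA /fB /fC /fbeta /bdiag.
by move: i; apply: ord4_ind => /=;
  do ?[exact: c|exact: bl_cst|apply: bl_add|apply: bl_opp|apply: bl_mul].
Qed.

(** [qbeta] is a fourth unknown because [qB] contains only its square, while the shears depend on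
    its sign. *)
Definition red_state (n : R -> nat -> R) (l : R -> nat -> nat -> R) (i : 'I_4) (s : R) :=
  match nat_of_ord i with
  | 0%N => qA (n s) | 1%N => qB (n s) (l s) | 2 => qC (n s) | _ => qbeta (l s)
  end.

Section Uniqueness.
Variables (n n' : R -> nat -> R) (l l' : R -> nat -> nat -> R) (t : R).
Local Notation btw s := (Num.min 0 t <= s <= Num.max 0 t).
Hypothesis np : forall s, btw s -> forall k, (k < 4)%N -> 0 < n s k.
Hypothesis np' : forall s, btw s -> forall k, (k < 4)%N -> 0 < n' s k.
Hypothesis fl : forall s, btw s -> ldl_flow n l s.
Hypothesis fl' : forall s, btw s -> ldl_flow n' l' s.
Hypothesis n0 : forall k, (k < 4)%N -> n 0 k = n' 0 k.
Hypothesis l0 : forall k j, (k < 4)%N -> (j < k)%N -> l 0 k j = l' 0 k j.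

Let btw_sub s u : btw s -> Num.min 0 s <= u <= Num.max 0 s -> btw u.
Proof.
rewrite /Num.min /Num.max; case: (ltP 0 t); case: (ltP 0 s); lra.
Qed.

Let state_derive (m : R -> nat -> R) (k : R -> nat -> nat -> R) i s :
  (forall k, (k < 4)%N -> 0 < m s k) -> ldl_flow m k s ->
  is_derive s (1 : R) (red_state m k i)
    (let A := qA (m s) in let B := qB (m s) (k s) in let C := qC (m s) in
     match nat_of_ord i with
     | 0%N => A * fA A B C | 1%N => B * fB A B C | 2 => C * fC A B C
     | _ => qbeta (k s) * fbeta A B C end).
Proof.
move=> mp f; have [hA hB hC] := reduced_flow mp f; have hb := qbeta_flow f.
by rewrite /red_state; move: i; apply: ord4_ind.
Qed.

Lemma red_state_unique s : btw s -> forall i, red_state n l i s = red_state n' l' i s.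
Proof.
move=> bs.
have ab : Num.min 0 t <= Num.max 0 t by rewrite /Num.min /Num.max; case: (ltP 0 t); lra.
have bd (m : R -> nat -> R) k i : (forall s, btw s -> forall j, (j < 4)%N -> 0 < m s j) ->
    (forall s, btw s -> ldl_flow m k s) ->
    exists K, forall s, btw s -> `|red_state m k i s| <= K.
  move=> mp f; apply: continuous_bounded => // u bu.
  exact: dr_continuous (state_derive i (mp u bu) (f u bu)).
have [K hK] := choice (fun i => bd n l i np fl).
have [K' hK'] := choice (fun i => bd n' l' i np' fl').
have pos i : 0 <= K i by apply: le_trans (hK i s bs).
have pos' i : 0 <= K' i by apply: le_trans (hK' i s bs).
pose M := \sum_i (K i + K' i).
have M0 : 0 <= M by apply: sumr_ge0 => i _; exact: addr_ge0.
have KM i : K i <= M /\ K' i <= M.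
  rewrite /M (bigD1 i) //=.
  have : 0 <= \sum_(j < 4 | j != i) (K j + K' j).
    by apply: sumr_ge0 => j _; exact: addr_ge0.
  by have := pos i; have := pos' i; lra.
have [L L0 FL] := bl_uniform (fun i => bl_red_field i M0).
have sol (m : R -> nat -> R) k : (forall s, btw s -> forall j, (j < 4)%N -> 0 < m s j) ->
    (forall s, btw s -> ldl_flow m k s) ->
    (forall i s, btw s -> `|red_state m k i s| <= M) ->
    forall i u, btw u -> is_derive u (1 : R) (red_state m k i)
      (red_field M i (fun j => red_state m k j u)).
  move=> mp f b i u bu; apply: dr_eq (state_derive i (mp u bu) (f u bu)) _.
  rewrite /red_field !clamp_id; try exact: b.
  by move: i; apply: ord4_ind.
apply: (sol_unique L0 FL).
- move=> i; rewrite /red_state /qA /qB /qC /qbeta !n0 // !l0 //.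
- move=> i u bu; apply: sol => //; last exact: btw_sub bu.
  by move=> j v bv; apply: le_trans (hK j v bv) (KM j).1.
- move=> i u bu; apply: sol => //; last exact: btw_sub bu.
  by move=> j v bv; apply: le_trans (hK' j v bv) (KM j).2.
Qed.

Let stE s : btw s -> [/\ qA (n s) = qA (n' s), qB (n s) (l s) = qB (n' s) (l' s),
  qC (n s) = qC (n' s) & qbeta (l s) = qbeta (l' s)].
Proof.
move=> bs; have h := red_state_unique bs.
by split; [exact: (h 0)|exact: (h 1)|exact: (h 2)|exact: (h 3)].
Qed.

Let eq_of_derive (f g df : R -> R) : f 0 = g 0 ->
  (forall u, btw u -> is_derive u (1 : R) f (df u)) ->
  (forall u, btw u -> is_derive u (1 : R) g (df u)) -> forall s, btw s -> f s = g s.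
Proof.
move=> fg hf hg s bs; apply/eqP; rewrite -subr_eq0.
have -> : f s - g s = f 0 - g 0.
  apply: (@dr_const_between (fun u => f u + - g u)) => u bu.
  have bu' := btw_sub bs bu.
  by apply: dr_eq (dr_add (hf u bu') (dr_opp (hg u bu'))) _; rewrite subrr.
by rewrite fg subrr.
Qed.

(** Once A, B, C and [qbeta] agree, corresponding diagonal factors solve the same linear equation
    and have constant quotient. The rows of [L] then agree one after the other, each derivative
    involving only the row above. *)
Lemma ldl_unique s : btw s -> (forall k, (k < 4)%N -> n s k = n' s k) /\
  forall k j, (k < 4)%N -> (j < k)%N -> l s k j = l' s k j.
Proof.
move=> bs; split.
  move=> k k4; have z u : btw u -> n' u k != 0 by move=> bu; rewrite gt_eqF // np'.
  have H : n s k / n' s k = n 0 k / n' 0 k.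
    apply: (@dr_const_between (fun u => n u k * (n' u k)^-1)) => u bu.
    have bu' := btw_sub bs bu.
    have [a b c d] := stE bu'.
    have [hn _] := fl bu'; have [hn' _] := fl' bu'.
    apply: dr_eq (dr_mul (hn k k4) (@dr_inv _ (fun u => n' u k) u _ (z u bu') (hn' k k4))) _.
    by rewrite a b c; field; exact: z.
  have b0 : btw 0 by rewrite /Num.min /Num.max; case: (ltP 0 t); lra.
  move: H; rewrite n0 // divff ?(z 0 b0) // => H.
  by rewrite -[LHS](divfK (z s bs)) H mul1r.
have dl k j u : (k < 4)%N -> (j < k)%N -> btw u ->
    is_derive u (1 : R) (fun s => l s k j) (ldl_dot (n u) (l u) k j).
  by move=> k4 jk bu; exact: (fl bu).2.
have dl' k j u : (k < 4)%N -> (j < k)%N -> btw u ->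
    is_derive u (1 : R) (fun s => l' s k j) (ldl_dot (n' u) (l' u) k j).
  by move=> k4 jk bu; exact: (fl' bu).2.
have key k j : (k < 4)%N -> (j < k)%N ->
    (forall u, btw u -> ldl_dot (n u) (l u) k j = ldl_dot (n' u) (l' u) k j) ->
    forall s, btw s -> l s k j = l' s k j.
  move=> k4 jk e; apply: (@eq_of_derive (fun s => l s k j) (fun s => l' s k j)
    (fun u => ldl_dot (n u) (l u) k j)); first exact: l0.
  - by move=> u bu; exact: dl.
  - by move=> u bu; rewrite e //; exact: dl'.
have e10 := key 1%N 0%N isT isT (fun u bu => erefl).
have e21 : forall s, btw s -> l s 2 1%N = l' s 2 1%N.
  by apply: key => // u bu; have [a b c d] := stE bu; rewrite /ldl_dot a b c d.
have e20 : forall s, btw s -> l s 2 0%N = l' s 2 0%N.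
  apply: key => // u bu; have [a b c d] := stE bu.
  by rewrite /ldl_dot a b c d /unitri /= e10.
have e32 : forall s, btw s -> l s 3 2 = l' s 3 2.
  by apply: key => // u bu; have [a b c d] := stE bu; rewrite /ldl_dot a b c d.
have e31 : forall s, btw s -> l s 3 1%N = l' s 3 1%N.
  apply: key => // u bu; have [a b c d] := stE bu.
  by rewrite /ldl_dot a b c d /unitri /= e21.
have e30 : forall s, btw s -> l s 3 0%N = l' s 3 0%N.
  apply: key => // u bu; have [a b c d] := stE bu.
  by rewrite /ldl_dot a b c d /unitri /= e20.
case=> [|[|[|[|k]]]] // [|[|[|j]]] //= _ _;
  [exact: e10|exact: e20|exact: e21|exact: e30|exact: e31|exact: e32].
Qed.

End Uniqueness.

End ReducedFlow.

(** * Long-time existence *)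

Section Continuity.
Context {R : realType}.

(* [continuous] hides a quantifier, on which [apply:] trips; this alias does not. *)
Definition cts (f : R -> R) : Prop := continuous f.

Lemma cts_cst c : cts (fun=> c).
Proof. by move=> s; exact: cst_continuous. Qed.

Lemma cts_add f g : cts f -> cts g -> cts (fun s => f s + g s).
Proof. by move=> fc gc s; exact: (continuousD (fc s) (gc s)). Qed.

Lemma cts_mul f g : cts f -> cts g -> cts (fun s => f s * g s).
Proof. by move=> fc gc s; exact: (continuousM (fc s) (gc s)). Qed.

Lemma cts_opp f : cts f -> cts (fun s => - f s).
Proof. by move=> fc s; exact: (continuousN (fc s)). Qed.

Lemma cts_derive f (df : R -> R) : (forall s, is_derive s (1 : R) f (df s)) -> cts f.
Proof. by move=> h s; exact: dr_continuous (h s). Qed.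

Lemma cts_exp_min f k : cts f -> cts (fun s => expR (Num.min (f s) k)).
Proof.
move=> fc s; apply: continuous_comp; last exact: continuous_expR.
by apply: continuous_min; [exact: fc|exact: cst_continuous].
Qed.

Lemma cts_antiderivative f c : cts f -> exists g : R -> R,
  g 0 = c /\ forall s, is_derive s (1 : R) g (f s).
Proof.
move=> fc; have [g [g0 gD]] := antiderivative fc; exists (fun s => c + g s).
rewrite g0 addr0; split=> // s.
by apply: dr_eq (dr_add (dr_cst s c) (gD s)) _; rewrite add0r.
Qed.

End Continuity.

Ltac cts_tac := repeat lazymatch goal with
  | |- cts (fun s => @?f s + @?g s) => apply: (@cts_add _ f g)
  | |- cts (fun s => @?f s * @?g s) => apply: (@cts_mul _ f g)
  | |- cts (fun s => - @?f s) => apply: (@cts_opp _ f)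
  | |- cts (fun s => @?f s ^+ 2) => apply: (@cts_mul _ f f)
  | |- cts (fun=> ?c) => exact: (@cts_cst _ c)
  | |- _ => assumption
  end.

(* The unknowns are the logarithms of A, B, C relative to their initial values.
   Truncating them from above makes the field globally Lipschitz, and barriers
   show that the truncation is inactive in the future: when A >= C (resp.
   C >= A) the logarithmic derivative of A (resp. C) is nonpositive. *)
Section Existence.
Context {R : realType}.
Variables (n0 : nat -> R) (l0 : nat -> nat -> R).
Hypothesis n0P : forall k, (k < 4)%N -> 0 < n0 k.

Let A0 := qA n0.
Let B0 := qB n0 l0.
Let C0 := qC n0.

Let A0P : 0 < A0. Proof. by rewrite divr_gt0 ?mulr_gt0 ?n0P. Qed.
Let C0P : 0 < C0. Proof. by rewrite divr_gt0 ?mulr_gt0 ?n0P. Qed.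
Let B0P : 0 <= B0.
Proof. by rewrite mulr_ge0 ?sqr_ge0 // divr_ge0 ?mulr_ge0 // ltW // n0P. Qed.

(** A common ceiling for A and C: whichever reaches it dominates the other. The 1 puts both initial
    values strictly below. *)
Let K := A0 + C0 + 1.
Let kA := ln (K / A0).
Let kC := ln (K / C0).

Let KA : K / A0 > 1. Proof. by rewrite ltr_pdivlMr // mul1r /K; have := A0P; have := C0P; lra. Qed.
Let KC : K / C0 > 1. Proof. by rewrite ltr_pdivlMr // mul1r /K; have := A0P; have := C0P; lra. Qed.
Let kAP : 0 < kA. Proof. exact: ln_gt0. Qed.
Let kCP : 0 < kC. Proof. exact: ln_gt0. Qed.

Let tA (x : R) := A0 * expR (Num.min x kA).
Let tB (x : R) := B0 * expR (Num.min x 1).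
Let tC (x : R) := C0 * expR (Num.min x kC).

Let field (i : 'I_3) (u : 'I_3 -> R) : R :=
  let A := tA (u 0) in let B := tB (u 1) in let C := tC (u 2) in
  match nat_of_ord i with 0%N => fA A B C | 1%N => fB A B C | _ => fC A B C end.

Let bl_field i : bounded_lipschitz (field i).
Proof.
have e k j := @bl_exp_min R 3 k j.
rewrite /field /fA /fB /fC /fbeta /bdiag /tA /tB /tC.
by case: i => [[|[|[|//]]]] /= _;
  do ?[exact: e|exact: bl_cst|apply: bl_add|apply: bl_opp|apply: bl_mul].
Qed.

Let fA_le0 (A B C : R) : 0 < A -> 0 <= B -> 0 < C -> C <= A -> fA A B C <= 0.
Proof.
move=> pA pB pC CA; rewrite /fA /bdiag.
have := mulr_ge0 (ltW pA) pB; have := mulr_ge0 pB (ltW pC); have := sqr_ge0 B.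
have : A * C <= A ^+ 2 by rewrite expr2 ler_pM2l.
have : C ^+ 2 <= A * C by rewrite expr2 ler_pM2r.
have := sqr_ge0 A; lra.
Qed.

Let fC_le0 (A B C : R) : 0 < A -> 0 <= B -> 0 < C -> A <= C -> fC A B C <= 0.
Proof.
move=> pA pB pC CA; rewrite /fC /bdiag.
have := mulr_ge0 (ltW pA) pB; have := mulr_ge0 pB (ltW pC); have := sqr_ge0 B.
have : A * C <= C ^+ 2 by rewrite expr2 ler_pM2r.
have : A ^+ 2 <= A * C by rewrite expr2 ler_pM2l.
have := sqr_ge0 C; lra.
Qed.

Let fB_le0 (A B C : R) : 0 < A -> 0 <= B -> 0 < C -> fB A B C <= 0.
Proof.
move=> pA pB pC; rewrite /fB /fbeta /bdiag.
have := mulr_ge0 (ltW pA) pB; have := mulr_ge0 pB (ltW pC).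
have := mulr_ge0 (ltW pA) (ltW pC).
have := sqr_ge0 A; have := sqr_ge0 B; have := sqr_ge0 C; nra.
Qed.

Lemma ldl_exists : exists (delta : R) (n : R -> nat -> R) (l : R -> nat -> nat -> R),
  [/\ 0 < delta, forall s k, (k < 4)%N -> 0 < n s k,
      forall k, (k < 4)%N -> n 0 k = n0 k,
      forall k j, (k < 4)%N -> (j < k)%N -> l 0 k j = l0 k j &
      forall s, - delta < s -> ldl_flow n l s].
Proof.
have [L L0 FL] := bl_uniform bl_field.
have [y [y0 yD]] := picard L0 FL (fun=> 0).
pose A s := tA (y 0 s); pose B s := tB (y 1 s); pose C s := tC (y 2 s).
have D0 s : is_derive s (1 : R) (y 0) (fA (A s) (B s) (C s)) by exact: (yD 0).
have D1 s : is_derive s (1 : R) (y 1) (fB (A s) (B s) (C s)) by exact: (yD 1).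
have D2 s : is_derive s (1 : R) (y 2) (fC (A s) (B s) (C s)) by exact: (yD 2).
have pA s : 0 < A s by rewrite mulr_gt0 ?expR_gt0.
have pB s : 0 <= B s by rewrite mulr_ge0 ?expR_ge0.
have pC s : 0 < C s by rewrite mulr_gt0 ?expR_gt0.
have AK s : A s <= K.
  rewrite -[leRHS](divfK (lt0r_neq0 A0P)) [leRHS]mulrC ler_pM2l //.
  by rewrite -(lnK (x := K / A0)) ?posrE ?(lt_trans ltr01) // ler_expR ge_min lexx orbT.
have CK s : C s <= K.
  rewrite -[leRHS](divfK (lt0r_neq0 C0P)) [leRHS]mulrC ler_pM2l //.
  by rewrite -(lnK (x := K / C0)) ?posrE ?(lt_trans ltr01) // ler_expR ge_min lexx orbT.
have bA s : 0 <= s -> y 0 s <= kA.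
  move=> s0; apply: (barrier s0 _ (fun u _ => D0 u)); first by rewrite y0 ltW.
  (* Above the barrier the truncated A equals [K], which bounds the truncated C. *)
  move=> u _ h; apply: fA_le0 => //; apply: le_trans (CK u) _.
  rewrite /A /tA (min_idPr h) lnK ?posrE ?(lt_trans ltr01) //.
  by rewrite mulrC divfK // gt_eqF.
have bC s : 0 <= s -> y 2 s <= kC.
  move=> s0; apply: (barrier s0 _ (fun u _ => D2 u)); first by rewrite y0 ltW.
  move=> u _ h; apply: fC_le0 => //; apply: le_trans (AK u) _.
  rewrite /C /tC (min_idPr h) lnK ?posrE ?(lt_trans ltr01) //.
  by rewrite mulrC divfK // gt_eqF.
(* For B any positive level serves, as [fB] is nonpositive throughout. *)
have bB s : 0 <= s -> y 1 s <= 1.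
  move=> s0; apply: (barrier s0 _ (fun u _ => D1 u)); first by rewrite y0.
  by move=> u _ _; exact: fB_le0.
(* The barriers work only forwards; in the past, continuity keeps the truncation inactive for a
   short time [delta]. *)
have [delta d0 hdelta] : exists2 delta, 0 < delta & forall s, - delta < s ->
    [/\ y 0 s <= kA, y 1 s <= 1 & y 2 s <= kC].
  have near0 i (k : R) : 0 < k -> exists2 d, 0 < d & forall s, `|s| < d -> y i s <= k.
    move=> k0.
    have /cvgrPdist_lt/(_ k k0) [d /= d0 hd] : y i s @[s --> (0 : R)] --> y i 0.
      exact: dr_continuous (yD i 0).
    exists d => // s sd; have := hd s; rewrite /ball_ /= sub0r normrN => /(_ sd).
    by rewrite y0 sub0r normrN => h; have := ler_norm (y i s); lra.
  have [dA dA0 hA] := near0 0 kA kAP; have [dB dB0 hB] := near0 1 1 ltr01.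
  have [dC dC0 hC] := near0 2 kC kCP.
  exists (Num.min dA (Num.min dB dC)); first by rewrite !lt_min dA0 dB0 dC0.
  move=> s; rewrite ltrNl !lt_min => /andP[h1 /andP[h2 h3]].
  case: (leP 0 s) => s0; first by split; [exact: bA|exact: bB|exact: bC].
  by split; [apply: hA|apply: hB|apply: hC]; rewrite ltr0_norm.
have yc i : cts (y i) by exact: cts_derive (yD i).
have Ac : cts A by apply: cts_mul; [exact: cts_cst|exact: cts_exp_min].
have Bc : cts B by apply: cts_mul; [exact: cts_cst|exact: cts_exp_min].
have Cc : cts C by apply: cts_mul; [exact: cts_cst|exact: cts_exp_min].
have bc k : cts (fun s => bdiag (A s) (B s) (C s) k).
  by rewrite /bdiag; case: k => [|[|[|k]]]; cts_tac.
have [P hP] := choice (fun k => cts_antiderivative 0 (bc k)).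
have fbc : cts (fun s => fbeta (A s) (B s) (C s)) by rewrite /fbeta; cts_tac.
have [Q [Q0 QD]] := cts_antiderivative 0 fbc.
(* This formula for the solution of the linear equation of [qbeta] also covers the initial value
   0. *)
pose be s := qbeta l0 * expR (Q s).
have beD s : is_derive s (1 : R) be (be s * fbeta (A s) (B s) (C s)).
  apply: dr_eq (dr_mul (dr_cst s (qbeta l0)) (dr_exp (QD s))) _.
  by rewrite mul0r add0r mulrA.
have bec := cts_derive beD.
pose m2 s := shear2 (A s) (B s) (C s) (be s).
pose m3 s := shear3 (A s) (B s) (C s) (be s).
have m2c : cts m2 by rewrite /m2 /shear2; cts_tac.
have m3c : cts m3 by rewrite /m3 /shear3; cts_tac.
have [l21 [l21_0 l21D]] := cts_antiderivative (l0 2 1%N) m2c.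
have [l32 [l32_0 l32D]] := cts_antiderivative (l0 3 2) m3c.
have [l20 [l20_0 l20D]] :=
  cts_antiderivative (l0 2 0%N) (cts_mul m2c (@cts_cst _ (l0 1%N 0%N))).
have [l31 [l31_0 l31D]] :=
  cts_antiderivative (l0 3 1%N) (cts_mul m3c (cts_derive l21D)).
have [l30 [l30_0 l30D]] :=
  cts_antiderivative (l0 3 0%N) (cts_mul m3c (cts_derive l20D)).
pose n s k := n0 k * expR (P k s).
pose l s (k j : nat) := match k, j with
  | 1%N, _ => l0 1%N 0%N | 2, 0%N => l20 s | 2, _ => l21 s
  | _, 0%N => l30 s | _, 1%N => l31 s | _, _ => l32 s end.
exists delta, n, l; split => //.
- by move=> s k k4; rewrite mulr_gt0 ?n0P ?expR_gt0.
- by move=> k k4; rewrite /n (hP k).1 expR0 mulr1.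
- by case=> [|[|[|[|k]]]] // [|[|[|j]]].
(* [be] enters the shears from which [l] was integrated, so consistency must be checked: both sides
   have the same derivative and initial value. *)
have bE s : qbeta (l s) = be s.
  apply/eqP; rewrite -subr_eq0.
  have -> : qbeta (l s) - be s = qbeta (l 0) - be 0.
    apply: (@dr_const_between _ (fun s => l32 s + - l21 s + - be s)) => u _.
    apply: dr_eq (dr_add (dr_add (l32D u) (dr_opp (l21D u))) (dr_opp (beD u))) _.
    by rewrite /m2 /m3 /shear2 /shear3 /fbeta; ring.
  by rewrite /be Q0 expR0 mulr1 /qbeta /= l32_0 l21_0 subrr.
have expE (f : R -> R) i s (df : R -> R) : f 0 = 0 ->
    (forall u, is_derive u (1 : R) f (df u)) ->
    (forall u, is_derive u (1 : R) (y i) (df u)) -> f s = y i s.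
  move=> f0 fD yD'; apply/eqP; rewrite -subr_eq0.
  have -> : f s - y i s = f 0 - y i 0.
    apply: (@dr_const_between _ (fun s => f s + - y i s)) => u _.
    by apply: dr_eq (dr_add (fD u) (dr_opp (yD' u))) _; rewrite subrr.
  by rewrite f0 y0 subrr.
have hPD k u : is_derive u (1 : R) (P k) (bdiag (A u) (B u) (C u) k) by exact: (hP k).2.
have ex3 (a b c : R) : expR (a - b - c) = expR a / (expR b * expR c).
  by rewrite !expRD !expRN; field; rewrite !gt_eqF ?expR_gt0.
have nz k : (k < 4)%N -> n0 k != 0 by move=> k4; rewrite gt_eqF ?n0P.
(* Integrating [bdiag] returns the untruncated value [A0 * expR (y 0 s)], which is [A s] where the
   truncation is inactive. *)
have AE s : - delta < s -> qA (n s) = A s.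
  move=> hs; have [h _ _] := hdelta s hs.
  have z : P 2 0 + - P 0%N 0 + - P 1%N 0 = 0 by rewrite !(hP _).1; ring.
  have e : P 2 s + - P 0%N s + - P 1%N s = y 0 s.
    exact: (expE (fun s => P 2 s + - P 0%N s + - P 1%N s) 0 s _ z (fun u =>
      dr_add (dr_add (hPD 2 u) (dr_opp (hPD 0%N u))) (dr_opp (hPD 1%N u))) D0).
  rewrite /A /tA (min_idPl h) -e ex3 /n /qA /A0 /qA; field.
  by rewrite !nz //= !gt_eqF ?expR_gt0.
have CE s : - delta < s -> qC (n s) = C s.
  move=> hs; have [_ _ h] := hdelta s hs.
  have z : P 3 0 + - P 0%N 0 + - P 2 0 = 0 by rewrite !(hP _).1; ring.
  have e : P 3 s + - P 0%N s + - P 2 s = y 2 s.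
    exact: (expE (fun s => P 3 s + - P 0%N s + - P 2 s) 2 s _ z (fun u =>
      dr_add (dr_add (hPD 3 u) (dr_opp (hPD 0%N u))) (dr_opp (hPD 2 u))) D2).
  rewrite /C /tC (min_idPl h) -e ex3 /n /qC /C0 /qC; field.
  by rewrite !nz //= !gt_eqF ?expR_gt0.
have BE s : - delta < s -> qB (n s) (l s) = B s.
  move=> hs; have [_ h _] := hdelta s hs.
  have z : P 3 0 + - P 0%N 0 + - P 1%N 0 + 2 * Q 0 = 0 by rewrite !(hP _).1 Q0; ring.
  have D u : is_derive u (1 : R) (fun s => P 3 s + - P 0%N s + - P 1%N s + 2 * Q s)
      (fB (A u) (B u) (C u)).
    apply: dr_eq (dr_add (dr_add (dr_add (hPD 3 u) (dr_opp (hPD 0%N u)))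
      (dr_opp (hPD 1%N u))) (dr_mul (dr_cst u 2) (QD u))) _.
    by rewrite /fB; ring.
  have e := expE _ 1 s _ z D D1.
  rewrite /B /tB (min_idPl h) -e expRD ex3 /qB bE /be /n /B0 /qB mulr_natl mulr2n expRD.
  field.
  by rewrite !nz //= !gt_eqF ?expR_gt0.
move=> s hs; split.
- move=> k k4; rewrite AE // BE // CE //.
  apply: dr_eq (dr_mul (dr_cst s (n0 k)) (dr_exp (hPD k s))) _.
  by rewrite mul0r add0r mulrA.
- have e2 : shear2 (qA (n s)) (qB (n s) (l s)) (qC (n s)) (qbeta (l s)) = m2 s.
    by rewrite AE // BE // CE // bE.
  have e3 : shear3 (qA (n s)) (qB (n s) (l s)) (qC (n s)) (qbeta (l s)) = m3 s.
    by rewrite AE // BE // CE // bE.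
  case=> [|[|[|[|k]]]] // [|[|[|j]]] //= _ _; rewrite /ldl_dot ?e2 ?e3 /unitri /= ?mulr1;
  [exact: dr_cst|exact: l20D|exact: l21D|exact: l30D|exact: l31D|exact: l32D].
Qed.

End Existence.

(** * Asymptotics of the flow *)

Section Asymptotics.
Context {R : realType}.

Lemma rho_dot_le (A B C : R) : 0 <= A -> 0 <= B -> 0 <= C ->
  A * fA A B C + B * fB A B C + C * fC A B C
    <= - (4^-1 * (A + B + C) ^+ 2 * (A + B + C)).
Proof.
move=> a b c; rewrite /fA /fB /fC /fbeta /bdiag -subr_ge0.
(* Only the monomials [A^2 C] and [A C^2] have the wrong sign; this product absorbs them. *)
have h1 : 0 <= (A + C) * (A - C) ^+ 2 by rewrite mulr_ge0 ?sqr_ge0 ?addr_ge0.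
have := mulr_ge0 (mulr_ge0 a a) a; have := mulr_ge0 (mulr_ge0 b b) b.
have := mulr_ge0 (mulr_ge0 c c) c; have := mulr_ge0 (mulr_ge0 a b) c.
have := mulr_ge0 (mulr_ge0 a a) b; have := mulr_ge0 (mulr_ge0 a b) b.
have := mulr_ge0 (mulr_ge0 b b) c; have := mulr_ge0 (mulr_ge0 b c) c.
have := mulr_ge0 (mulr_ge0 a a) c; have := mulr_ge0 (mulr_ge0 a c) c.
by move=> *; lra.
Qed.

Lemma rho_dot_ge (A B C : R) : 0 <= A -> 0 <= B -> 0 <= C ->
  - (3 * (A + B + C) ^+ 3) <= A * fA A B C + B * fB A B C + C * fC A B C.
Proof.
move=> a b c; rewrite /fA /fB /fC /fbeta /bdiag -subr_ge0.
have := mulr_ge0 (mulr_ge0 a a) a; have := mulr_ge0 (mulr_ge0 b b) b.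
have := mulr_ge0 (mulr_ge0 c c) c; have := mulr_ge0 (mulr_ge0 a b) c.
have := mulr_ge0 (mulr_ge0 a a) b; have := mulr_ge0 (mulr_ge0 a b) b.
have := mulr_ge0 (mulr_ge0 b b) c; have := mulr_ge0 (mulr_ge0 b c) c.
have := mulr_ge0 (mulr_ge0 a a) c; have := mulr_ge0 (mulr_ge0 a c) c.
by move=> *; lra.
Qed.

Lemma ratio_dot_le (A B C : R) : 0 <= A -> 0 <= B -> 0 <= C ->
  fB A B C - fA A B C <= - (2 / 3 * (A + B + C) ^+ 2).
Proof.
move=> a b c; rewrite /fA /fB /fbeta /bdiag -subr_ge0.
have := mulr_ge0 a b; have := mulr_ge0 b c; have := mulr_ge0 a c.
have := sqr_ge0 A; have := sqr_ge0 B; have := sqr_ge0 C.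
by move=> *; lra.
Qed.

Lemma fA_sub_fC (A B C : R) : fA A B C - fC A B C = - (2 * (A - C) * (A + B + C)).
Proof. by rewrite /fA /fC /bdiag; field. Qed.

Variables (n : R -> nat -> R) (l : R -> nat -> nat -> R).
Hypothesis np : forall s : R, 0 <= s -> forall k, (k < 4)%N -> 0 < n s k.
Hypothesis fl : forall s : R, 0 <= s -> ldl_flow n l s.

Let A s := qA (n s).
Let B s := qB (n s) (l s).
Let C s := qC (n s).
Let rho s := A s + B s + C s.

Let pA (s : R) : 0 <= s -> 0 < A s.
Proof. by move=> s0; rewrite divr_gt0 ?mulr_gt0 ?np. Qed.
Let pC (s : R) : 0 <= s -> 0 < C s.
Proof. by move=> s0; rewrite divr_gt0 ?mulr_gt0 ?np. Qed.
Let pB (s : R) : 0 <= s -> 0 <= B s.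
Proof.
by move=> s0; rewrite mulr_ge0 ?sqr_ge0 // divr_ge0 ?mulr_ge0 // ltW // np.
Qed.
Let prho (s : R) : 0 <= s -> 0 < rho s.
Proof. by move=> s0; have := pA s0; have := pB s0; have := pC s0; rewrite /rho; lra. Qed.

Let dA (s : R) : 0 <= s -> is_derive s (1 : R) A (A s * fA (A s) (B s) (C s)).
Proof. by move=> s0; have [] := reduced_flow (np s0) (fl s0). Qed.
Let dB (s : R) : 0 <= s -> is_derive s (1 : R) B (B s * fB (A s) (B s) (C s)).
Proof. by move=> s0; have [] := reduced_flow (np s0) (fl s0). Qed.
Let dC (s : R) : 0 <= s -> is_derive s (1 : R) C (C s * fC (A s) (B s) (C s)).
Proof. by move=> s0; have [] := reduced_flow (np s0) (fl s0). Qed.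
Let drho (s : R) : 0 <= s -> is_derive s (1 : R) rho
  (A s * fA (A s) (B s) (C s) + B s * fB (A s) (B s) (C s) + C s * fC (A s) (B s) (C s)).
Proof. by move=> s0; exact: (dr_add (dr_add (dA s0) (dB s0)) (dC s0)). Qed.

Let q0 := rho 0 ^- 2.
Let q0P : 0 < q0. Proof. by rewrite invr_gt0 exprn_gt0 // prho. Qed.

Let rho2 (s : R) : 0 <= s -> (q0 + 6 * s)^-1 <= rho s ^+ 2.
Proof.
move=> s0; apply: (square_lower_bound s0 prho drho) => u u0.
by apply: rho_dot_ge; [exact: ltW (pA u0)|exact: pB|exact: ltW (pC u0)].
Qed.

Lemma rho_cvg0 : rho t @[t --> +oo] --> 0.
Proof.
apply: (decay (k := 4^-1) _ q0P _ drho rho2); first by rewrite invr_gt0.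
  by move=> s s0; exact: ltW (prho s0).
move=> s s0.
by apply: rho_dot_le; [exact: ltW (pA s0)|exact: pB|exact: ltW (pC s0)].
Qed.

Let X s := B s * (A s)^-1.

Let dX (s : R) : 0 <= s ->
  is_derive s (1 : R) X (X s * (fB (A s) (B s) (C s) - fA (A s) (B s) (C s))).
Proof.
move=> s0; have z := lt0r_neq0 (pA s0).
apply: dr_eq (dr_mul (dB s0) (dr_inv z (dA s0))) _.
rewrite /X; move: (fA _ _ _) (fB _ _ _) => a b; field.
exact: z.
Qed.

Let X0 (s : R) : 0 <= s -> 0 <= X s.
Proof. by move=> s0; rewrite divr_ge0 ?pB // ltW // pA. Qed.

Let dX_le (s : R) : 0 <= s -> X s * (fB (A s) (B s) (C s) - fA (A s) (B s) (C s))
  <= - (2 / 3 * rho s ^+ 2 * X s).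
Proof.
move=> s0; rewrite mulrC -mulNr ler_wpM2r ?X0 //.
by apply: ratio_dot_le; [exact: ltW (pA s0)|exact: pB|exact: ltW (pC s0)].
Qed.

Let X_cvg0 : X t @[t --> +oo] --> 0.
Proof. by apply: (decay (k := 2 / 3) _ q0P X0 dX rho2 dX_le); lra. Qed.

Let X_le (s : R) : 0 <= s -> X s <= X 0.
Proof.
move=> s0; apply: (dr_nincr s0) (fun u h => dX _) _ => [u /andP[]//|u /andP[u0 _]].
apply: le_trans (dX_le u0) _; rewrite oppr_le0 mulr_ge0 ?X0 //.
by rewrite mulr_ge0 ?sqr_ge0 //; lra.
Qed.

(** This is [A / C + C / A - 2]: it vanishes exactly when A = C and, unlike [ln (A / C)], it is
    rational and nonnegative, as [decay] requires. *)
Let r s := (A s + - C s) * (A s + - C s) * (A s * C s)^-1.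

Let dr (s : R) : 0 <= s -> is_derive s (1 : R) r (- (2 * r s * (A s + C s) * rho s)).
Proof.
move=> s0; have zA := lt0r_neq0 (pA s0); have zC := lt0r_neq0 (pC s0).
have dAC := dr_add (dA s0) (dr_opp (dC s0)).
apply: dr_eq (dr_mul (dr_mul dAC dAC) (@dr_inv _ (fun s => A s * C s) s _
  (mulf_neq0 zA zC) (dr_mul (dA s0) (dC s0)))) _.
have e : fA (A s) (B s) (C s) = fC (A s) (B s) (C s) - 2 * (A s - C s) * rho s.
  by have := fA_sub_fC (A s) (B s) (C s); rewrite -/(rho s) => h; lra.
rewrite /r e; move: (fC _ _ _) (rho s) => c h; field.
by rewrite zA zC.
Qed.

Let r0 (s : R) : 0 <= s -> 0 <= r s.
Proof.
by move=> s0; rewrite divr_ge0 -?expr2 ?sqr_ge0 // mulr_ge0 // ltW ?pA ?pC.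
Qed.

Let r_cvg0 : r t @[t --> +oo] --> 0.
Proof.
have x0 : 0 < 1 + X 0 by rewrite ltr_wpDr ?X0.
apply: (decay (k := 2 / (1 + X 0)) _ q0P r0 dr rho2); first by rewrite divr_gt0.
move=> s s0; rewrite lerN2.
(* B is at most [X 0] times A, so [A + C] is comparable to rho and [r] decays at a rate of order
   [rho ^+ 2]. *)
have h : rho s <= (1 + X 0) * (A s + C s).
  have : B s <= X 0 * A s by rewrite -ler_pdivrMr ?pA // X_le.
  have := mulr_ge0 (X0 (lexx 0)) (ltW (pC s0)); rewrite /rho; lra.
have h' : rho s / (1 + X 0) <= A s + C s by rewrite ler_pdivrMr // mulrC.
rewrite (_ : 2 / (1 + X 0) * rho s ^+ 2 * r s = 2 * r s * rho s * (rho s / (1 + X 0)));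
  last by ring.
rewrite (_ : 2 * r s * (A s + C s) * rho s = 2 * r s * rho s * (A s + C s)); last by ring.
apply: ler_wpM2l h'; apply: mulr_ge0; last exact: ltW (prho s0).
by apply: mulr_ge0 => //; exact: r0.
Qed.

(** With [u = C / A] one has [(1 - u)^2 = r u] and [u <= u + 1 / u = r + 2]. *)
Let u_cvg1 : C t / A t @[t --> +oo] --> (1 : R).
Proof.
have h : r t * (r t + 2) @[t --> +oo] --> (0 * (0 + 2) : R).
  by apply: cvgM; [exact: r_cvg0|apply: cvgD; [exact: r_cvg0|exact: cvg_cst]].
rewrite mul0r in h.
apply/cvgrPdist_lt => e e0.
have e2 : 0 < e ^+ 2 by rewrite exprn_gt0.
move/cvgrPdist_lt: h => /(_ _ e2) h.
near=> t.
have t0 : 0 <= t by near: t; apply: nbhs_pinfty_ge; exact: num_real.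
have ht : `|0 - r t * (r t + 2)| < e ^+ 2 by near: t.
rewrite sub0r normrN in ht.
rewrite ger0_norm in ht; last by rewrite mulr_ge0 ?addr_ge0 ?r0.
have zA := pA t0; have zC := pC t0.
have e1 : (1 - C t / A t) ^+ 2 = r t * (C t / A t).
  by rewrite /r; field; rewrite !gt_eqF.
have uP : 0 < C t / A t by rewrite divr_gt0.
have e3 : C t / A t <= r t + 2.
  have -> : r t + 2 = C t / A t + A t / C t by rewrite /r; field; rewrite !gt_eqF.
  by rewrite lerDl divr_ge0 // ltW.
rewrite -(ltr_pXn2r (n := 2)) ?nnegrE // ?ltW // -normrX ger0_norm ?sqr_ge0 // e1.
by apply: le_lt_trans ht; rewrite ler_wpM2l ?r0.
Unshelve. all: by end_near. Qed.

Let ratio_cvg : A t / rho t @[t --> +oo] --> (2^-1 : R).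
Proof.
have h : (1 + X t + C t / A t)^-1 @[t --> +oo] --> ((1 + 0 + 1)^-1 : R).
  apply: cvgV; first by rewrite addr0 gt_eqF.
  by apply: cvgD; [apply: cvgD; [exact: cvg_cst|exact: X_cvg0]|exact: u_cvg1].
rewrite addr0 in h; apply: cvg_trans h; apply: near_eq_cvg.
near=> t.
have t0 : 0 <= t by near: t; apply: nbhs_pinfty_ge; exact: num_real.
have zA := pA t0; have := prho t0; rewrite /rho /X => zr.
by field; rewrite !gt_eqF //; lra.
Unshelve. all: by end_near. Qed.

Let cvg0_of_le (f : R -> R) : (forall t : R, 0 <= t -> 0 <= f t <= rho t) ->
  f t @[t --> +oo] --> (0 : R).
Proof.
move=> h; apply/cvgrPdist_lt => e e0.
have /cvgrPdist_lt/(_ e e0) he : rho t @[t --> +oo] --> (0 : R) by exact: rho_cvg0.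
near=> t.
have t0 : 0 <= t by near: t; apply: nbhs_pinfty_ge; exact: num_real.
have : `|0 - rho t| < e by near: t.
have /andP[h1 h2] := h t t0.
rewrite !sub0r !normrN !ger0_norm //; [lra|exact: ltW (prho t0)].
Unshelve. all: by end_near. Qed.

Lemma qA_cvg0 : qA (n t) @[t --> +oo] --> (0 : R).
Proof.
apply: cvg0_of_le => t t0; have := pA t0; have := pB t0; have := pC t0.
by rewrite /rho -/(A t) => *; apply/andP; split; lra.
Qed.

Lemma qB_cvg0 : qB (n t) (l t) @[t --> +oo] --> (0 : R).
Proof.
apply: cvg0_of_le => t t0; have := pA t0; have := pB t0; have := pC t0.
by rewrite /rho -/(B t) => *; apply/andP; split; lra.
Qed.

Lemma qC_cvg0 : qC (n t) @[t --> +oo] --> (0 : R).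
Proof.
apply: cvg0_of_le => t t0; have := pA t0; have := pB t0; have := pC t0.
by rewrite /rho -/(C t) => *; apply/andP; split; lra.
Qed.

Lemma qA_ratio_cvg : qA (n t) / (qA (n t) + qB (n t) (l t) + qC (n t))
  @[t --> +oo] --> (2^-1 : R).
Proof. exact: ratio_cvg. Qed.

Lemma qB_ratio_cvg : qB (n t) (l t) / (qA (n t) + qB (n t) (l t) + qC (n t))
  @[t --> +oo] --> (0 : R).
Proof.
have h : X t * (A t / rho t) @[t --> +oo] --> (0 * 2^-1 : R).
  by apply: cvgM; [exact: X_cvg0|exact: ratio_cvg].
rewrite mul0r in h; apply: cvg_trans h; apply: near_eq_cvg.
near=> t.
have t0 : 0 <= t by near: t; apply: nbhs_pinfty_ge; exact: num_real.
by rewrite /X mulrA divfK // gt_eqF // pA.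
Unshelve. all: by end_near. Qed.

Lemma qC_ratio_cvg : qC (n t) / (qA (n t) + qB (n t) (l t) + qC (n t))
  @[t --> +oo] --> (2^-1 : R).
Proof.
have h : C t / A t * (A t / rho t) @[t --> +oo] --> (1 * 2^-1 : R).
  by apply: cvgM; [exact: u_cvg1|exact: ratio_cvg].
rewrite mul1r in h; apply: cvg_trans h; apply: near_eq_cvg.
near=> t.
have t0 : 0 <= t by near: t; apply: nbhs_pinfty_ge; exact: num_real.
by rewrite mulrA divfK // gt_eqF // pA.
Unshelve. all: by end_near. Qed.

End Asymptotics.

(** * Pointed convergence and the limit soliton *)

Section Convergence.
Context {R : realType}.
Local Notation V := 'rV[R]_4.
Local Notation jacobian := Defs.jacobian.

(* Polynomial functions depending on t only through coefficients that converge: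
   derivatives then converge uniformly on compact sets. *)
Inductive poly_family : (R -> V -> R) -> (V -> R) -> Prop :=
| fam_cst (c : R -> R) (l : R) : c t @[t --> +oo] --> l ->
    poly_family (fun t _ => c t) (fun=> l)
| fam_coord i : poly_family (fun _ x => x 0 i) (fun x => x 0 i)
| fam_add f g f' g' : poly_family f f' -> poly_family g g' ->
    poly_family (fun t x => f t x + g t x) (fun x => f' x + g' x)
| fam_mul f g f' g' : poly_family f f' -> poly_family g g' ->
    poly_family (fun t x => f t x * g t x) (fun x => f' x * g' x).

Lemma fam_poly f f' : poly_family f f' -> (forall t, poly_fun (f t)) /\ poly_fun f'.
Proof.
elim=> {f f'} [c l _|i|f g f' g' _ [hf hf'] _ [hg hg']|f g f' g' _ [hf hf'] _ [hg hg']].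
- by split=> [t|]; exact: pf_cst.
- by split=> [t|]; exact: pf_coord.
- by split=> [t|]; exact: pf_add.
- by split=> [t|]; exact: pf_mul.
Qed.

Lemma fam_of_poly f : poly_fun f -> poly_family (fun=> f) f.
Proof.
elim=> {f} [c|i|f g _ hf _ hg|f g _ hf _ hg].
- by apply: (fam_cst (c := fun=> c)); exact: cvg_cst.
- exact: fam_coord.
- exact: fam_add.
- exact: fam_mul.
Qed.

Lemma fam_partial i f f' : poly_family f f' ->
  poly_family (fun t => partial i (f t)) (partial i f').
Proof.
elim=> {f f'} [c l _|j|f g f' g' hf IHf hg IHg|f g f' g' hf IHf hg IHg].
- under eq_fun do rewrite partial_cst; rewrite partial_cst.
  by apply: fam_of_poly; exact: pf_cst.
- under eq_fun do rewrite partial_coord; rewrite partial_coord.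
  by apply: fam_of_poly; exact: pf_cst.
- have [pf pf'] := fam_poly hf; have [pg pg'] := fam_poly hg.
  rewrite partialD // (_ : (fun t => _) =
    fun t x => partial i (f t) x + partial i (g t) x); first exact: fam_add.
  by apply/funext => t; rewrite partialD.
- have [pf pf'] := fam_poly hf; have [pg pg'] := fam_poly hg.
  rewrite partialM // (_ : (fun t => _) =
    fun t x => partial i (f t) x * g t x + f t x * partial i (g t) x).
    by apply: fam_add; exact: fam_mul.
  by apply/funext => t; rewrite partialM.
Qed.

Lemma fam_iter_partial s f f' : poly_family f f' ->
  poly_family (fun t => iter_partial s (f t)) (iter_partial s f').
Proof. by move=> h; elim: s => //= i s; exact: fam_partial. Qed.

Lemma poly_bounded f (K : set V) : poly_fun f -> compact K ->
  exists2 M, 0 <= M & forall x, K x -> `|f x| <= M.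
Proof.
move=> pf cK; have [K0|/set0P[x0 Kx0]] := eqVneq K set0.
  by exists 0 => // x; rewrite K0.
have [||c Kc hc] := @compact_EVT_max _ _ (fun x => `|f x|) K _ cK.
- by exists x0.
- apply: continuous_subspaceT => x; apply: continuous_comp; last exact: norm_continuous.
  exact: pf_continuous.
exists `|f c| => // x Kx; apply: hc; exact/mem_set.
Qed.

Lemma fam_uniform f f' (K : set V) : poly_family f f' -> compact K ->
  forall e : R, 0 < e -> \forall t \near +oo, forall x, K x -> `|f t x - f' x| < e.
Proof.
move=> h cK; elim: h => {f f'}
  [c l cl|i|f g f' g' hf IHf hg IHg|f g f' g' hf IHf hg IHg] e e0.
- move/cvgrPdist_lt: cl => /(_ e e0); apply: filterS => t ht x _.
  by rewrite distrC.
- by near=> t => x _; rewrite subrr normr0.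
- have e2 : 0 < e / 2 by rewrite divr_gt0.
  move: (IHf _ e2) (IHg _ e2); apply: filterS2 => t h1 h2 x Kx.
  rewrite opprD addrACA; apply: le_lt_trans (ler_normD _ _) _.
  by have := h1 x Kx; have := h2 x Kx; lra.
- have [_ pf'] := fam_poly hf; have [_ pg'] := fam_poly hg.
  have [M M0 hM] := poly_bounded pf' cK; have [N N0 hN] := poly_bounded pg' cK.
  (* As [d <= 1], the error of the product is at most [d * (1 + N + M)]; the 2 leaves a strict
     margin. *)
  pose d := Num.min 1 (e / (M + N + 2)).
  have s0 : 0 < M + N + 2 by lra.
  have d0 : 0 < d by rewrite lt_min ltr01 divr_gt0.
  have d1 : d <= 1 by rewrite ge_min lexx.
  have d2 : d * (M + N + 2) <= e by rewrite -ler_pdivlMr // ge_min lexx orbT.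
  move: (IHf _ d0) (IHg _ d0); apply: filterS2 => t h1 h2 x Kx.
  rewrite (_ : f t x * g t x - f' x * g' x = (f t x - f' x) * (g t x - g' x)
    + (f t x - f' x) * g' x + f' x * (g t x - g' x)); last by ring.
  apply: le_lt_trans (ler_normD _ _) _.
  apply: le_lt_trans (lerD (ler_normD _ _) (lexx _)) _; rewrite !normrM.
  have := h1 x Kx; have := h2 x Kx; have := hM x Kx; have := hN x Kx.
  move: (normr_ge0 (f t x - f' x)) (normr_ge0 (g t x - g' x)) (normr_ge0 (f' x))
    (normr_ge0 (g' x)).
  move: (`|f t x - f' x|) (`|g t x - g' x|) (`|f' x|) (`|g' x|) => p q r s.
  move=> p0 q0 r0 s1 sN rM qd pd.
  have : p * q <= d * 1 by apply: ler_pM => //; lra.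
  have : p * s <= d * N by apply: ler_pM => //; lra.
  have : r * q <= M * d by apply: ler_pM => //; lra.
  lra.
Unshelve. all: by end_near. Qed.

Definition linear_chart (P : 'M[R]_4) (y : V) : V := y *m P.

Lemma linear_chart_coord P a : poly_fun (fun y => linear_chart P y 0 a).
Proof.
under eq_fun do rewrite mxE; apply: pf_sum => k.
by apply: pf_mul; [exact: pf_coord|exact: pf_cst].
Qed.

Lemma jacobian_linear_chart P y : jacobian (linear_chart P) y = P^T.
Proof.
apply/matrixP => a i; rewrite !mxE.
under eq_fun do rewrite mxE.
rewrite partial_sum => [|k]; last by apply: pf_mul; [exact: pf_coord|exact: pf_cst].
rewrite (bigD1 i) //= big1 ?addr0 => [|k ki];
  (rewrite partialM ?partial_coord ?partial_cst; [|exact: pf_coord|exact: pf_cst]).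
- by rewrite eqxx mul1r mulr0 addr0.
- by rewrite eq_sym (negPf ki) mul0r mulr0 addr0.
Qed.

Lemma linear_chart_diffeo P : P \in unitmx ->
  diffeo_onto_image setT (linear_chart P).
Proof.
move=> uP.
have im : linear_chart P @` setT = setT.
  apply/seteqP; split => // y _; exists (y *m invmx P) => //.
  by rewrite /linear_chart mulmxKV.
split.
- by move=> i; apply: pf_smooth; exact: linear_chart_coord.
- by rewrite im; exact: openT.
- exists (linear_chart (invmx P)); split => [i|x _].
    by apply: pf_smooth; exact: linear_chart_coord.
  by rewrite /linear_chart mulmxK.
Qed.

(** Linear isomorphisms are global diffeomorphisms fixing the base point, so the exhaustion can be
    constant and only the coefficients of the pulled-back metrics vary. *)
Lemma cheeger_gromov_linear (g : R -> V -> 'M[R]_4) (ginf : V -> 'M[R]_4)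
    (P : R -> 'M[R]_4) (h : R -> V -> 'M[R]_4) :
  (forall t, P t \in unitmx) ->
  (forall t : R, 0 <= t -> pullback (linear_chart (P t)) (g t) = h t) ->
  (forall i j, poly_family (fun t y => h t y i j) (fun y => ginf y i j)) ->
  cheeger_gromov_cvg g ginf.
Proof.
move=> uP hP fam; exists (fun=> setT), (fun t => linear_chart (P t)); split.
- by move=> t; split; [exact: openT|].
- by move=> K _; exact: nearW.
- by move=> t; split; [exact: linear_chart_diffeo|rewrite /linear_chart mul0mx].
move=> K cK s i j e e0.
have [_ pinf] := fam_poly (fam i j).
have fd : poly_family (fun t y => h t y i j + - ginf y i j)
    (fun y => ginf y i j + - ginf y i j).
  by apply: fam_add; [exact: fam|apply: fam_of_poly; exact: pf_opp].
have z0 : iter_partial s (fun y => ginf y i j + - ginf y i j) = fun=> 0.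
  under eq_fun do rewrite subrr.
  by elim: s => //= k s ->; rewrite partial_cst.
have := fam_uniform (fam_iter_partial s fd) cK e0; rewrite z0 => H.
near=> t => x Kx.
have t0 : 0 <= t by near: t; apply: nbhs_pinfty_ge; exact: num_real.
rewrite hP // (_ : (fun y => (h t y - ginf y) i j) = fun y => h t y i j + - ginf y i j).
  rewrite -[X in `|X|]subr0; move: x Kx; near: t; exact: H.
by apply/funext => y; rewrite !mxE.
Unshelve. all: by end_near. Qed.

(** The left-invariant metric with an orthonormal frame of constants [a], [b], [c], in the
    exponential coordinates of that frame. It still makes sense at a = b = c = 0, where the group
    becomes abelian and the metric flat. *)
Definition frame_metric (a b c : R) (y : V) : 'M[R]_4 :=
  (theta a b c y)^T *m theta a b c y.

(** A Lie algebra isomorphism is, in exponential coordinates, the group isomorphism itself. The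
    transposes come from points being row vectors. *)
Lemma pullback_frame_metric U a b c : U \in unitmx -> n4_frame_morph U a b c ->
  pullback (linear_chart (invmx U)^T) (linv (U^T *m U)) = frame_metric a b c.
Proof.
move=> uU hU; apply/funext => y.
rewrite /pullback jacobian_linear_chart trmxK /linv /frame_metric.
have e : U *m theta 1 0 1 (y *m (invmx U)^T) *m invmx U = theta a b c y.
  rewrite (theta_frame_morph _ hU) mulmxK //; congr (theta a b c).
  by rewrite -mulmxA -trmx_mul mulmxV // trmx1 mulmx1.
by rewrite -e /linear_chart !trmx_mul !mulmxA !trmxK.
Qed.

Lemma fam_theta (a b c : R -> R) (a' b' c' : R) k j :
  a t @[t --> +oo] --> a' -> b t @[t --> +oo] --> b' -> c t @[t --> +oo] --> c' ->
  poly_family (fun t y => theta (a t) (b t) (c t) y k j) (fun y => theta a' b' c' y k j).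
Proof.
move=> ha hb hc.
under eq_fun do under eq_fun do rewrite thetaE.
under [X in poly_family _ X]eq_fun do rewrite thetaE.
have cst (x : R) : poly_family (fun _ _ => x) (fun=> x).
  by apply: fam_of_poly; exact: pf_cst.
have opp f f' : poly_family f f' -> poly_family (fun t y => - f t y) (fun y => - f' y).
  move=> h; have := fam_mul (cst (-1)) h.
  under eq_fun do under eq_fun do rewrite mulN1r.
  by under [X in poly_family _ X]eq_fun do rewrite mulN1r.
by move: k; apply: ord4_ind; move: j; apply: ord4_ind => /=;
  do ?[exact: cst|exact: fam_coord|exact: (fam_cst ha)|exact: (fam_cst hb)
      |exact: (fam_cst hc)|apply: fam_add|apply: opp|apply: fam_mul].
Qed.

Lemma fam_frame_metric (a b c : R -> R) (a' b' c' : R) i j :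
  a t @[t --> +oo] --> a' -> b t @[t --> +oo] --> b' -> c t @[t --> +oo] --> c' ->
  poly_family (fun t y => frame_metric (a t) (b t) (c t) y i j)
    (fun y => frame_metric a' b' c' y i j).
Proof.
move=> ha hb hc.
have E a0 b0 c0 y : frame_metric a0 b0 c0 y i j =
    theta a0 b0 c0 y 0 i * theta a0 b0 c0 y 0 j + theta a0 b0 c0 y 1 i * theta a0 b0 c0 y 1 j
    + theta a0 b0 c0 y 2 i * theta a0 b0 c0 y 2 j + theta a0 b0 c0 y 3 i * theta a0 b0 c0 y 3 j.
  by rewrite mxE big4 ![(_)^T _ _]mxE.
under eq_fun do under eq_fun do rewrite E.
under [X in poly_family _ X]eq_fun do rewrite E.
by do ?[apply: fam_add]; apply: fam_mul; exact: fam_theta.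
Qed.

End Convergence.

(** * The soliton structure of the standard metric *)

Section Soliton.
Context {R : realType}.
Local Notation V := 'rV[R]_4.
Local Notation theta1 := (theta (R := R) 1 0 1).

(* Since weights 2 and 3 are the sums of weights 0 + 1 and 0 + 2, the diagonal
   matrix is a derivation of n_4; bach_mx 1 0 1 is 35/24 plus this matrix. *)
Definition soliton_weight (i : 'I_4) : R :=
  match nat_of_ord i with
  | 0%N => - (7 / 12) | 1%N => - (7 / 6) | 2 => - (7 / 4) | _ => - (7 / 3)
  end.

(* The Lie derivative counts both slots of the metric, hence the half. *)
Definition soliton_field (x : V) : V := \row_i (soliton_weight i / 2 * x 0 i).

Lemma complete_soliton_field : complete_field soliton_field.
Proof.
split.
  move=> i; apply: pf_smooth; under eq_fun do rewrite mxE.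
  by apply: pf_mul; [exact: pf_cst|exact: pf_coord].
move=> p; exists (fun t => \row_i (p 0 i * expR (soliton_weight i / 2 * t))); split.
  by apply/rowP => i; rewrite !mxE mulr0 expR0 mulr1.
move=> t.
have h i j : is_derive t (1 : R)
    (fun s => (\row_i (p 0 i * expR (soliton_weight i / 2 * s)) : V) i j)
    (soliton_field (\row_i (p 0 i * expR (soliton_weight i / 2 * t))) i j).
  rewrite ord1 !mxE; under eq_fun do rewrite mxE.
  apply: dr_eq (dr_mul (dr_cst t (p 0 j))
    (dr_exp (dr_mul (dr_cst t (soliton_weight j / 2)) (dr_id t)))) _.
  by ring.
have d : derivable (fun s => \row_i (p 0 i * expR (soliton_weight i / 2 * s)) : V) t 1.
  by apply/derivable_mxP => i j; case: (h i j).
apply: DeriveDef => //; rewrite derive_mx //; apply/matrixP => i j; rewrite mxE.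
by case: (h i j).
Qed.

(** The derivation generates automorphisms, under which the Maurer-Cartan form is equivariant; this
    is the infinitesimal form of that equivariance. *)
Lemma lie_theta p i (x : V) :
  \sum_k (soliton_field x 0 k * partial k (fun y => theta1 y p i) x)
  + theta1 x p i * (soliton_weight i / 2) = soliton_weight p / 2 * theta1 x p i.
Proof.
rewrite big4 !partial_theta !thetaE !mxE.
by move: p; apply: ord4_ind; move: i; apply: ord4_ind; rewrite /soliton_weight /=; field.
Qed.

Lemma partial_soliton_field i k (x : V) :
  partial i (fun y => soliton_field y 0 k) x = (i == k)%:R * (soliton_weight k / 2).
Proof.
under eq_fun do rewrite mxE.
rewrite partialZ ?partial_coord; last exact: pf_coord.
by rewrite mulrC.
Qed.

Lemma lie_linv1 x : lie_deriv soliton_field (linv 1%:M) x =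
  linv (\matrix_(i, j) ((i == j)%:R * soliton_weight i)) x.
Proof.
have gE y i j : linv 1%:M y i j = \sum_p theta1 y p i * theta1 y p j.
  by rewrite /linv mulmx1 mxE; apply: eq_bigr => p _; rewrite mxE.
apply/matrixP => i j; rewrite mxE.
transitivity (\sum_p soliton_weight p * (theta1 x p i * theta1 x p j)); last first.
  rewrite /linv mxE; apply: eq_bigr => q _.
  rewrite [X in _ = X * _]mxE (bigD1 q) //= big1 ?addr0 => [|p pq].
    by rewrite [(theta1 x)^T _ _]mxE [X in _ = _ * X * _]mxE eqxx mul1r; ring.
  by rewrite [X in _ * X]mxE (negPf pq) mul0r mulr0.
have pg k : partial k (fun y => linv 1%:M y i j) x = \sum_p
    (partial k (fun y => theta1 y p i) x * theta1 x p j
     + theta1 x p i * partial k (fun y => theta1 y p j) x).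
  rewrite (_ : (fun y => _) = fun y => \sum_p theta1 y p i * theta1 y p j); last first.
    by apply/funext => y; exact: gE.
  rewrite partial_sum => [|p]; last by apply: pf_mul; exact: pf_theta.
  by apply: eq_bigr => p _; rewrite partialM //; exact: pf_theta.
rewrite !big_split /=.
have -> : \sum_k linv 1%:M x k j * partial i (fun y => soliton_field y 0 k) x =
    linv 1%:M x i j * (soliton_weight i / 2).
  rewrite (bigD1 i) //= big1 ?addr0 => [|k ki]; rewrite partial_soliton_field.
    by rewrite eqxx mul1r.
  by rewrite eq_sym (negPf ki) mul0r mulr0.
have -> : \sum_k linv 1%:M x i k * partial j (fun y => soliton_field y 0 k) x =
    linv 1%:M x i j * (soliton_weight j / 2).
  rewrite (bigD1 j) //= big1 ?addr0 => [|k ki]; rewrite partial_soliton_field.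
    by rewrite eqxx mul1r.
  by rewrite eq_sym (negPf ki) mul0r mulr0.
under eq_bigr do rewrite pg mulr_sumr.
rewrite exchange_big gE !mulr_suml -!big_split /=; apply: eq_bigr => p _.
have li := lie_theta p i x; have lj := lie_theta p j x.
rewrite (eq_bigr (fun k =>
    (soliton_field x 0 k * partial k (fun y => theta1 y p i) x) * theta1 x p j
    + theta1 x p i * (soliton_field x 0 k * partial k (fun y => theta1 y p j) x))) => [|k _];
  last by ring.
rewrite big_split /= -mulr_suml -mulr_sumr.
move: li lj; set X := \sum_k _; set Y := \sum_k _ => li lj.
have -> : X = soliton_weight p / 2 * theta1 x p i - theta1 x p i * (soliton_weight i / 2).
  by rewrite -li addrK.
have -> : Y = soliton_weight p / 2 * theta1 x p j - theta1 x p j * (soliton_weight j / 2).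
  by rewrite -lj addrK.
by field.
Qed.

Lemma standard_metric : left_invariant_metric (linv (1%:M : 'M[R]_4)).
Proof.
apply: linv_left_invariant; first exact: trmx1.
move=> v v0; rewrite mulmx1 mxE lt_neqAle sumr_ge0 ?andbT; last first.
  by move=> i _; rewrite mxE -expr2 sqr_ge0.
rewrite eq_sym; apply: contra v0; rewrite psumr_eq0; last first.
  by move=> i _; rewrite mxE -expr2 sqr_ge0.
move=> /allP h; apply/eqP/rowP => i; rewrite [RHS]mxE; apply/eqP.
by have := h i (mem_index_enum i); rewrite mxE -expr2 sqrf_eq0.
Qed.

Lemma standard_soliton : expanding_bach_soliton (linv (1%:M : 'M[R]_4)).
Proof.
split; first by case: standard_metric.
(* The constant is forced: for the diagonal entries [b_i] of [bach_mx 1 0 1] minus lambda to be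
   weights of a derivation, lambda must be [b_0 + b_1 - b_2], which also equals
   [b_0 + b_2 - b_3]. *)
exists (35 / 24), soliton_field; split.
- by lra.
- exact: complete_soliton_field.
move=> x.
have h : n4_frame_morph (1%:M : 'M[R]_4) 1 0 1.
  move=> r p q; rewrite !big4 !mxE.
  by move: r; apply: ord4_ind; move: p; apply: ord4_ind; move: q; apply: ord4_ind;
    rewrite /=; ring.
have := linv_bach_velocity x (unitmx1 _ _) h; rewrite trmx1 !mul1mx !mulmx1 => ->.
rewrite lie_linv1.
have -> : bach_mx 1 0 1 = 35 / 24 *: 1%:M
    + \matrix_(i, j) ((i == j)%:R * soliton_weight i) :> 'M[R]_4.
  apply/matrixP => i j; rewrite !mxE.
  by move: i; apply: ord4_ind; move: j; apply: ord4_ind; rewrite /soliton_weight /=; field.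
rewrite /linv; move: (theta1 x) (\matrix_(i, j) _) => T D.
by rewrite mulmxDr mulmxDl -!scalemxAr -!scalemxAl.
Qed.

End Soliton.

(** * The flow of an arbitrary left-invariant metric *)

Section InvariantSolutions.
Context {R : realType}.
Local Notation V := 'rV[R]_4.

Lemma eq_gram (n n' : nat -> R) (l l' : nat -> nat -> R) :
  (forall k, (k < 4)%N -> n k = n' k) ->
  (forall k j, (k < 4)%N -> (j < k)%N -> l k j = l' k j) ->
  gram n l = gram n' l'.
Proof.
move=> en el; apply/matrixP => i j; rewrite !mxE; apply: eq_bigr => k _.
have e m : unitri l k m = unitri l' k m.
  by rewrite /unitri; case: ifP => // _; case: ifP => // mk; exact: el.
by rewrite en // !e.
Qed.

(** An invariant metric is determined by its value at the identity, so the flow equation read at 0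
    becomes the system for the LDL factors. *)
Lemma solution_ldl (g0 : V -> 'M[R]_4) (eps T : \bar R) (h : R -> V -> 'M[R]_4) t :
  bach_flow_invariant_solution g0 eps T h -> (- eps < t%:E < T)%E ->
  let H s := h s 0 in
  [/\ h t = linv (H t), gram (ldl_n (H t)) (ldl_l (H t)) = H t,
      forall k, (k < 4)%N -> 0 < ldl_n (H t) k &
      ldl_flow (fun s => ldl_n (H s)) (fun s => ldl_l (H s)) t].
Proof.
move=> [_ _ _ sol] tI H; have [li dh] := sol t tI.
have hE := left_invariant_linv li.
have [[_ Hsym Hpos] _] := li.
have gE : gram (ldl_n (H t)) (ldl_l (H t)) = H t by exact: gram_ldl (Hsym 0) (Hpos 0).
have np k : (k < 4)%N -> 0 < ldl_n (H t) k by exact: ldl_n_gt0 (Hsym 0) (Hpos 0) _.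
split => //; apply: ldl_flow_of_gram; [exact: Hsym 0|exact: Hpos 0|move=> i j].
apply: is_derive_entry.
have := dh 0; rewrite hE -/(H t) -[in bach_velocity _]gE gram_bach_velocity //.
by rewrite linv_0.
Qed.

Lemma between_itv (eps T : \bar R) (t s : R) : (0 < eps)%E -> (0 < T)%E ->
  (- eps < t%:E < T)%E -> Num.min 0 t <= s <= Num.max 0 t -> (- eps < s%:E < T)%E.
Proof.
move=> e0 T0 /andP[h1 h2] /andP[h3 h4].
have e0' : (- eps < 0)%E by rewrite oppe_lt0.
apply/andP; split.
- apply: (@lt_le_trans _ _ (Num.min 0 t)%:E); last by rewrite lee_fin.
  by rewrite /Num.min; case: ifP.
- apply: (@le_lt_trans _ _ (Num.max 0 t)%:E); first by rewrite lee_fin.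
  by rewrite /Num.max; case: ifP.
Qed.

Lemma solution_unique (g0 : V -> 'M[R]_4) (eps T eps' T' : \bar R)
    (h h' : R -> V -> 'M[R]_4) t :
  bach_flow_invariant_solution g0 eps T h ->
  bach_flow_invariant_solution g0 eps' T' h' ->
  (- eps < t%:E < T)%E -> (- eps' < t%:E < T')%E -> h t = h' t.
Proof.
move=> sh sh' tI tI'; have [e0 T0 h0 _] := sh; have [e0' T0' h0' _] := sh'.
have I s := between_itv (s := s) e0 T0 tI.
have I' s := between_itv (s := s) e0' T0' tI'.
have [hE gE _ _] := solution_ldl sh tI; have [hE' gE' _ _] := solution_ldl sh' tI'.
have bt : Num.min 0 t <= t <= Num.max 0 t.
  by rewrite /Num.min /Num.max; case: (ltP 0 t); lra.
have e00 : h 0 0 = h' 0 0 by rewrite h0 h0'.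
have [en el] := @ldl_unique R (fun s => ldl_n (h s 0)) (fun s => ldl_n (h' s 0))
  (fun s => ldl_l (h s 0)) (fun s => ldl_l (h' s 0)) t
  (fun s b => let: And4 _ _ p _ := solution_ldl sh (I s b) in p)
  (fun s b => let: And4 _ _ p _ := solution_ldl sh' (I' s b) in p)
  (fun s b => let: And4 _ _ _ f := solution_ldl sh (I s b) in f)
  (fun s b => let: And4 _ _ _ f := solution_ldl sh' (I' s b) in f)
  (fun k _ => congr1 (fun G => ldl_n G k) e00)
  (fun k j _ _ => congr1 (fun G => ldl_l G k j) e00) t bt.
by rewrite hE hE' -gE -gE' (eq_gram en el).
Qed.

Lemma flow_solution (g0 : V -> 'M[R]_4) (delta : R) (n : R -> nat -> R)
    (l : R -> nat -> nat -> R) :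
  0 < delta -> (forall s k, (k < 4)%N -> 0 < n s k) -> linv (gram (n 0) (l 0)) = g0 ->
  (forall s, - delta < s -> ldl_flow n l s) ->
  bach_flow_invariant_solution g0 delta%:E +oo (fun t => linv (gram (n t) (l t))).
Proof.
move=> d0 np g00 fl; split => //.
- by rewrite g00.
move=> t /andP[td _]; split; first by apply: gram_left_invariant => k; exact: np.
move=> x; rewrite gram_bach_velocity; last by move=> k; exact: np.
by apply: linv_derive; apply: gram_flow; apply: fl; rewrite -lte_fin.
Qed.

Lemma near_ereal_itv (a b : \bar R) (t : R) : (a < t%:E < b)%E ->
  \forall u \near t, (a < u%:E < b)%E.
Proof.
move=> /andP[at_ tb].
have A : \forall u \near t, (a < u%:E)%E.
  case: a at_ => [r| |] //; last by move=> _; apply: (@filterE _ (nbhs t)) => u; rewrite ltNyr.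
  rewrite lte_fin => rt; have rt' : 0 < t - r by rewrite subr_gt0.
  have /cvgrPdist_lt/(_ _ rt') tt : x @[x --> t] --> t by exact: cvg_id.
  near=> u; have : `|t - u| < t - r by near: u.
  by rewrite lte_fin => h; have := ler_norm (t - u); lra.
have B : \forall u \near t, (u%:E < b)%E.
  case: b tb => [r| |] //; last by move=> _; apply: (@filterE _ (nbhs t)) => u; rewrite ltry.
  rewrite lte_fin => rt; have rt' : 0 < r - t by rewrite subr_gt0.
  have /cvgrPdist_lt/(_ _ rt') tt : x @[x --> t] --> t by exact: cvg_id.
  near=> u; have : `|t - u| < r - t by near: u.
  by rewrite lte_fin distrC => h; have := ler_norm (u - t); lra.
by near=> u; apply/andP; split; near: u.
Unshelve. all: by end_near. Qed.

Lemma maximal_solution (g0 : V -> 'M[R]_4) (delta : \bar R) (g1 : R -> V -> 'M[R]_4) :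
  bach_flow_invariant_solution g0 delta +oo g1 ->
  exists (eps : \bar R) (g : R -> V -> 'M[R]_4),
    bach_flow_maximal_solution g0 eps +oo g /\ forall t : R, 0 <= t -> g t = g1 t.
Proof.
move=> s1; have [d0 _ g10 _] := s1.
pose S := [set e | exists T h, bach_flow_invariant_solution g0 e T h].
have Sd : S delta by exists +oo%E, g1.
pose eps := ereal_sup S.
have deps : (delta <= eps)%E by exact: ereal_sup_ubound.
(* Any two invariant solutions agree where both are defined, so they glue. *)
pose at_ (t : R) (M : V -> 'M[R]_4) := exists e T h,
  [/\ bach_flow_invariant_solution g0 e T h, (- e < t%:E < T)%E & M = h t].
have glue t : exists M, (exists M', at_ t M') -> at_ t M.
  (* [g0] is the default at times that no solution reaches. *)
  have [[M' h]|no] := pselect (exists M', at_ t M'); last by exists g0.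
  by exists M'.
have [g hg] := choice glue.
have claim e T h t : bach_flow_invariant_solution g0 e T h -> (- e < t%:E < T)%E ->
    g t = h t.
  move=> sh tI.
  have [|e' [T' [h' [sh' tI' ->]]]] := hg t; first by exists (h t), e, T, h.
  exact: solution_unique sh' sh tI' tI.
have pos t : 0 <= t -> (- delta < t%:E < +oo)%E.
  move=> t0; rewrite ltry andbT; apply: (@lt_le_trans _ _ 0%E).
    by rewrite oppe_lt0.
  by rewrite lee_fin.
exists eps, g; split; last by move=> t t0; apply: claim s1 _; exact: pos.
split; last first.
  move=> e' T' h sh; split; [|exact: leey|].
    by apply: ereal_sup_ubound; exists T', h.
  by move=> t tI x; rewrite (claim _ _ _ _ sh tI).
split => //.
- exact: lt_le_trans d0 deps.
- by move=> x; rewrite (claim _ _ _ _ s1 (pos 0 (lexx _))) g10.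
move=> t /andP[te _].
have [e [T [h [sh tI]]]] : exists e T h,
    bach_flow_invariant_solution g0 e T h /\ (- e < t%:E < T)%E.
  case: (leP 0 t) => t0; first by exists delta, +oo%E, g1; split => //; exact: pos.
  (* For negative [t] the supremum supplies a solution reaching back beyond [t]; its right end is
     positive, so [t] lies in its interval. *)
  have : (- t%:E < eps)%E by rewrite lteNl.
  move=> /ereal_sup_gt[e [T [h sh]] te']; exists e, T, h; split => //.
  rewrite lteNl te' /=; have [_ T0 _ _] := sh; apply: lt_trans T0.
  by rewrite lte_fin.
have [_ _ _ sol] := sh; have [li dh] := sol t tI.
have gt : g t = h t := claim _ _ _ _ sh tI.
(* The interval of [h] is open, so [g] and [h] coincide near [t] and share the derivative. *)
rewrite gt; split => // x; apply: near_eq_is_derive (dh x).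
have := near_ereal_itv tI; apply: filterS => u uI.
by rewrite (claim _ _ _ _ sh uI).
Qed.

End InvariantSolutions.

(** * Pointed limits of the flow and of its rescaling *)

Section Limits.
Context {R : realType}.
Local Notation V := 'rV[R]_4.

Lemma cvg_of_sqr (f q : R -> R) (L : R) : (forall t, 0 <= f t) ->
  (forall t, f t ^+ 2 = q t) -> q t @[t --> +oo] --> L ->
  f t @[t --> +oo] --> Num.sqrt L.
Proof.
move=> f0 fq qL.
have -> : f = Num.sqrt \o q.
  by apply/funext => t; rewrite /= -fq sqrtr_sqr ger0_norm.
by apply: cvg_comp qL _; exact: sqrt_continuous.
Qed.

(** For [fr_b], whose sign is that of [qbeta]; the limit 0 makes the sign harmless. *)
Lemma cvg0_of_sqr (f q : R -> R) : (forall t, f t ^+ 2 = q t) ->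
  q t @[t --> +oo] --> (0 : R) -> f t @[t --> +oo] --> (0 : R).
Proof.
move=> fq q0; apply/norm_cvg0P; rewrite -[X in _ --> X]sqrtr0.
by apply: (@cvg_of_sqr (fun t => `|f t|) q) => // t; rewrite -normrX ger0_norm ?sqr_ge0.
Qed.

(** Serves both limits: A = C = 0 gives the flat metric, A = C = 1 the standard metric. *)
Lemma cheeger_gromov_gram (g : R -> V -> 'M[R]_4) (n : R -> nat -> R)
    (l : R -> nat -> nat -> R) (A C : R) :
  (forall t k, (k < 4)%N -> 0 < n t k) ->
  (forall t : R, 0 <= t -> g t = linv (gram (n t) (l t))) ->
  qA (n t) @[t --> +oo] --> A -> qB (n t) (l t) @[t --> +oo] --> (0 : R) ->
  qC (n t) @[t --> +oo] --> C ->
  cheeger_gromov_cvg g (frame_metric (Num.sqrt A) 0 (Num.sqrt C)).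
Proof.
move=> np gE qAc qBc qCc.
have sq t := fr_sqr (l t) (np t).
apply: (cheeger_gromov_linear (P := fun t => (invmx (gram_root (n t) (l t)))^T)
  (h := fun t => frame_metric (fr_a (n t)) (fr_b (n t) (l t)) (fr_c (n t)))).
- by move=> t; rewrite unitmx_tr unitmx_inv gram_root_unit // => k; exact: np.
- move=> t t0; rewrite gE // -(gram_rootE (l t) (np t)).
  apply: pullback_frame_metric; first by apply: gram_root_unit => k; exact: np.
  by apply: gram_root_morph => k; exact: np.
move=> i j; apply: fam_frame_metric.
- apply: cvg_of_sqr qAc => t; last by rewrite sq.
  by rewrite /fr_a divr_ge0 ?mulr_ge0 ?sqrtr_ge0.
- by apply: cvg0_of_sqr qBc => t; rewrite sq.
- apply: cvg_of_sqr qCc => t; last by rewrite sq.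
  by rewrite /fr_c divr_ge0 ?mulr_ge0 ?sqrtr_ge0.
Qed.

Lemma frame_metric000 : frame_metric 0 0 0 = euclidean_metric (R := R).
Proof.
apply/funext => y; rewrite /frame_metric /euclidean_metric.
have -> : theta 0 0 0 y = 1%:M.
  apply/matrixP => i j; rewrite thetaE mxE.
  by move: i; apply: ord4_ind; move: j; apply: ord4_ind => /=; ring.
by rewrite trmx1 mulmx1.
Qed.

Lemma linv_scale (c : R) (G : 'M[R]_4) x : linv (c *: G) x = c *: linv G x.
Proof. by rewrite /linv -scalemxAr -scalemxAl. Qed.

Lemma gram_scale (c : R) n (l : nat -> nat -> R) :
  gram (fun k => c * n k) l = c *: gram n l.
Proof.
apply/matrixP => i j; rewrite !mxE mulr_sumr; apply: eq_bigr => k _.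
by rewrite !mulrA.
Qed.

End Limits.

Theorem theorem1 (R : realType) (g0 : 'rV[R]_4 -> 'M[R]_4)
    (hg0 : left_invariant_metric g0) :
  exists (eps T : \bar R) (g : R -> 'rV[R]_4 -> 'M[R]_4),
    [/\ bach_flow_maximal_solution g0 eps T g,
        T = +oo%E,
        cheeger_gromov_cvg g euclidean_metric &
        exists ginf : 'rV[R]_4 -> 'M[R]_4,
          [/\ left_invariant_metric ginf,
              expanding_bach_soliton ginf &
              cheeger_gromov_cvg
                (fun (t : R) (x : 'rV[R]_4) => `|scal (g t) x| *: g t x)
                ginf]].
Proof.
have g0E := left_invariant_linv hg0; have [[_ gsym gpos] _] := hg0.
have n0P k : (k < 4)%N -> 0 < ldl_n (g0 0) k by exact: ldl_n_gt0 (gsym 0) (gpos 0) _.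
have [delta [n [l [d0 np n0 l0 fl]]]] := ldl_exists (ldl_l (g0 0)) n0P.
have init : linv (gram (n 0) (l 0)) = g0.
  by rewrite [RHS]g0E (eq_gram n0 l0) (gram_ldl (gsym 0) (gpos 0)).
have [eps [g [gmax gE]]] := maximal_solution (flow_solution d0 np init fl).
have np' (s : R) : 0 <= s -> forall k, (k < 4)%N -> 0 < n s k by move=> _ k; exact: np.
have fl' (s : R) : 0 <= s -> ldl_flow n l s by move=> s0; apply: fl; lra.
exists eps, +oo%E, g; split => //.
  rewrite -frame_metric000 -[in X in frame_metric X]sqrtr0 -[in X in frame_metric _ _ X]sqrtr0.
  apply: (cheeger_gromov_gram np gE).
  - exact: qA_cvg0 np' fl'.
  - exact: qB_cvg0 np' fl'.
  - exact: qC_cvg0 np' fl'.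
exists (linv 1%:M); split; [exact: standard_metric|exact: standard_soliton|].
(* [sg] is the absolute value of the scalar curvature. Scaling the metric by it divides A, B and C
   by it, and as it is half of rho, the limit ratios 1/2 become 1. *)
pose sg t := (qA (n t) + qB (n t) (l t) + qC (n t)) / 2.
have sg0 t : 0 < sg t.
  rewrite divr_gt0 // ltr_wpDr ?ltr_wpDr //.
  - by rewrite divr_ge0 ?mulr_ge0 // ltW // np.
  - by rewrite mulr_ge0 ?sqr_ge0 // divr_ge0 ?mulr_ge0 // ltW // np.
  - by rewrite divr_gt0 ?mulr_gt0 ?np.
have nz t k : (k < 4)%N -> n t k != 0 by move=> k4; rewrite gt_eqF // np.
have sz t : sg t != 0 by rewrite gt_eqF.
have lim (f : R -> R) (L : R) :
    f t / (qA (n t) + qB (n t) (l t) + qC (n t)) @[t --> +oo] --> L ->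
    f t / sg t @[t --> +oo] --> 2 * L.
  move=> h; have h2 : 2 * (f t / (qA (n t) + qB (n t) (l t) + qC (n t)))
    @[t --> +oo] --> 2 * L by exact: cvgMl_tmp.
  apply: cvg_trans h2; apply: near_eq_cvg.
  by near=> t; rewrite /sg invf_div /= mulrCA.
pose n' t k := sg t * n t k.
have n'p t k : (k < 4)%N -> 0 < n' t k by move=> k4; rewrite mulr_gt0 // np.
have -> : linv 1%:M = frame_metric (Num.sqrt 1) 0 (Num.sqrt 1) :> ('rV[R]_4 -> _).
  by apply/funext => x; rewrite sqrtr1 /frame_metric /linv mulmx1.
have two : 2 * 2^-1 = 1 :> R by rewrite divff // pnatr_eq0.
apply: (@cheeger_gromov_gram _ _ n' l) => //.
- move=> t t0; apply/funext => x; rewrite gE // gram_scal; last by move=> k; exact: np.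
  by rewrite normrN ger0_norm ?ltW ?sg0 // /n' gram_scale linv_scale.
- rewrite -two; apply: cvg_trans (lim _ _ (qA_ratio_cvg np' fl')).
  apply: near_eq_cvg; near=> t; rewrite /n' /qA.
  by field; rewrite sz !nz.
- rewrite -[0 in X in _ --> X](mulr0 2); apply: cvg_trans (lim _ _ (qB_ratio_cvg np' fl')).
  apply: near_eq_cvg; near=> t; rewrite /n' /qB.
  by field; rewrite sz !nz.
- rewrite -two; apply: cvg_trans (lim _ _ (qC_ratio_cvg np' fl')).
  apply: near_eq_cvg; near=> t; rewrite /n' /qC.
  by field; rewrite sz !nz.
Unshelve. all: by end_near. Qed.
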